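(* Let $x,y>0$, $a_1,a_2\in\mathbb{R}$ and $\sigma_1,\sigma_2\in\mathbb{R}$ with $\sigma_1\sigma_2>0$. Then $$\inf_{V\in\mathcal{V}}\ \lim_{T\to\infty}\frac1T\int_0^T\mathbb{P}(\tau(V)>t)\,\mathrm{d}t=\lim_{T\to\infty}\frac1T\int_0^T\mathbb{P}(\tau(-B)>t)\,\mathrm{d}t$$ and $$\sup_{V\in\mathcal{V}}\ \lim_{T\to\infty}\frac1T\int_0^T\mathbb{P}(\tau(V)>t)\,\mathrm{d}t=\lim_{T\to\infty}\frac1T\int_0^T\mathbb{P}(\tau(B)>t)\,\mathrm{d}t .$$
   Context: $(\Omega,\mathcal{F},(\mathcal{F}_t)_{t\ge0},\mathbb{P})$ is a filtered probability space supporting a fixed standard $(\mathcal{F}_t)$-Brownian motion $B=(B_t)_{t\ge 0}$ ($B_0=0$). $\mathcal{V}$ denotes the set of all standard $(\mathcal{F}_t)$-Brownian motions $V=(V_t)_{t\ge0}$ with $V_0=0$ on this space. (It may be assumed that the space also supports an $(\mathcal{F}_t)$-Brownian motion independent of $B$.) For $V\in\mathcal{V}$ the geometric Brownian motions $X$ and $Y(V)$ are defined by $$X_t=x+\int_0^tX_s(\sigma_1\,\mathrm{d}B_s+a_1\,\mathrm{d}s),\qquad Y_t(V)=y+\int_0^tY_s(V)(\sigma_2\,\mathrm{d}V_s+a_2\,\mathrm{d}s).$$ The coupling time is $\tau(V):=\inf\{t\ge0:\ X_t=Y_t(V)\}$, with $\inf\emptyset:=\infty$. For every $V\in\mathcal{V}$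 the limit $\lim_{T\to\infty}\frac1T\int_0^T\mathbb{P}(\tau(V)>t)\,\mathrm{d}t$ exists and equals $\mathbb{P}(\tau(V)=\infty)$. *)

(* Defs.v *)
From HB Require Import structures.
From mathcomp Require Import all_boot all_order all_algebra.
From mathcomp Require Import all_classical all_reals all_analysis.

Set Implicit Arguments.
Unset Strict Implicit.
Unset Printing Implicit Defensive.

Import Order.TTheory GRing.Theory Num.Theory.
Import numFieldNormedType.Exports.

Local Open Scope classical_set_scope.
Local Open Scope ring_scope.

(* A process is a function [R -> T -> R], time first.  Time runs over
   [0, +oo[: values at negative times are never constrained nor used. *)

Section processes.
Context {d : measure_display} {T : measurableType d} {R : realType}.
Variable P : probability T R.
Variable F : R -> set (set T).

Implicit Types (B H X Y : R -> T -> R) (G : set (set T)) (xi : T -> R).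

Definition filtration : Prop :=
  [/\ forall t, 0 <= t -> sigma_algebra setT (F t),
      forall t, 0 <= t -> F t `<=` measurable
    & forall s t, 0 <= s -> s <= t -> F s `<=` F t].

Definition measurable_wrt G xi : Prop :=
  forall U : set R, measurable U -> G (xi @^-1` U).

Definition adapted X : Prop :=
  forall t, 0 <= t -> measurable_wrt (F t) (X t).

Definition continuous_paths X : Prop :=
  forall w, {within `[0, +oo[, continuous (fun t => X t w)}.

Definition independent_of G xi : Prop :=
  forall (A : set T) (U : set R), G A -> measurable U ->
    P (A `&` xi @^-1` U) = (P A * P (xi @^-1` U))%E.

(* Standard Brownian motion relative to the filtration F, started at 0.
   The second parameter of [normal_prob] is the standard deviation. *)
Definition brownian B : Prop :=
  [/\ adapted B,
      continuous_paths B,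
      forall w, B 0 w = 0,
      forall s t, 0 <= s -> s < t ->
        independent_of (F s) (fun w => B t w - B s w)
    & forall s t, 0 <= s -> s < t -> forall U : set R, measurable U ->
        P ((fun w => B t w - B s w) @^-1` U) =
        normal_prob 0 (Num.sqrt (t - s)) U].

(* Encodes \sum_(i < n) xi_i 1_(]t_i, t_{i+1}]), where n = sp_size. *)
Record simple_process := SimpleProcess {
  sp_size : nat;
  sp_time : nat -> R;
  sp_coef : nat -> T -> R
}.

Definition simple_adapted (S : simple_process) : Prop :=
  forall i, (i < sp_size S)%N ->
    [/\ 0 <= sp_time S i, sp_time S i <= sp_time S i.+1,
        measurable_wrt (F (sp_time S i)) (sp_coef S i)
      & exists M : R, forall w, `|sp_coef S i w| <= M].

Definition simple_eval (S : simple_process) : R -> T -> R := fun s w =>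
  \sum_(i < sp_size S)
    sp_coef S i w * \1_(`]sp_time S i, sp_time S i.+1] : set R) s.

Definition simple_integral (S : simple_process) B (t : R) : T -> R := fun w =>
  \sum_(i < sp_size S)
    sp_coef S i w * (B (Num.min (sp_time S i.+1) t) w
                     - B (Num.min (sp_time S i) t) w).

(* Convergence to 0 in probability of nonnegative [0, +oo]-valued functions. *)
Definition cvg0_in_probability (Z : nat -> T -> \bar R) : Prop :=
  forall e : R, 0 < e -> (fun n => P [set w | (e%:E <= Z n w)%E]) @ \oo --> 0%E.

(* [I] is a version of the Ito integral of H with respect to B over [0, t]:
   the limit in probability of the integrals of simple adapted processes S n
   such that \int_0^t (S n - H)^2 ds tends to 0 in probability. *)
Definition is_ito_integral B H (t : R) (I : T -> R) : Prop :=
  measurable_fun setT I /\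
  exists S : nat -> simple_process,
    [/\ forall n, simple_adapted (S n),
        cvg0_in_probability (fun n w =>
          \int[lebesgue_measure]_(s in `[0%R, t])
            ((simple_eval (S n) s w - H s w) ^+ 2)%:E)%E
      & cvg0_in_probability (fun n w =>
          `|simple_integral (S n) B t w - I w|%:E)].

(* X is a (strong) solution of X_t = x + \int_0^t X_s (sigma dB_s + a ds). *)
Definition is_gbm (x sigma a : R) B X : Prop :=
  [/\ adapted X,
      continuous_paths X
    & forall t, 0 <= t -> exists2 I : T -> R,
        is_ito_integral B (fun s w => sigma * X s w) t I &
        {ae P, forall w, X t w =
           x + I w + \int[lebesgue_measure]_(s in `[0, t]) (a * X s w)}].

Definition coupling_time X Y (w : T) : \bar R :=
  ereal_inf [set t%:E | t in [set t : R | 0 <= t /\ X t w = Y t w]].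

(* lim_(T -> oo) T^-1 \int_0^T P(tau > t) dt *)
Definition mean_tail (tau : T -> \bar R) : \bar R :=
  lim ((fun u : R => (u^-1)%:E *
         \int[lebesgue_measure]_(t in `[0%R, u]) P [set w | t%:E < tau w])%E
       @ +oo%R).

End processes.

(* Main.v *)
Require Import Defs.
From HB Require Import structures.
From mathcomp Require Import all_boot all_order all_algebra.
From mathcomp Require Import all_classical all_reals all_analysis.
From mathcomp Require Import measurable_realfun.
From mathcomp Require Import ring lra.

Set Implicit Arguments.
Unset Strict Implicit.
Unset Printing Implicit Defensive.

Import Order.TTheory GRing.Theory Num.Theory.
Import numFieldNormedType.Exports.

Local Open Scope classical_set_scope.
Local Open Scope ring_scope.

(** The logarithms turn the two geometric motions into a drifted process
    [Z t = z + al * B t + be * V t + m * t] with [z > 0], where [al] and [be] have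
    opposite signs and [m] is, up to sign, the difference of
    [a1 - sigma1 ^ 2 / 2] and [a2 - sigma2 ^ 2 / 2]; the coupling time is the
    hitting time of 0 by [Z].  The mean tail is the limit of the probabilities
    that [Z] is positive on [0, t] ([mean_tail_coupling]), so these survival
    probabilities are compared for different [V].

    The comparison rests on the convexity of the exponential instead of
    stochastic calculus for the pair [(B, V)], whose joint law is unknown.  Put
    [s = al - be]; its size is the sum of the sizes of [al] and [be].  Then
    [al * B + be * V] is a barycentre of [s * B] and [- s * V], so for
    [theta = 2 * m / s ^ 2] the process [exp (- theta * Z)] lies below a
    martingale started at [exp (- theta * z)], and Doob's inequality bounds the
    probability of hitting 0 by [exp (- theta * z)] ([hit_upper],
    [survival_ge]).  Put [r = al + be]; then [r * B] or [r * V] is a barycentre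
    of [al * B + be * V] and [r * V] or [r * B], so for
    [theta = 2 * m / r ^ 2] the process [exp (- theta * Z)] lies above a
    martingale started at [exp (- theta * z)], and optional stopping bounds the
    hitting probability from below ([hit_lower], [survival_le]).  For [V = - B]
    the process [Z] is [z + s * B t + m * t], for [V = B] it is
    [z + r * B t + m * t], and a single motion satisfies both bounds with
    equality.  This settles [m > 0]; for [m = 0] a small upward drift is added
    and removed in the limit, and for [m < 0] the process tends to minus infinity
    ([survival_min], [survival_max]).

    The explicit form of the two geometric motions has to be derived from the
    integral equation ([gbm_explicit]).  A stochastic integral of a continuous
    adapted process is the limit in probability of its Riemann sums along suitable
    grids ([ito_riemann]); hence a solution is the limit of its Euler sums.  So is
    the explicit process, by a mean square computation with Gaussian moments
    ([euler_geometric]).  The difference of the two is the limit of its own Euler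
    sums and vanishes by Gronwall's lemma, applied to the mean square of the
    difference stopped when it becomes large ([stopped_mean_sqr0]).  Stopping
    means multiplication by the indicator of the event that the path has been
    small so far, and all martingale arguments take place on finite grids. *)

(** * Real-valued random variables *)

Section real_random_variables.
Context {d : measure_display} {T : measurableType d} {R : realType}.
Variable P : probability T R.
Implicit Types (f g : T -> R) (A : set T).

Definition L1 f : Prop := P.-integrable setT (EFin \o f).
Definition mean f : R := \int[P]_w f w.
Definition L2 f : Prop := measurable_fun setT f /\ L1 (fun w => f w ^+ 2).

Lemma L1_meas f : L1 f -> measurable_fun setT f.
Proof. by move=> /integrableP[/measurable_EFinP]. Qed.

Lemma L1_le f g : measurable_fun setT f -> (forall w, `|f w| <= g w) ->
  L1 g -> L1 f.
Proof.
move=> mf fg; apply: le_integrable => //; first exact/measurable_EFinP.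
by move=> w _ /=; rewrite lee_fin (le_trans (fg w))// ler_norm.
Qed.

Lemma L1_cst c : L1 (cst c).
Proof. exact: finite_measure_integrable_cst. Qed.

Lemma L1D f g : L1 f -> L1 g -> L1 (fun w => f w + g w).
Proof. by move=> /integrableD /[apply]; exact. Qed.

Lemma L1Z c f : L1 f -> L1 (fun w => c * f w).
Proof. by move=> /(integrableZl measurableT c). Qed.

Lemma L1N f : L1 f -> L1 (fun w => - f w).
Proof. by move=> /integrableN. Qed.

Lemma L1B f g : L1 f -> L1 g -> L1 (fun w => f w - g w).
Proof. by move=> Hf /L1N; exact: L1D. Qed.

Lemma L1_sum n (F : nat -> T -> R) : (forall i, (i < n)%N -> L1 (F i)) ->
  L1 (fun w => \sum_(i < n) F i w).
Proof.
elim: n => [_|n IH FL].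
  by under eq_fun do rewrite big_ord0; exact: L1_cst.
under eq_fun do rewrite big_ord_recr/=.
by apply: L1D; [apply: IH => i ni; apply: FL; rewrite ltnS ltnW|exact: FL].
Qed.

Lemma L1_bnd f M : measurable_fun setT f -> (forall w, `|f w| <= M) -> L1 f.
Proof. by move=> mf fM; apply: (L1_le mf fM); exact: L1_cst. Qed.

Lemma L1Mbnd f g M : measurable_fun setT f -> (forall w, `|f w| <= M) ->
  L1 g -> L1 (fun w => f w * g w).
Proof.
move=> mf fM Lg; apply: (L1_le (g := fun w => M * `|g w|)).
- by apply: measurable_funM => //; exact: L1_meas.
- by move=> w; rewrite normrM ler_wpM2r.
- by apply: L1Z; exact: integrable_norm.
Qed.

Lemma L1_indic A f : measurable A -> L1 f -> L1 (fun w => \1_A w * f w).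
Proof.
move=> mA; apply: (@L1Mbnd _ _ 1) => [|w]; first exact: measurable_indic.
by rewrite indicE; case: (_ \in _); rewrite ?normr1 ?normr0.
Qed.

Lemma L1_indic1 A : measurable A -> L1 \1_A.
Proof. exact: integrable_indic. Qed.

Lemma meanD f g : L1 f -> L1 g -> mean (fun w => f w + g w) = mean f + mean g.
Proof. by move=> ? ?; rewrite /mean RintegralD. Qed.

Lemma meanB f g : L1 f -> L1 g -> mean (fun w => f w - g w) = mean f - mean g.
Proof. by move=> ? ?; rewrite /mean RintegralB. Qed.

Lemma meanZ c f : L1 f -> mean (fun w => c * f w) = c * mean f.
Proof. by move=> ?; rewrite /mean RintegralZl. Qed.

Lemma mean_cst c : mean (cst c) = c.
Proof. by rewrite /mean Rintegral_cst//= probability_setT mulr1. Qed.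

Lemma eq_mean f g : (forall w, f w = g w) -> mean f = mean g.
Proof. by move=> fg; apply: eq_Rintegral => w _. Qed.

Lemma mean_le f g : L1 f -> L1 g -> (forall w, f w <= g w) -> mean f <= mean g.
Proof. by move=> Lf Lg fg; apply: le_Rintegral => // w _. Qed.

Lemma mean_ge0 f : (forall w, 0 <= f w) -> 0 <= mean f.
Proof. by move=> f0; apply: Rintegral_ge0. Qed.

Lemma mean_sum n (F : nat -> T -> R) : (forall i, (i < n)%N -> L1 (F i)) ->
  mean (fun w => \sum_(i < n) F i w) = \sum_(i < n) mean (F i).
Proof.
elim: n => [_|n IH FL].
  by rewrite big_ord0 -[RHS]mean_cst; apply: eq_mean => w; rewrite big_ord0.
rewrite big_ord_recr/= -IH; last by move=> i ni; apply: FL; rewrite ltnS ltnW.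
rewrite -meanD; last 2 first.
- by apply: L1_sum => i ni; apply: FL; rewrite ltnS ltnW.
- exact: FL.
by apply: eq_mean => w; rewrite big_ord_recr.
Qed.

Definition prob A : R := fine (P A).

Lemma probE A : measurable A -> P A = (prob A)%:E.
Proof. by move=> mA; rewrite fineK// fin_num_measure. Qed.

Lemma prob_ge0 A : 0 <= prob A.
Proof. by rewrite fine_ge0. Qed.

Lemma le_prob A (C : set T) : measurable A -> measurable C -> A `<=` C ->
  prob A <= prob C.
Proof.
by move=> mA mC AC; rewrite -lee_fin -!probE//; apply: le_measure; rewrite ?inE.
Qed.

Lemma prob_le1 A : measurable A -> prob A <= 1.
Proof. by move=> mA; rewrite -lee_fin -probE//; exact: probability_le1. Qed.

Lemma mean_indic A : measurable A -> mean \1_A = prob A.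
Proof. by move=> mA; rewrite /mean /Rintegral integral_indic// setIT. Qed.

Lemma prob_le_mean A f : measurable A -> L1 f -> (forall w, 0 <= f w) ->
  (forall w, A w -> 1 <= f w) -> prob A <= mean f.
Proof.
move=> mA Lf f0 f1; rewrite -mean_indic//; apply: mean_le => // [|w].
  exact: L1_indic1.
rewrite indicE; case: (boolP (w \in A)) => [/[!inE] /f1//|_]; exact: f0.
Qed.

Lemma markov_mean f e : 0 < e -> L1 f -> (forall w, 0 <= f w) ->
  prob [set w | e <= f w] <= e^-1 * mean f.
Proof.
move=> e0 Lf f0; rewrite -meanZ//; apply: prob_le_mean.
- rewrite -[X in measurable X]setTI.
  by apply: measurable_fun_le => //; exact: L1_meas.
- exact: L1Z.
- by move=> w; rewrite mulr_ge0// invr_ge0 ltW.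
- by move=> w /= ef; rewrite -ler_pdivrMl ?invr_gt0// invrK mulr1.
Qed.

Lemma probU A (C : set T) : measurable A -> measurable C ->
  prob (A `|` C) <= prob A + prob C.
Proof.
move=> mA mC; rewrite -lee_fin EFinD -!probE//; last exact: measurableU.
exact: measureU2.
Qed.

Lemma L2_L1M f g : L2 f -> L2 g -> L1 (fun w => f w * g w).
Proof.
move=> [mf Lf] [mg Lg]; apply: (L1_le (g := fun w => f w ^+ 2 + g w ^+ 2)).
- exact: measurable_funM.
- move=> w; rewrite normrM -(real_normK (num_real (f w))).
  rewrite -(real_normK (num_real (g w))).
  have := sqr_ge0 (`|f w| - `|g w|); rewrite sqrrB.
  have : 0 <= `|f w| * `|g w| by rewrite mulr_ge0.
  lra.
- exact: L1D.
Qed.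

Lemma L2_bnd f M : measurable_fun setT f -> (forall w, `|f w| <= M) -> L2 f.
Proof.
move=> mf fM; split => //; apply: (@L1_bnd _ (M ^+ 2)).
  exact: measurable_funX.
by move=> w; rewrite normrX ler_sqr ?nnegrE// (le_trans _ (fM w)).
Qed.

Lemma L2_L1 f : L2 f -> L1 f.
Proof.
move=> Lf; have L1' : L2 (cst 1) by apply: (@L2_bnd _ 1) => // w; rewrite normr1.
by have := L2_L1M Lf L1'; congr L1; apply/funext => w; rewrite mulr1.
Qed.

Lemma L2D f g : L2 f -> L2 g -> L2 (fun w => f w + g w).
Proof.
move=> Lf Lg; split; first by apply: measurable_funD; [case: Lf|case: Lg].
under eq_fun do rewrite sqrrD -mulr_natl.
apply: L1D; last by case: Lg.
by apply: L1D; [case: Lf|apply: L1Z; exact: L2_L1M].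
Qed.

Lemma L2Z c f : L2 f -> L2 (fun w => c * f w).
Proof.
move=> [mf Lf]; split; first exact: measurable_funM.
by under eq_fun do rewrite exprMn; exact: L1Z.
Qed.

Lemma L2B f g : L2 f -> L2 g -> L2 (fun w => f w - g w).
Proof.
move=> Lf Lg; under eq_fun do rewrite -mulN1r.
by apply: L2D => //; exact: L2Z.
Qed.

Lemma L2_sum n (F : nat -> T -> R) : (forall i, (i < n)%N -> L2 (F i)) ->
  L2 (fun w => \sum_(i < n) F i w).
Proof.
elim: n => [_|n IH FL].
  under eq_fun do rewrite big_ord0.
  by apply: (@L2_bnd _ 0) => // w; rewrite normr0.
under eq_fun do rewrite big_ord_recr/=.
by apply: L2D; [apply: IH => i ni; apply: FL; rewrite ltnS ltnW|exact: FL].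
Qed.

Lemma chebyshev_mean f e : 0 < e -> L2 f ->
  prob [set w | e <= `|f w|] <= (e ^+ 2)^-1 * mean (fun w => f w ^+ 2).
Proof.
move=> e0 [mf Lf].
have -> : [set w | e <= `|f w|] = [set w | e ^+ 2 <= f w ^+ 2].
  apply/seteqP; split => w /=; rewrite -(real_normK (num_real (f w)));
  by rewrite ler_sqr ?nnegrE// ltW.
by apply: markov_mean => // [|w]; rewrite ?exprn_gt0// sqr_ge0.
Qed.

End real_random_variables.

(** * Measurability with respect to the filtration *)

Section filtration_measurability.
Context {d : measure_display} {T : measurableType d} {R : realType}.
Variable G : set (set T).
Hypothesis sG : sigma_algebra setT G.
Implicit Types (f g : T -> R) (A : set T).

Lemma wrtP f :
  measurable_wrt G f <-> measurable_fun setT (f : g_sigma_algebraType G -> R).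
Proof.
split => [mf _ U mU|mf U mU].
  by rewrite setTI; apply: sub_gen_smallest; exact: mf.
have := mf measurableT U mU; rewrite setTI.
by rewrite /measurable/= sigma_algebra_id.
Qed.

Lemma wrt_set A :
  measurable (A : set (g_sigma_algebraType G)) -> G A.
Proof. by rewrite /measurable/= sigma_algebra_id. Qed.

Lemma set_wrt A : G A -> measurable (A : set (g_sigma_algebraType G)).
Proof. exact: sub_gen_smallest. Qed.

Lemma wrt_cst (c : R) : measurable_wrt G (cst c).
Proof. by apply/wrtP; exact: measurable_cst. Qed.

Lemma wrtD f g : measurable_wrt G f -> measurable_wrt G g ->
  measurable_wrt G (fun w => f w + g w).
Proof. by move=> /wrtP mf /wrtP mg; apply/wrtP; exact: measurable_funD. Qed.

Lemma wrtM f g : measurable_wrt G f -> measurable_wrt G g ->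
  measurable_wrt G (fun w => f w * g w).
Proof. by move=> /wrtP mf /wrtP mg; apply/wrtP; exact: measurable_funM. Qed.

Lemma wrt_comp (h : R -> R) f : measurable_fun setT h ->
  measurable_wrt G f -> measurable_wrt G (fun w => h (f w)).
Proof.
move=> mh mf U mU; apply: (mf (h @^-1` U)).
by rewrite -[X in measurable X]setTI; exact: mh.
Qed.

Lemma wrtZ c f : measurable_wrt G f -> measurable_wrt G (fun w => c * f w).
Proof. by apply: wrtM; exact: wrt_cst. Qed.

Lemma wrtN f : measurable_wrt G f -> measurable_wrt G (fun w => - f w).
Proof. by move=> /(@wrtZ (-1)); under eq_fun do rewrite mulN1r. Qed.

Lemma wrtB f g : measurable_wrt G f -> measurable_wrt G g ->
  measurable_wrt G (fun w => f w - g w).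
Proof. by move=> mf mg; apply: wrtD => //; exact: wrtN. Qed.

Lemma wrt_sum n (f : nat -> T -> R) :
  (forall i, (i < n)%N -> measurable_wrt G (f i)) ->
  measurable_wrt G (fun w => \sum_(i < n) f i w).
Proof.
elim: n => [_|n IH mf].
  by under eq_fun do rewrite big_ord0; exact: wrt_cst.
under eq_fun do rewrite big_ord_recr/=.
by apply: wrtD; [apply: IH => i ni; apply: mf; rewrite ltnS ltnW|exact: mf].
Qed.

Lemma wrt_indic A : G A -> measurable_wrt G (\1_A : T -> R).
Proof.
move=> GA; apply/wrtP.
have := @measurable_indic _ (g_sigma_algebraType G) R setT A (set_wrt GA).
exact.
Qed.

Lemma wrt_le f c : measurable_wrt G f -> G [set w | f w <= c].
Proof. by move=> /(_ `]-oo, c]%classic (measurable_itv _)); rewrite set_itvE. Qed.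

Lemma wrt_ge f c : measurable_wrt G f -> G [set w | c <= f w].
Proof. by move=> /(_ `[c, +oo[%classic (measurable_itv _)); rewrite set_itvE. Qed.

Lemma wrt_lt f c : measurable_wrt G f -> G [set w | f w < c].
Proof. by move=> /(_ `]-oo, c[%classic (measurable_itv _)); rewrite set_itvE. Qed.

Lemma wrt_gt f c : measurable_wrt G f -> G [set w | c < f w].
Proof. by move=> /(_ `]c, +oo[%classic (measurable_itv _)); rewrite set_itvE. Qed.

Lemma wrtU A (C : set T) : G A -> G C -> G (A `|` C).
Proof.
move=> /set_wrt mA /set_wrt mC; apply: wrt_set; exact: measurableU.
Qed.

Lemma wrtI A (C : set T) : G A -> G C -> G (A `&` C).
Proof.
move=> /set_wrt mA /set_wrt mC; apply: wrt_set; exact: measurableI.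
Qed.

Lemma wrtC A : G A -> G (~` A).
Proof. by move=> /set_wrt mA; apply: wrt_set; exact: measurableC. Qed.

Lemma wrtT : G setT.
Proof. by apply: wrt_set; exact: measurableT. Qed.

Lemma wrt_bigcap (A : nat -> set T) : (forall n, G (A n)) ->
  G (\bigcap_n A n).
Proof.
move=> GA; apply: wrt_set.
by apply: bigcapT_measurable => n; exact: set_wrt.
Qed.

End filtration_measurability.

Lemma wrt_mono {d} {T : measurableType d} {R : realType} (G H : set (set T))
  (f : T -> R) : G `<=` H -> measurable_wrt G f -> measurable_wrt H f.
Proof. by move=> GH mf U mU; apply: GH; exact: mf. Qed.

Lemma wrt_meas {d} {T : measurableType d} {R : realType} (G : set (set T))
  (f : T -> R) : G `<=` measurable -> measurable_wrt G f -> measurable_fun setT f.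
Proof. by move=> GH mf _ U mU; rewrite setTI; apply: GH; exact: mf. Qed.

(** * Independence and products of means *)

Section independence.
Context {d : measure_display} {T : measurableType d} {R : realType}.
Variable P : probability T R.
Variable G : set (set T).
Hypothesis Gm : G `<=` measurable.
Local Notation L1 := (L1 P).
Local Notation mean := (mean P).

(** The joint law of [xi] and [eta] is the product of their laws, so the claim
    is Fubini's theorem. *)
Lemma mean_indep (xi eta : T -> R) (h : R -> R) :
  measurable_wrt G xi -> measurable_fun setT eta -> measurable_fun setT h ->
  independent_of P G eta -> L1 xi -> L1 (h \o eta) ->
  L1 (fun w => xi w * h (eta w)) /\
  mean (fun w => xi w * h (eta w)) = mean xi * mean (h \o eta).
Proof.
move=> Gxi meta mh ind Lxi Leta.
have mxi := wrt_meas Gm Gxi.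
pose X : {mfun T >-> R} := HB.pack xi (isMeasurableFun.Build _ _ _ _ _ mxi).
pose Y : {mfun T >-> R} := HB.pack eta (isMeasurableFun.Build _ _ _ _ _ meta).
pose m1 := distribution P X; pose m2 := distribution P Y.
pose Z w := (xi w, eta w).
have mZ : measurable_fun setT Z by exact: measurable_fun_pair.
pose k (z : R * R) : R := z.1 * h z.2.
have mk : measurable_fun setT k.
  by apply: measurable_funM => //; exact: measurableT_comp.
have law (U : set (R * R)) : measurable U -> (m1 \x m2)%E U = pushforward P Z U.
  apply: (@product_measure_unique _ _ _ _ _ m1 m2 (pushforward P Z)).
  move=> A B mA mB /=.
  rewrite /pushforward/= -(ind (xi @^-1` A) B)//; exact: Gxi.
have iE (f : R * R -> \bar R) :
    (\int[m1 \x m2]_z f z = \int[pushforward P Z]_z f z)%E.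
  by apply: eq_measure_integral => A mA _; exact: law.
have ik : (m1 \x m2)%E.-integrable setT (EFin \o k).
  apply/integrable12ltyP; first exact/measurable_EFinP.
  have -> : (\int[m1]_x \int[m2]_y `|(EFin \o k) (x, y)| =
      \int[m1]_x (`|x|%:E * \int[m2]_y `|h y|%:E))%E.
    apply: eq_integral => x _; rewrite -ge0_integralZl//; last first.
      by apply/measurable_EFinP; exact: measurableT_comp.
    by apply: eq_integral => y _; rewrite /= normrM EFinM.
  rewrite ge0_integralZr//; last 2 first.
  - by apply/measurable_EFinP; exact: normr_measurable.
  - exact: integral_ge0.
  rewrite !ge0_integral_distribution//; last 2 first.
  - by apply/measurable_EFinP; exact: measurableT_comp.
  - by apply/measurable_EFinP; exact: normr_measurable.
  move/integrableP : Lxi => [_ lxi]; move/integrableP : Leta => [_ leta].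
  have lxi0 : (0 <= \int[P]_x `|(EFin \o xi) x|)%E by exact: integral_ge0.
  by apply: lte_mul_pinfty => //; rewrite ge0_fin_numE.
have Lp : L1 (fun w => xi w * h (eta w)).
  apply/integrableP; split.
    apply/measurable_EFinP; apply: measurable_funM => //.
    exact: measurableT_comp.
  move/integrableP : ik => [_]; rewrite iE ge0_integral_pushforward//.
  by apply/measurable_EFinP; exact: measurableT_comp.
split=> //.
rewrite /mean /Rintegral.
have -> : (\int[P]_w (xi w * h (eta w))%:E = \int[m1 \x m2]_z (k z)%:E)%E.
  by rewrite iE integral_pushforward//; exact/measurable_EFinP.
rewrite -integral12_prod_meas1//.
have -> : (\int[m1]_x fubini_F m2 (EFin \o k) x =
    \int[m1]_x (x%:E * (mean (h \o eta))%:E))%E.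
  apply: eq_integral => x _; rewrite /fubini_F/=.
  under eq_integral do rewrite EFinM.
  have ih : m2.-integrable setT (EFin \o h).
    by apply: integrable_pushforward => //; exact/measurable_EFinP.
  rewrite integralZl//; congr (_ * _)%E.
  rewrite integral_distribution//; last exact/measurable_EFinP.
  by rewrite /mean /Rintegral fineK//; exact: integrable_fin_num.
have ii : m1.-integrable setT (EFin : R -> \bar R).
  by apply: integrable_pushforward => //; exact/measurable_EFinP.
rewrite integralZr// integral_distribution//.
by rewrite fineM// integrable_fin_num.
Qed.

End independence.

(** * Gaussian moments *)

Section normal_integral.
Context {R : realType}.
Local Notation mu := (@lebesgue_measure R).

Lemma ge0_integral_normal_prob (m s : R) (f : R -> \bar R) :
  measurable_fun setT f -> (forall x, (0 <= f x)%E) ->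
  (\int[normal_prob m s]_x f x = \int[mu]_x (f x * (normal_pdf m s x)%:E))%E.
Proof.
move=> mf f0; have dom := @normal_prob_dominates R m s.
rewrite -(Radon_Nikodym_SigmaFinite.change_of_variables dom)//.
have i2 : mu.-integrable setT (Radon_Nikodym_SigmaFinite.f (normal_prob m s) mu).
  exact: Radon_Nikodym_SigmaFinite.f_integrable.
have mpdf : measurable_fun setT (fun x => (normal_pdf m s x)%:E).
  by apply/measurable_EFinP; exact: measurable_normal_pdf.
apply: ae_eq_integral => //.
- by apply: emeasurable_funM => //; exact: measurable_int i2.
- exact: emeasurable_funM.
- apply: ae_eqe_mul2l; apply: integral_ae_eq => // E _ mE.
  by rewrite -Radon_Nikodym_SigmaFinite.f_integral.
Qed.

(** Completing the square: an exponential weight shifts the mean. *)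
Lemma expR_normal_pdf (c s x : R) : s != 0 ->
  expR (c * x) * normal_pdf 0 s x =
  expR (c ^+ 2 * s ^+ 2 / 2) * normal_pdf (c * s ^+ 2) s x.
Proof.
move=> s0; rewrite !normal_pdfE// /normal_fun.
rewrite mulrCA [RHS]mulrCA -!expRD; congr (_ * expR _).
by field.
Qed.

Lemma integral_expR_normal (c s : R) : s != 0 ->
  (\int[normal_prob 0 s]_x (expR (c * x))%:E =
   (expR (c ^+ 2 * s ^+ 2 / 2))%:E)%E.
Proof.
move=> s0; rewrite ge0_integral_normal_prob//; last first.
  by apply/measurable_EFinP; apply: measurableT_comp.
under eq_integral do rewrite -EFinM expR_normal_pdf// EFinM.
rewrite ge0_integralZl//.
- by rewrite integral_normal_pdf mule1.
- by apply/measurable_EFinP; exact: measurable_normal_pdf.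
- by move=> x _; rewrite lee_fin normal_pdf_ge0.
Qed.

End normal_integral.

Section gaussian_moments.
Context {d : measure_display} {T : measurableType d} {R : realType}.
Variable P : probability T R.
Variables (eta : T -> R) (v : R).
Hypotheses (meta : measurable_fun setT eta) (v0 : 0 < v).
Hypothesis law : forall U : set R, measurable U ->
  P (eta @^-1` U) = normal_prob 0 (Num.sqrt v) U.
Local Notation L1 := (L1 P).
Local Notation mean := (mean P).

Let sv : Num.sqrt v ^+ 2 = v. Proof. by rewrite sqr_sqrtr// ltW. Qed.
Let s0 : Num.sqrt v != 0. Proof. by rewrite gt_eqF// sqrtr_gt0. Qed.

Let mgf c : (\int[P]_w (expR (c * eta w))%:E = (expR (c ^+ 2 * v / 2))%:E)%E.
Proof.
rewrite -[in RHS]sv -integral_expR_normal//.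
have mf : measurable_fun setT (fun x : R => (expR (c * x))%:E).
  by apply/measurable_EFinP/measurableT_comp => //; exact: measurable_funM.
have meta' : measurable_fun setT (eta : T -> measurableTypeR R) := meta.
pose Y : {mfun T >-> measurableTypeR R} :=
  HB.pack (eta : T -> measurableTypeR R) (isMeasurableFun.Build _ _ _ _ _ meta').
have -> : (\int[normal_prob 0 (Num.sqrt v)]_x (expR (c * x))%:E =
    \int[distribution P Y]_x (expR (c * x))%:E)%E.
  by apply: eq_measure_integral => A mA _; symmetry; exact: law.
by rewrite ge0_integral_distribution.
Qed.

Let mexp c : measurable_fun setT (fun w => expR (c * eta w)).
Proof. by apply: measurableT_comp => //; exact: measurable_funM. Qed.

Lemma gauss_L1_exp c : L1 (fun w => expR (c * eta w)).
Proof.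
apply/integrableP; split; first exact/measurable_EFinP.
under eq_integral do rewrite /= ger0_norm ?expR_ge0//.
by rewrite mgf ltry.
Qed.

Lemma gauss_mean_exp c : mean (fun w => expR (c * eta w)) = expR (c ^+ 2 * v / 2).
Proof. by rewrite /mean /Rintegral mgf. Qed.

Lemma gauss_L2_exp c : L2 P (fun w => expR (c * eta w)).
Proof.
split => //; under eq_fun do rewrite -expRM_natl mulrA.
exact: gauss_L1_exp.
Qed.

Let expR_ge2 (x : R) : 0 <= x -> 1 + x + x ^+ 2 / 2 <= expR x.
Proof.
move=> x0; have -> : 1 + x + x ^+ 2 / 2 = series (exp_coeff x) 3.
  rewrite /series/= !big_nat_recr//= big_nil/= /exp_coeff/=.
  by rewrite add0r expr0 expr1 !factS fact0 !divr1.
rewrite /expR; apply: nondecreasing_cvgn_le; last exact: is_cvg_series_exp_coeff.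
by apply: nondecreasing_series => i _ _; exact: exp_coeff_ge0.
Qed.

Let le_sqr_expR (x : R) : x ^+ 2 <= 2 * (expR x + expR (- x)).
Proof.
wlog x0 : x / 0 <= x.
  move=> H; have [/H//|/ltW x0] := leP 0 x.
  by have := H (- x); rewrite oppr_ge0 opprK sqrrN addrC; exact.
have := expR_ge2 x0; have := expR_ge0 (- x); lra.
Qed.

Let le_mul_sinh (c x : R) : 0 < c ->
  2 * c * x ^+ 2 <= x * expR (c * x) - x * expR (- c * x).
Proof.
move=> c0; wlog x0 : x / 0 <= x.
  move=> H; have [/H//|/ltW x0] := leP 0 x.
  have := H (- x); rewrite oppr_ge0 => /(_ x0).
  have -> : - c * - x = c * x by ring.
  have -> : c * - x = - c * x by ring.
  by rewrite sqrrN; lra.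
have y0 : 0 <= c * x by rewrite mulr_ge0// ltW.
have h1 := expR_ge2 y0.
(* the product of the two second order expansions is 1 + y ^ 4 / 4 *)
have h2 : expR (- (c * x)) <= 1 - c * x + (c * x) ^+ 2 / 2.
  rewrite expRN -div1r ler_pdivrMr ?expR_gt0//.
  have p0 : 0 <= 1 - c * x + (c * x) ^+ 2 / 2.
    by have := sqr_ge0 (c * x - 1); rewrite sqrrB; lra.
  apply: (le_trans _ (ler_wpM2l p0 h1)).
  have -> : (1 - c * x + (c * x) ^+ 2 / 2) * (1 + c * x + (c * x) ^+ 2 / 2) =
    1 + ((c * x) ^+ 2) ^+ 2 / 4 by field.
  by rewrite lerDl divr_ge0// sqr_ge0.
rewrite -mulrBr mulNr; have -> : 2 * c * x ^+ 2 = x * (2 * (c * x)) by ring.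
by rewrite ler_wpM2l//; lra.
Qed.

Lemma gauss_L2 : L2 P eta.
Proof.
split => //; apply: (L1_le (g := fun w => 2 * (expR (1 * eta w) + expR ((-1) * eta w)))).
- exact: measurable_funX.
- by move=> w; rewrite ger0_norm ?sqr_ge0// mul1r mulN1r.
- by apply: L1Z; apply: L1D; exact: gauss_L1_exp.
Qed.

(** The exponential lies above its tangents, so the increment of the moment
    generating function from [c] to [c + h] is at least [h] times this mean, for
    all [h] of either sign: the mean is its derivative at [c]. *)
Lemma gauss_mean_mul_exp c :
  mean (fun w => eta w * expR (c * eta w)) = c * v * expR (c ^+ 2 * v / 2).
Proof.
set m := mean _.
have Lm : L1 (fun w => eta w * expR (c * eta w)).
  by apply: L2_L1M; [exact: gauss_L2|exact: gauss_L2_exp].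
pose psi h : R := expR ((c + h) ^+ 2 * v / 2) - expR (c ^+ 2 * v / 2) - h * m.
have psi0 h : 0 <= psi h.
  rewrite /psi subr_ge0 /m -meanZ// -!gauss_mean_exp -meanB; last 2 first.
    exact: gauss_L1_exp.
    exact: gauss_L1_exp.
  apply: mean_le => [||w].
  - exact: L1Z.
  - by apply: L1B; exact: gauss_L1_exp.
  - rewrite [(c + h) * _]mulrDl expRD.
    have := ler_wpM2l (expR_ge0 (c * eta w)) (expR_ge1Dx (h * eta w)).
    by lra.
have dpsi : is_derive (0 : R) 1 psi (c * v * expR (c ^+ 2 * v / 2) - m).
  rewrite /psi; apply: is_derive_eq.
  by rewrite /GRing.scale/= !addr0 [- _ * 0]mulr0; field.
have [_ d0] : is_derive (0 : R) 1 psi 0.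
  apply: (@derive1_at_min _ _ (-1) 1) => [|h _||h _].
  - lra.
  - by rewrite /psi; exact: ex_derive.
  - by rewrite in_itv/=; lra.
  - by rewrite {1}/psi addr0 mul0r subrr subr0; exact: psi0.
by case: dpsi => _; rewrite d0 => /eqP; rewrite eq_sym subr_eq0 => /eqP.
Qed.

Lemma gauss_mean0 : mean eta = 0.
Proof.
have := gauss_mean_mul_exp 0; rewrite mul0r mul0r => <-.
by apply: eq_mean => w; rewrite mul0r expR0 mulr1.
Qed.

(** The means of both sides of
    [2 * c * x ^+ 2 <= x * expR (c * x) - x * expR (- c * x)] are compared as
    [c] tends to 0. *)
Lemma gauss_var_le : mean (fun w => eta w ^+ 2) <= v.
Proof.
set m := mean _.
have L2e := gauss_L2.
have le u : 0 < u -> m <= v * expR u.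
  move=> u0; pose c := Num.sqrt (2 * u / v).
  have c0 : 0 < c by rewrite sqrtr_gt0 divr_gt0// mulr_gt0.
  have Lm a : L1 (fun w => eta w * expR (a * eta w)).
    by apply: L2_L1M => //; exact: gauss_L2_exp.
  have : 2 * c * m <= 2 * c * (v * expR u).
    rewrite /m -meanZ; last by case: L2e.
    have -> : 2 * c * (v * expR u) = c * v * expR (c ^+ 2 * v / 2) -
        (- c) * v * expR ((- c) ^+ 2 * v / 2).
      rewrite sqrrN; have -> : c ^+ 2 * v / 2 = u.
        by rewrite sqr_sqrtr ?divr_ge0 ?mulr_ge0 ?ltW//; field; rewrite gt_eqF.
      by ring.
    rewrite -!gauss_mean_mul_exp -meanB//; apply: mean_le.
    - by apply: L1Z; case: L2e.
    - exact: L1B.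
    - by move=> w; exact: le_mul_sinh.
  by rewrite ler_pM2l// mulr_gt0.
have [m0|m0] := leP m 0; first by rewrite (le_trans m0)// ltW.
have mv0 : 0 < m / v by rewrite divr_gt0.
suff : ln (m / v) <= 0 by rewrite -ler_expR lnK ?posrE// expR0 ler_pdivrMr// mul1r.
apply/ler_addgt0Pl => e e0; rewrite addr0.
by rewrite -ler_expR lnK ?posrE// ler_pdivrMr// mulrC le.
Qed.

End gaussian_moments.

(** * Martingale transforms of Brownian increments *)

Lemma chain_le {R : realType} (tm : nat -> R) n :
  (forall j, (j < n)%N -> tm j < tm j.+1) ->
  forall i j, (i <= j)%N -> (j <= n)%N -> tm i <= tm j.
Proof.
move=> tmS i; elim=> [|j IH]; first by rewrite leqn0 => /eqP ->.
rewrite leq_eqVlt => /predU1P[-> //|ij jn].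
by rewrite (le_trans (IH ij (ltnW jn)))// ltW// tmS.
Qed.

Section brownian_transforms.
Context {d : measure_display} {T : measurableType d} {R : realType}.
Variable P : probability T R.
Variable F : R -> set (set T).
Hypothesis hF : filtration F.
Variable B : R -> T -> R.
Hypothesis hB : brownian P F B.
Local Notation L1 := (L1 P).
Local Notation L2 := (L2 P).
Local Notation mean := (mean P).
Local Notation prob := (prob P).

Let sF t : 0 <= t -> sigma_algebra setT (F t). Proof. by case: hF => + _ _; exact. Qed.
Let mF t : 0 <= t -> F t `<=` measurable. Proof. by case: hF => _ + _; exact. Qed.

Lemma brownian_adapted t : 0 <= t -> measurable_wrt (F t) (B t).
Proof. by case: hB => + _ _ _ _; exact. Qed.

Lemma brownian_meas t : 0 <= t -> measurable_fun setT (B t).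
Proof. by move=> t0; apply: (wrt_meas (mF t0)); exact: brownian_adapted. Qed.

Lemma incr_adapted s t : 0 <= s -> s <= t ->
  measurable_wrt (F t) (fun w => B t w - B s w).
Proof.
move=> s0 st; have t0 := le_trans s0 st.
apply: (wrtB (sF t0)); first exact: brownian_adapted.
by apply: wrt_mono (brownian_adapted s0); case: hF => _ _; exact.
Qed.

Lemma incr_meas s t : 0 <= s -> s <= t ->
  measurable_fun setT (fun w => B t w - B s w).
Proof.
by move=> s0 st; apply: (wrt_meas (mF (le_trans s0 st))); exact: incr_adapted.
Qed.

Lemma incr_law s t : 0 <= s -> s < t -> forall U : set R, measurable U ->
  P ((fun w => B t w - B s w) @^-1` U) = normal_prob 0 (Num.sqrt (t - s)) U.
Proof. by case: hB => _ _ _ _; exact. Qed.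

Lemma incr_indep s t (xi : T -> R) (h : R -> R) : 0 <= s -> s < t ->
  measurable_wrt (F s) xi -> measurable_fun setT h ->
  L1 xi -> L1 (fun w => h (B t w - B s w)) ->
  L1 (fun w => xi w * h (B t w - B s w)) /\
  mean (fun w => xi w * h (B t w - B s w)) =
  mean xi * mean (fun w => h (B t w - B s w)).
Proof.
move=> s0 st Fxi mh Lxi Lh.
apply: (@mean_indep _ _ _ P _ (mF s0) xi (fun w => B t w - B s w) h) => //.
  by apply: incr_meas => //; exact: ltW.
by case: hB => _ _ _ + _; exact.
Qed.

(** Orthogonality of the terms: given the past, each increment is centred, so
    the mixed products vanish. *)
Lemma transform_L2 (tm : nat -> R) (h : nat -> R -> R) (U : nat -> T -> R)
    (v : nat -> R) n :
  0 <= tm 0%N -> (forall j, (j < n)%N -> tm j < tm j.+1) ->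
  (forall j, (j < n)%N -> measurable_fun setT (h j)) ->
  (forall j, (j < n)%N -> L2 (fun w => h j (B (tm j.+1) w - B (tm j) w))) ->
  (forall j, (j < n)%N -> mean (fun w => h j (B (tm j.+1) w - B (tm j) w)) = 0) ->
  (forall j, (j < n)%N ->
     mean (fun w => h j (B (tm j.+1) w - B (tm j) w) ^+ 2) <= v j) ->
  (forall j, (j < n)%N -> measurable_wrt (F (tm j)) (U j) /\ L2 (U j)) ->
  let M := fun w => \sum_(j < n) U j w * h j (B (tm j.+1) w - B (tm j) w) in
  [/\ measurable_wrt (F (tm n)) M, L2 M &
      mean (fun w => M w ^+ 2) <=
      \sum_(j < n) mean (fun w => U j w ^+ 2) * v j].
Proof.
move=> tm0; elim: n => [|n IH] tmS mh Lh mean0 var_le FU /=.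
  under eq_fun do rewrite big_ord0; split; first exact: (wrt_cst (sF tm0)).
    by apply: (@L2_bnd _ _ _ _ _ 0) => // w; rewrite normr0.
  rewrite big_ord0 -[leRHS](mean_cst P 0) le_eqVlt; apply/orP; left; apply/eqP.
  by apply: eq_mean => w; rewrite big_ord0 expr0n.
have ltS j : (j < n)%N -> (j < n.+1)%N by move=> jn; rewrite ltnS ltnW.
have := IH (fun j jn => tmS j (ltS j jn)) (fun j jn => mh j (ltS j jn))
  (fun j jn => Lh j (ltS j jn)) (fun j jn => mean0 j (ltS j jn))
  (fun j jn => var_le j (ltS j jn)) (fun j jn => FU j (ltS j jn)).
set M := fun w => \sum_(j < n) _; case=> FM LM leM.
have tn0 : 0 <= tm n by rewrite (le_trans tm0)// (chain_le tmS).
have tnS := tmS n (ltnSn n).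
have tnS0 : 0 <= tm n.+1 by rewrite (le_trans tn0)// ltW.
set eta := fun w => h n (B (tm n.+1) w - B (tm n) w).
have [FUn LUn] := FU n (ltnSn n).
have Leta : L2 eta := Lh n (ltnSn n).
have mhn := mh n (ltnSn n).
have Fn : F (tm n) `<=` F (tm n.+1) by case: hF => _ _ /(_ _ _ tn0 (ltW tnS)).
have Feta : measurable_wrt (F (tm n.+1)) eta.
  by apply: wrt_comp => //; apply: incr_adapted => //; exact: ltW.
have [sq1 sq2] : L1 (fun w => U n w ^+ 2 * eta w ^+ 2) /\
    mean (fun w => U n w ^+ 2 * eta w ^+ 2) =
    mean (fun w => U n w ^+ 2) * mean (fun w => eta w ^+ 2).
  apply: (@incr_indep _ _ (fun w => U n w ^+ 2) (fun x => h n x ^+ 2)) => //.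
  - by apply: (wrt_comp (h := fun x => x ^+ 2)).
  - exact: measurable_funX.
  - by case: LUn.
  - by case: Leta.
have [cr1 cr2] : L1 (fun w => (M w * U n w) * eta w) /\
    mean (fun w => (M w * U n w) * eta w) = mean (fun w => M w * U n w) * mean eta.
  apply: incr_indep => //.
  - exact: (wrtM (sF tn0)).
  - exact: L2_L1M.
  - exact: L2_L1.
have LUe : L2 (fun w => U n w * eta w).
  split; first by apply: measurable_funM; [case: LUn|case: Leta].
  by under eq_fun do rewrite exprMn.
have E w : \sum_(j < n.+1) U j w * h j (B (tm j.+1) w - B (tm j) w) =
    M w + U n w * eta w by rewrite big_ord_recr.
under eq_fun do rewrite E; split.
- apply: (wrtD (sF tnS0)); first exact: wrt_mono FM.
  by apply: (wrtM (sF tnS0)) => //; exact: wrt_mono FUn.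
- exact: L2D.
- rewrite big_ord_recr/=.
  have -> : mean (fun w => (\sum_(j < n.+1)
      U j w * h j (B (tm j.+1) w - B (tm j) w)) ^+ 2) =
      mean (fun w => M w ^+ 2) + 2 * mean (fun w => M w * U n w * eta w) +
      mean (fun w => U n w ^+ 2 * eta w ^+ 2).
    rewrite -meanZ// -meanD//; last 2 first.
      by case: LM.
      exact: L1Z.
    rewrite -meanD//; last by apply: L1D; [case: LM|exact: L1Z].
    by apply: eq_mean => w; rewrite E; ring.
  rewrite cr2 [mean eta](mean0 n)// mulr0 mulr0 addr0 sq2 lerD//.
  by rewrite ler_wpM2l ?var_le// mean_ge0// => w; exact: sqr_ge0.
Qed.

Lemma incr_L2 s t : 0 <= s -> s < t -> L2 (fun w => B t w - B s w).
Proof.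
move=> s0 st; apply: gauss_L2 (incr_law s0 st); last by rewrite subr_gt0.
by apply: incr_meas => //; exact: ltW.
Qed.

Lemma incr_mean0 s t : 0 <= s -> s < t -> mean (fun w => B t w - B s w) = 0.
Proof.
move=> s0 st; apply: gauss_mean0 (incr_law s0 st); last by rewrite subr_gt0.
by apply: incr_meas => //; exact: ltW.
Qed.

Lemma incr_var_le s t : 0 <= s -> s < t ->
  mean (fun w => (B t w - B s w) ^+ 2) <= t - s.
Proof.
move=> s0 st; apply: gauss_var_le (incr_law s0 st); last by rewrite subr_gt0.
by apply: incr_meas => //; exact: ltW.
Qed.

(** The integrand is switched off before its accumulated square exceeds
    [delta]; this changes it only on an event of small probability, and the
    stopped sum is bounded in mean square. *)
Lemma transform_prob (tm : nat -> R) (U : nat -> T -> R) n eps delta :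
  0 <= tm 0%N -> (forall j, (j < n)%N -> tm j < tm j.+1) ->
  (forall j, (j < n)%N -> measurable_wrt (F (tm j)) (U j)) ->
  0 < eps -> 0 < delta ->
  prob [set w | eps <= `|\sum_(j < n) U j w * (B (tm j.+1) w - B (tm j) w)|] <=
  prob [set w | delta <= \sum_(j < n) U j w ^+ 2 * (tm j.+1 - tm j)] +
  delta / eps ^+ 2.
Proof.
move=> tm0 tmS FU eps0 delta0.
pose S k w := \sum_(j < k) U j w ^+ 2 * (tm j.+1 - tm j).
pose V j w := \1_[set w | S j.+1 w < delta] w * U j w.
have tj0 j : (j <= n)%N -> 0 <= tm j.
  by move=> jn; rewrite (le_trans tm0)// (chain_le tmS).
have FS j k : (j < n)%N -> (k <= j.+1)%N -> measurable_wrt (F (tm j)) (S k).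
  move=> jn kj; apply: (wrt_sum (sF (tj0 j (ltnW jn)))
    (f := fun i w => U i w ^+ 2 * (tm i.+1 - tm i))) => i ik.
  have ij : (i <= j)%N by rewrite -ltnS (leq_trans ik).
  have jn' := ltnW jn.
  apply: (wrtM (sF (tj0 j jn'))); last exact: (wrt_cst (sF (tj0 j jn'))).
  apply: (wrt_comp (h := fun x => x ^+ 2)) => //.
  apply: wrt_mono (FU i (leq_ltn_trans ij jn)); case: hF => _ _; apply.
    by apply: tj0; rewrite (leq_trans ij).
  exact: (chain_le tmS).
have FV j : (j < n)%N -> measurable_wrt (F (tm j)) (V j).
  move=> jn; have sj := sF (tj0 j (ltnW jn)).
  apply: (wrtM sj); last exact: FU.
  by apply: (wrt_indic sj); apply: wrt_lt; exact: FS.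
have meas_U j : (j < n)%N -> measurable_fun setT (U j).
  by move=> jn; apply: wrt_meas (FU j jn); exact: mF (tj0 j (ltnW jn)).
have meas_V j : (j < n)%N -> measurable_fun setT (V j).
  by move=> jn; apply: wrt_meas (FV j jn); exact: mF (tj0 j (ltnW jn)).
have VU j w : `|V j w| <= `|U j w|.
  by rewrite /V indicE; case: (_ \in _); rewrite ?mul1r// mul0r normr0.
have dt0 j : (j < n)%N -> 0 <= tm j.+1 - tm j.
  by move=> jn; rewrite subr_ge0 ltW// tmS.
have LV j : (j < n)%N -> L2 (V j).
  move=> jn; have dt := tmS j jn; rewrite -subr_gt0 in dt.
  apply: (@L2_bnd _ _ _ _ _ (1 + delta / (tm j.+1 - tm j))) => [|w].
    exact: meas_V.
  have sq : V j w ^+ 2 <= delta / (tm j.+1 - tm j).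
    rewrite ler_pdivlMr// /V indicE.
    case: (boolP (w \in _)) => [|_]; last by rewrite mul0r expr0n mul0r ltW.
    rewrite inE/= mul1r => lt; apply: le_trans (ltW lt).
    rewrite /S big_ord_recr/= lerDr sumr_ge0// => i _.
    by rewrite mulr_ge0 ?sqr_ge0// dt0// (ltn_trans _ jn).
  rewrite -(real_normK (num_real (V j w))) in sq.
  by have := sqr_ge0 (`|V j w| - 1); have := sqr_ge0 `|V j w|; rewrite sqrrB1; lra.
have SV w : forall k, (k <= n)%N ->
    \sum_(j < k) V j w ^+ 2 * (tm j.+1 - tm j) <= delta.
  elim=> [_|k IH kn]; first by rewrite big_ord0 ltW.
  have [lt|ge] := ltP (S k.+1 w) delta.
    apply: (le_trans _ (ltW lt)); apply: ler_sum => i _.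
    rewrite ler_wpM2r//; first by apply: dt0; exact: leq_trans kn.
    rewrite -[V i w ^+ 2](real_normK (num_real _)).
    by rewrite -[U i w ^+ 2](real_normK (num_real _)) ler_sqr ?nnegrE.
  rewrite big_ord_recr/= {2}/V indicE memNset ?mul0r ?expr0n/= ?mul0r ?addr0.
    by apply: IH; exact: ltnW.
  by rewrite /=; apply/negP; rewrite -leNgt.
have same w : S n w < delta -> forall j, (j < n)%N -> V j w = U j w.
  move=> lt j jn; rewrite /V indicE mem_set ?mul1r//=.
  apply: le_lt_trans lt; rewrite /S -!(big_mkord xpredT (fun j => U j w ^+ 2 * (tm j.+1 - tm j))).
  rewrite [leRHS](big_cat_nat (n := j.+1))//= lerDl big_seq sumr_ge0// => i.
  by rewrite mem_index_iota => /andP[_ ?]; rewrite mulr_ge0 ?sqr_ge0// dt0.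
have [_ LM leM] := @transform_L2 tm (fun=> id) V (fun j => tm j.+1 - tm j) n tm0
  tmS (fun _ _ => @measurable_id _ _ _)
  (fun j jn => incr_L2 (tj0 j (ltnW jn)) (tmS j jn))
  (fun j jn => incr_mean0 (tj0 j (ltnW jn)) (tmS j jn))
  (fun j jn => incr_var_le (tj0 j (ltnW jn)) (tmS j jn))
  (fun j jn => conj (FV j jn) (LV j jn)).
set M := fun w => \sum_(j < n) V j w * (B (tm j.+1) w - B (tm j) w) in LM leM.
have mM : measurable_fun setT M by case: LM.
have mS : measurable_fun setT (S n).
  apply: measurable_sum => i; apply: measurable_funM => //.
  by apply: measurable_funX; exact: meas_U.
have mUB : measurable_fun setT
    (fun w => \sum_(j < n) U j w * (B (tm j.+1) w - B (tm j) w)).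
  apply: measurable_sum => i; apply: measurable_funM; first exact: meas_U.
  by apply: incr_meas; [apply: tj0; exact: ltnW|rewrite ltW// tmS].
have mge (f : T -> R) c : measurable_fun setT f -> measurable [set w | c <= f w].
  by move=> mf; rewrite -[X in measurable X]setTI; exact: measurable_fun_le.
apply: (@le_trans _ _ (prob ([set w | delta <= S n w] `|` [set w | eps <= `|M w|]))).
  apply: le_prob.
  - by apply: mge; exact: measurableT_comp.
  - by apply: measurableU; apply: mge => //; exact: measurableT_comp.
  - move=> w /= ew; have [lt|ge] := ltP (S n w) delta; last by left.
    right; rewrite /= /M; move: ew; congr (_ <= `|_|).
    by apply: eq_bigr => i _; rewrite (same w lt).
apply: (le_trans (@probU _ _ _ P _ _ _ _)).
- exact: mge.
- by apply: mge; exact: measurableT_comp.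
rewrite lerD2l (le_trans (chebyshev_mean eps0 LM))//.
rewrite mulrC ler_wpM2r ?invr_ge0 ?exprn_ge0 ?(ltW eps0)//.
apply: (le_trans leM).
have -> : \sum_(j < n) mean (fun w => V j w ^+ 2) * (tm j.+1 - tm j) =
    mean (fun w => \sum_(j < n) V j w ^+ 2 * (tm j.+1 - tm j)).
  rewrite (mean_sum (F := fun j w => V j w ^+ 2 * (tm j.+1 - tm j))).
    apply: eq_bigr => i _; rewrite mulrC -meanZ; last by case: (LV i (ltn_ord i)).
    by apply: eq_mean => w; rewrite mulrC.
  move=> i ni; under eq_fun do rewrite mulrC.
  by apply: L1Z; case: (LV i ni).
rewrite -[leRHS](mean_cst P); apply: mean_le => [||w].
- apply: (L1_sum (F := fun j w => V j w ^+ 2 * (tm j.+1 - tm j))) => i ni.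
  under eq_fun do rewrite mulrC.
  by apply: L1Z; case: (LV i ni).
- exact: L1_cst.
- exact: SV.
Qed.

End brownian_transforms.

(** * Continuous paths, grids and Riemann sums *)

Section continuous_functions.
Context {R : realType}.
Implicit Types f : R -> R.

Lemma path_comp f (h : R -> R) : continuous h ->
  {within `[0, +oo[, continuous f} ->
  {within `[0, +oo[, continuous (fun t => h (f t))}.
Proof.
move=> ch /subspace_continuousP cf; apply/subspace_continuousP => x Ax.
exact: (continuous_cvg _ (ch (f x)) (cf x Ax)).
Qed.

Lemma pathD f (f' : R -> R) : {within `[0, +oo[, continuous f} ->
  {within `[0, +oo[, continuous f'} ->
  {within `[0, +oo[, continuous (fun t => f t + f' t)}.
Proof.
move=> /subspace_continuousP cf /subspace_continuousP cg.
by apply/subspace_continuousP => x Ax; apply: cvgD; [exact: cf|exact: cg].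
Qed.

Lemma pathZ c f : {within `[0, +oo[, continuous f} ->
  {within `[0, +oo[, continuous (fun t => c * f t)}.
Proof. by apply: path_comp => x; exact: mulrl_continuous. Qed.

Lemma pathB f (f' : R -> R) : {within `[0, +oo[, continuous f} ->
  {within `[0, +oo[, continuous f'} ->
  {within `[0, +oo[, continuous (fun t => f t - f' t)}.
Proof.
move=> cf /(@pathZ (-1)) ck.
have -> : (fun t => f t - f' t) = (fun t => f t + (-1) * f' t).
  by apply/funext => t; rewrite mulN1r.
exact: pathD.
Qed.

Lemma path_cst c : {within `[0, +oo[, continuous (cst c : R -> R)}.
Proof. by apply: continuous_subspaceT => x; exact: cst_continuous. Qed.

Lemma path_id : {within `[0, +oo[, continuous (id : R -> R)}.
Proof. by apply: continuous_subspaceT => x; exact: cvg_id. Qed.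

Lemma path_cont f : {within `[0, +oo[, continuous f} ->
  forall x e, 0 <= x -> 0 < e ->
  exists2 del, 0 < del & forall s, 0 <= s -> `|x - s| < del -> `|f x - f s| < e.
Proof.
move=> /subspace_continuousP cf x e x0 e0.
have := cf x; rewrite /= in_itv/= andbT => /(_ x0) /cvgrPdist_lt /(_ e e0).
rewrite /prop_near1 /within /= => -[del /= del0 Hdel].
by exists del => // s s0 xs; apply: Hdel; rewrite /= ?in_itv/= ?andbT.
Qed.

(** Heine-Cantor, from the compactness of [0, t] in its near-covering form. *)
Lemma path_unif_cont f t : {within `[0, +oo[, continuous f} ->
  forall e, 0 < e -> exists2 del, 0 < del &
  forall r s, 0 <= r <= t -> 0 <= s <= t -> `|r - s| <= del -> `|f r - f s| < e.
Proof.
move=> cf e e0.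
have /compact_near_coveringP cpt := @segment_compact R 0 t.
pose Q (del : R) (r : R) := 0 <= r <= t ->
  forall s, 0 <= s <= t -> `|r - s| <= del -> `|f r - f s| < e.
have [x|del /= del0 Hdel] := cpt R (0^'+) Q _.
  rewrite /= in_itv/= => /andP[x0 xt].
  have [del del0 Hdel] := path_cont cf x0 (divr_gt0 e0 (ltr0n _ 2)).
  have del20 : 0 < del / 2 by rewrite divr_gt0.
  exists ([set r | `|x - r| < del / 2], [set i | i < del / 2]).
    split => /=; first by exists (del / 2).
    exact: nbhs_right_lt.
  move=> [r i]/= [xr il] /andP[r0 rt] s /andP[s0 st] rs.
  have h1 : `|f x - f r| < e / 2 by apply: Hdel => //; lra.
  have h2 : `|f x - f s| < e / 2.
    apply: Hdel => //; have := ler_distD r x s; lra.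
  have := ler_distD (f x) (f r) (f s); rewrite (distrC (f r) (f x)); lra.
exists (del / 2); first by rewrite divr_gt0.
move=> r s rt st rs; apply: (Hdel (del / 2)) (rt) s st rs.
- by rewrite /= sub0r normrN gtr0_norm ?divr_gt0//; lra.
- by rewrite divr_gt0.
- by rewrite /= in_itv.
Qed.

Lemma path_bounded f t : {within `[0, +oo[, continuous f} ->
  exists2 M, 0 <= M & forall s, 0 <= s <= t -> `|f s| <= M.
Proof.
move=> cf; have cf' : {within `[0, t], continuous f}.
  by apply: continuous_subspaceW cf => x /=; rewrite !in_itv/= andbT => /andP[].
have [M [_ HM]] := compact_bounded (continuous_compact cf' (@segment_compact R 0 t)).
exists (`|M| + 1); first by rewrite addr_ge0.
move=> s st; apply: HM => /=; last by exists s => //=; rewrite in_itv.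
by rewrite (le_lt_trans (ler_norm M))// ltrDl.
Qed.

Lemma path_measurable f (t : R) : {within `[0, +oo[, continuous f} ->
  measurable_fun `[0, t] f.
Proof.
move=> cf; apply: subspace_continuous_measurable_fun => //.
by apply: continuous_subspaceW cf => x /=; rewrite !in_itv/= andbT => /andP[].
Qed.

Definition grid (t mesh : R) (m : nat) (g : nat -> R) : Prop :=
  [/\ g 0%N = 0, g m = t, forall j, (j < m)%N -> g j < g j.+1
    & forall j, (j < m)%N -> g j.+1 - g j <= mesh].

Lemma grid_range t mesh m g : grid t mesh m g ->
  forall j, (j <= m)%N -> 0 <= g j <= t.
Proof.
move=> [g0 gm gS _] j jm; have := chain_le gS (leq0n j) jm.
by have := chain_le gS jm (leqnn m); rewrite g0 gm => -> ->.
Qed.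

Lemma grid_lt t mesh m g : grid t mesh m g ->
  forall i j, (i <= m)%N -> (j <= m)%N -> (g i < g j) = (i < j)%N.
Proof.
move=> [_ _ gS _] i j im jm; case: (ltnP i j) => ij.
  by rewrite (lt_le_trans (gS i _))// ?(chain_le gS)// (leq_trans ij).
by apply/negbTE; rewrite -leNgt (chain_le gS).
Qed.

Lemma grid_le t mesh m g : grid t mesh m g ->
  forall i j, (i <= m)%N -> (j <= m)%N -> (g i <= g j) = (i <= j)%N.
Proof.
by move=> gr i j im jm; rewrite leNgt (grid_lt gr)// -leqNgt.
Qed.

(** Sort the given points together with those of a uniform grid. *)
Lemma grid_exists t mesh (l : seq R) : 0 <= t -> 0 < mesh ->
  (forall a, a \in l -> 0 <= a <= t) ->
  exists m g, grid t mesh m g /\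
    forall a, a \in l -> exists2 j, (j <= m)%N & g j = a.
Proof.
move=> t0 mesh0 lt.
pose k := (Num.truncn (t / mesh)).+1.
have k0 : 0 < k%:R :> R by rewrite ltr0n.
have tk : t / k%:R <= mesh.
  rewrite ler_pdivrMr// mulrC -ler_pdivrMr//; apply: ltW.
  by have /andP[] := Num.Theory.truncn_itv (divr_ge0 t0 (ltW mesh0)).
pose pts := [seq t / k%:R * i%:R | i <- iota 0 k.+1] ++ l.
have ptsP i : (i <= k)%N -> t / k%:R * i%:R \in pts.
  move=> ik; rewrite mem_cat; apply/orP; left; apply/mapP.
  by exists i => //; rewrite mem_iota/= add0n ltnS.
have ptst a : a \in pts -> 0 <= a <= t.
  rewrite mem_cat => /orP[/mapP[i]|/lt//].
  rewrite mem_iota/= add0n ltnS => ik ->.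
  rewrite mulr_ge0 ?divr_ge0 ?ler0n//= mulrAC ler_pdivrMr//.
  by rewrite ler_wpM2l// ler_nat.
pose s := sort <=%R (undup pts).
have memsP a : (a \in s) = (a \in pts) by rewrite mem_sort mem_undup.
have ss : sorted <%R s by rewrite sort_lt_sorted undup_uniq.
have s0 : 0 \in s by rewrite memsP -(mulr0 (t / k%:R)) (ptsP 0%N).
have st : t \in s.
  have <- : t / k%:R * k%:R = t by rewrite divfK ?gt_eqF.
  by rewrite memsP ptsP.
have sz : (0 < size s)%N by case: (s) s0.
pose m := (size s).-1; pose g := nth 0 s.
have mE : size s = m.+1 by rewrite /m prednK.
have gS j : (j < m)%N -> g j < g j.+1.
  move=> jm; apply: (sorted_ltn_nth lt_trans) => //; rewrite inE mE ltnS//.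
  exact: ltnW.
have gin a : a \in pts -> exists2 j, (j <= m)%N & g j = a.
  move=> ap; exists (index a s); last by rewrite /g nth_index// memsP.
  by rewrite -ltnS -mE index_mem memsP.
have ing j : (j <= m)%N -> g j \in pts.
  by move=> jm; rewrite -memsP mem_nth// mE ltnS.
exists m, g; split; last first.
  by move=> a al; apply: gin; rewrite mem_cat al orbT.
have g0 : g 0%N = 0.
  have [j jm gj] : exists2 j, (j <= m)%N & g j = 0 by apply: gin; rewrite -memsP.
  apply/eqP; rewrite eq_le -{1}gj (chain_le gS)//=.
  by have /andP[] := ptst _ (ing 0%N (leq0n _)).
have gm : g m = t.
  have [j jm gj] : exists2 j, (j <= m)%N & g j = t by apply: gin; rewrite -memsP.
  apply/eqP; rewrite eq_le -{2}gj (chain_le gS)// andbT.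
  by have /andP[] := ptst _ (ing m (leqnn _)).
split => // j jm.
rewrite leNgt; apply/negP => lt'.
(* the first point of the uniform grid beyond g j lies strictly before g j.+1 *)
have ex : exists i, (i <= k)%N && (g j < t / k%:R * i%:R).
  exists k; rewrite leqnn/= divfK ?gt_eqF//.
  by rewrite (lt_le_trans (gS j jm))// -gm (chain_le gS).
case: (ex_minnP ex) => i /andP[ik gji] imin.
have i0 : (0 < i)%N.
  case: i gji {ik imin} => //; rewrite mulr0 => gj0.
  by have /andP[+ _] := ptst _ (ing j (ltnW jm)); rewrite leNgt gj0.
have gj' : t / k%:R * i.-1%:R <= g j.
  rewrite leNgt; apply/negP => H; have := imin i.-1.
  rewrite H (leq_trans (leq_pred _) ik)/= => /(_ isT).
  by rewrite leqNgt prednK ?leqnn.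
have [p pm gp] := gin _ (ptsP i ik).
have iE : t / k%:R * i%:R = t / k%:R * i.-1%:R + t / k%:R.
  by rewrite -{1}(prednK i0) -natr1 mulrDr mulr1.
have jp : (j < p)%N.
  rewrite ltnNge; apply/negP => pj; move: gji; rewrite -gp ltNge.
  by rewrite (chain_le gS)// ltnW.
have : g j.+1 <= g p by rewrite (chain_le gS).
rewrite gp iE leNgt => /negP; apply.
by move: lt'; rewrite ltrBrDr; apply: le_lt_trans; rewrite addrC lerD.
Qed.

Local Notation mu := (@lebesgue_measure R).

Let integrable_cst_oc (a b c : R) : mu.-integrable `]a, b] (EFin \o cst c).
Proof.
apply: measurable_bounded_integrable => //.
  by rewrite /= lebesgue_measure_itv/=; case: ifP => // _; rewrite -EFinB ltry.
by exists `|c|; split; rewrite ?num_real// => x cx y _ /=; exact: ltW.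
Qed.

Lemma riemann_step (t : R) mesh m g (phi : R -> R) (e : nat -> R) (eta : R) :
  grid t mesh m g -> mu.-integrable `[0, t] (EFin \o phi) ->
  (forall j, (j < m)%N -> forall s, g j < s <= g j.+1 -> `|phi s - e j| <= eta) ->
  `|\int[mu]_(s in `[0, t]) phi s - \sum_(j < m) e j * (g j.+1 - g j)| <= eta * t.
Proof.
move=> gr iphi He; have [g0 gm gS _] := gr.
suff H : forall k, (k <= m)%N -> `|\int[mu]_(s in `[0, g k]) phi s -
    \sum_(j < k) e j * (g j.+1 - g j)| <= eta * g k.
  by have := H m (leqnn m); rewrite gm.
elim=> [_|k IH km].
  by rewrite big_ord0 g0 mulr0 set_itv1 Rintegral_set1 subr0 normr0.
have := IH (ltnW km) => {}IH; rewrite big_ord_recr/=.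
have /andP[gk0 gkt] := grid_range gr (ltnW km).
have /andP[gS0 gSt] := grid_range gr km.
have kS := gS k km.
have i1 : mu.-integrable `[0, g k.+1] (EFin \o phi).
  apply: integrableS iphi => // x /=; rewrite !in_itv/= => /andP[-> /le_trans]; exact.
have i2 : mu.-integrable `]g k, g k.+1] (EFin \o phi).
  apply: integrableS i1 => // x /=; rewrite !in_itv/= => /andP[+ ->].
  by rewrite andbT => /ltW; exact: le_trans.
have i3 : mu.-integrable `]g k, g k.+1] (EFin \o cst (e k)).
  exact: integrable_cst_oc.
have i4 : mu.-integrable `]g k, g k.+1] (EFin \o (fun s => phi s - e k)).
  by apply: (integrableB _ i2 i3).
have split1 := @Rintegral_itvB R phi (BLeft 0) (BRight (g k.+1)) (g k) i1.
rewrite !bnd_simp in split1; have {}split1 := split1 gk0 (ltW kS).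
have -> : \int[mu]_(s in `[0, g k.+1]) phi s -
    (\sum_(j < k) e j * (g j.+1 - g j) + e k * (g k.+1 - g k)) =
    (\int[mu]_(s in `[0, g k]) phi s - \sum_(j < k) e j * (g j.+1 - g j)) +
    \int[mu]_(s in `]g k, g k.+1]) (phi s - e k).
  rewrite RintegralB//= -split1 Rintegral_cst//= lebesgue_measure_itv/= lte_fin kS.
  by rewrite /=; ring.
have -> : eta * g k.+1 = eta * g k + eta * (g k.+1 - g k) by ring.
rewrite (le_trans (ler_normD _ _))// lerD//.
apply: (le_trans (le_normr_Rintegral _ i4)) => //.
apply: (@le_trans _ _ (\int[mu]_(s in `]g k, g k.+1]) cst eta s)); last first.
  by rewrite Rintegral_cst//= lebesgue_measure_itv/= lte_fin kS.
apply: le_Rintegral => //; first exact: integrable_norm.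
by move=> s; rewrite /= in_itv/=; exact: He.
Qed.

Lemma grid_dist t mesh m g j s : grid t mesh m g -> (j < m)%N ->
  g j < s <= g j.+1 -> 0 <= s <= t /\ `|s - g j| <= mesh.
Proof.
move=> gr jm /andP[gs sg]; have /andP[gj0 _] := grid_range gr (ltnW jm).
have /andP[_ gjt] := grid_range gr jm; have [_ _ _ ms] := gr.
have msj := ms j jm.
rewrite (le_trans gj0 (ltW gs)) (le_trans sg gjt); split => //.
by rewrite gtr0_norm ?subr_gt0//; lra.
Qed.

Lemma path_integrable f (t : R) : {within `[0, +oo[, continuous f} ->
  mu.-integrable `[0, t] (EFin \o f).
Proof.
move=> cf; have [t0|t0] := leP 0 t; last first.
  by rewrite set_itv_ge ?bnd_simp -?ltNge//; exact: integrable_set0.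
have [M _ HM] := path_bounded t cf.
apply: measurable_bounded_integrable => //.
- by rewrite /= lebesgue_measure_itv/=; case: ifP => // _; rewrite -EFinB ltry.
- exact: path_measurable.
- exists M; split; first exact: num_real.
  by move=> x Mx s /=; rewrite in_itv/= => /HM; move/le_trans; apply; exact: ltW.
Qed.

Lemma riemann_sum_cvg f (t : R) : {within `[0, +oo[, continuous f} -> 0 <= t ->
  forall e, 0 < e -> exists2 mesh, 0 < mesh & forall m g, grid t mesh m g ->
  `|\int[mu]_(s in `[0, t]) f s - \sum_(j < m) f (g j) * (g j.+1 - g j)| < e.
Proof.
move=> cf t0 e e0; have et : 0 < e / (t + 1) by rewrite divr_gt0// ltr_wpDl.
have [mesh mesh0 Hm] := path_unif_cont t cf et.
exists mesh => // m g gr; have := @riemann_step _ _ _ _ f (fun j => f (g j))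
  (e / (t + 1)) gr (path_integrable t cf).
move=> H; apply: (le_lt_trans (H _)) => [j jm s sj|].
  have [st sg] := grid_dist gr jm sj.
  by rewrite ltW// Hm// (grid_range gr (ltnW jm)).
by rewrite mulrAC ltr_pdivrMr ?ltr_wpDl// ltr_pM2l// ltrDl.
Qed.

End continuous_functions.

(** * Convergence in probability *)

Section convergence_in_probability.
Context {d : measure_display} {T : measurableType d} {R : realType}.
Variable P : probability T R.
Local Notation L1 := (L1 P).
Local Notation mean := (mean P).
Local Notation prob := (prob P).
Implicit Types Z : nat -> T -> R.

Lemma measurable_ge (f : T -> R) c : measurable_fun setT f ->
  measurable [set w | c <= f w].
Proof.
by move=> mf; rewrite -[X in measurable X]setTI; exact: measurable_fun_le.
Qed.

Lemma measurable_ge_norm (f : T -> R) c : measurable_fun setT f ->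
  measurable [set w | c <= `|f w|].
Proof. by move=> mf; apply: measurable_ge; exact: measurableT_comp. Qed.

Lemma mean_cvg0 (f : nat -> T -> R) g : (forall n, measurable_fun setT (f n)) ->
  (forall w, f ^~ w @ \oo --> (0 : R)) -> (forall n w, `|f n w| <= g w) ->
  L1 g -> mean (f n) @[n --> \oo] --> (0 : R).
Proof.
move=> mf f0 fg Lg.
have [] := @dominated_convergence _ _ _ P setT measurableT
  (fun n => EFin \o f n) (cst 0%E) (EFin \o g).
- by move=> n; exact/measurable_EFinP.
- exact: measurable_cst.
- apply: aeW => w _; apply: cvg_EFin; last exact: f0.
  by near=> n.
- exact: Lg.
- by apply: aeW => w n _ /=; rewrite lee_fin.
move=> _ _; rewrite integral0 => /fine_cvgP[_]; exact.
Unshelve. all: by end_near. Qed.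

(** Convergence to 0 in probability in the form of Ky Fan's metric: the same
    number bounds the size and the probability, which saves a quantifier. *)
Definition cvp Z : Prop := forall e, 0 < e ->
  \forall n \near \oo, prob [set w | e <= `|Z n w|] <= e.

Lemma cvp_small Z : (forall n, measurable_fun setT (Z n)) -> cvp Z ->
  forall e del, 0 < e -> 0 < del ->
  \forall n \near \oo, prob [set w | e <= `|Z n w|] <= del.
Proof.
move=> mZ cZ e del e0 del0; have m0 : 0 < Num.min e del by rewrite lt_min e0.
near=> n; have : prob [set w | Num.min e del <= `|Z n w|] <= Num.min e del.
  by near: n; exact: cZ.
rewrite le_min => /andP[_]; apply: le_trans; apply: le_prob.
- exact: measurable_ge_norm.
- exact: measurable_ge_norm.
- by move=> w /=; apply: le_trans; rewrite ge_min lexx.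
Unshelve. all: by end_near. Qed.

Lemma cvpD Z1 Z2 : (forall n, measurable_fun setT (Z1 n)) ->
  (forall n, measurable_fun setT (Z2 n)) -> cvp Z1 -> cvp Z2 ->
  cvp (fun n w => Z1 n w + Z2 n w).
Proof.
move=> m1 m2 c1 c2 e e0; have e20 : 0 < e / 2 by rewrite divr_gt0.
near=> n.
apply: (@le_trans _ _ (prob ([set w | e / 2 <= `|Z1 n w|] `|`
    [set w | e / 2 <= `|Z2 n w|]))).
  apply: le_prob.
  - by apply: measurable_ge_norm; exact: measurable_funD.
  - by apply: measurableU; exact: measurable_ge_norm.
  - move=> w /= ew; have [h1|h1] := leP (e / 2) `|Z1 n w|; first by left.
    right => /=; have := ler_normD (Z1 n w) (Z2 n w); lra.
apply: (le_trans (@probU _ _ _ P _ _ _ _)); try exact: measurable_ge_norm.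
rewrite [leRHS](splitr e) lerD//.
  by near: n; exact: c1.
by near: n; exact: c2.
Unshelve. all: by end_near. Qed.

Lemma cvpZ Z c : (forall n, measurable_fun setT (Z n)) ->
  cvp Z -> cvp (fun n w => c * Z n w).
Proof.
move=> mZ cZ e e0; have c10 : 0 < `|c| + 1 by rewrite ltr_wpDl.
near=> n; apply: (@le_trans _ _ (prob [set w | e / (`|c| + 1) <= `|Z n w|])).
  apply: le_prob.
  - by apply: measurable_ge_norm; exact: measurable_funM.
  - exact: measurable_ge_norm.
  - move=> w /=; rewrite normrM ler_pdivrMr// => /le_trans; apply.
    by rewrite mulrC ler_wpM2l// lerDl.
by near: n; apply: cvp_small => //; rewrite divr_gt0.
Unshelve. all: by end_near. Qed.

Lemma cvpB Z1 Z2 : (forall n, measurable_fun setT (Z1 n)) ->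
  (forall n, measurable_fun setT (Z2 n)) -> cvp Z1 -> cvp Z2 ->
  cvp (fun n w => Z1 n w - Z2 n w).
Proof.
move=> m1 m2 c1 c2; under eq_fun do under eq_fun do rewrite -mulN1r.
apply: cvpD => //; last exact: cvpZ.
by move=> n; exact: measurable_funM.
Qed.

Lemma cvp_pointwise Z : (forall n, measurable_fun setT (Z n)) ->
  (forall w, Z ^~ w @ \oo --> (0 : R)) -> cvp Z.
Proof.
move=> mZ Z0 e e0.
have H : mean \1_[set w | e <= `|Z n w|] @[n --> \oo] --> (0 : R).
  apply: (@mean_cvg0 _ (cst 1)) => [n|w|n w|].
  - by apply: measurable_indic; exact: measurable_ge_norm.
  - apply: cvg_near_cst; have /cvgrPdist_lt /(_ e e0) := Z0 w.
    apply: filterS => n; rewrite sub0r normrN => lt.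
    by rewrite indicE memNset//=; apply/negP; rewrite -ltNge.
  - by rewrite indicE; case: (_ \in _); rewrite ?normr1 ?normr0.
  - exact: L1_cst.
have /cvgrPdist_le /(_ e e0) := H; apply: filterS => n.
rewrite mean_indic; last exact: measurable_ge_norm.
by rewrite sub0r normrN ger0_norm// prob_ge0.
Qed.

Lemma cvp_mean_sqr Z : (forall n, L2 P (Z n)) ->
  mean (fun w => Z n w ^+ 2) @[n --> \oo] --> (0 : R) -> cvp Z.
Proof.
move=> LZ Z0 e e0; have e30 : 0 < e ^+ 3 by rewrite exprn_gt0.
have /cvgrPdist_le /(_ _ e30) := Z0; apply: filterS => n.
rewrite sub0r normrN ger0_norm; last by apply: mean_ge0 => w; exact: sqr_ge0.
move=> le3; apply: (le_trans (chebyshev_mean e0 (LZ n))).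
rewrite ler_pdivrMl ?exprn_gt0//; apply: (le_trans le3).
by rewrite exprSr.
Qed.

Lemma cvg0_in_probability_cvp Z : (forall n w, 0 <= Z n w) ->
  (forall n, measurable_fun setT (Z n)) ->
  cvg0_in_probability P (fun n w => (Z n w)%:E) -> cvp Z.
Proof.
move=> Z0 mZ cZ e e0; have /fine_cvgP[_] := cZ e e0.
move/cvgrPdist_le => /(_ e e0); apply: filterS => n /=.
rewrite sub0r normrN ger0_norm; last by rewrite fine_ge0.
apply: le_trans; rewrite /prob; rewrite le_eqVlt; apply/orP; left; apply/eqP.
by congr (fine (P _)); apply/seteqP; split => w /=; rewrite lee_fin ger0_norm.
Qed.

End convergence_in_probability.

(** * Ito integrals as limits of Riemann sums *)

Section simple_process_on_grid.
Context {d : measure_display} {T : measurableType d} {R : realType}.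
Variable F : R -> set (set T).
Hypothesis hF : filtration F.
Variables (S : @simple_process d T R) (t mesh : R) (m : nat) (g : nat -> R).
Hypothesis hS : simple_adapted F S.
Hypothesis gr : grid t mesh m g.
Hypothesis low : forall i, (i < sp_size S)%N ->
  exists2 p, (p <= m)%N & g p = Num.min (sp_time S i) t.
Hypothesis up : forall i, (i < sp_size S)%N ->
  exists2 p, (p <= m)%N & g p = Num.min (sp_time S i.+1) t.

Let lt_grid a p j s : (p <= m)%N -> g p = Num.min a t -> (j < m)%N ->
  g j < s <= g j.+1 -> (a < s) = (p <= j)%N.
Proof.
move=> pm gp jm /andP[gs sg]; apply/idP/idP.
  move=> as'; rewrite -ltnS -(grid_lt gr)// gp.
  apply: (@le_lt_trans _ _ a); first by rewrite ge_min lexx.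
  exact: lt_le_trans sg.
move=> pj; have : g p <= g j by rewrite (grid_le gr)// ltnW.
have /andP[_ gjt] := grid_range gr jm.
rewrite gp ge_min => /orP[/le_lt_trans|tg]; first exact.
by have := lt_le_trans (le_lt_trans tg gs) (le_trans sg gjt); rewrite ltxx.
Qed.

Lemma simple_eval_grid j s w : (j < m)%N -> g j < s <= g j.+1 ->
  simple_eval S s w = simple_eval S (g j.+1) w.
Proof.
move=> jm gs; apply: eq_bigr => i _; congr (_ * _).
have [p pm gp] := low (ltn_ord i); have [q qm gq] := up (ltn_ord i).
have gj : g j < g j.+1 <= g j.+1 by rewrite lexx andbT; case: gr => _ _ ->.
have E u : g j < u <= g j.+1 ->
    \1_`]sp_time S i, sp_time S i.+1] u = ((p <= j) && ~~ (q <= j))%N%:R :> R.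
  move=> gu; rewrite indicE; congr (nat_of_bool _)%:R.
  by rewrite mem_setE in_itv/= (lt_grid pm gp jm gu) leNgt (lt_grid qm gq jm gu).
by rewrite !E.
Qed.

(** On [ ]g j, g j.+1] ] a simple process whose times belong to the grid is
    constant.  Its value is read at the right end point, but it is fixed by the
    coefficients known at time [g j]. *)
Lemma simple_eval_adapted j : (j < m)%N ->
  measurable_wrt (F (g j)) (simple_eval S (g j.+1)).
Proof.
move=> jm; have /andP[gj0 _] := grid_range gr (ltnW jm).
have sF : sigma_algebra setT (F (g j)) by case: hF => + _ _; exact.
apply: (wrt_sum sF (f := fun i w => sp_coef S i w *
  \1_(`]sp_time S i, sp_time S i.+1] : set R) (g j.+1))) => i iS.
have [ti0 tii Fi _] := hS iS.
have [p pm gp] := low iS; have [q qm gq] := up iS.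
have gj : g j < g j.+1 <= g j.+1 by rewrite lexx andbT; case: gr => _ _ ->.
rewrite indicE; case: (boolP (_ \in _)) => [|_]; last first.
  by under eq_fun do rewrite mulr0; exact: (wrt_cst sF).
rewrite inE/= in_itv/= => /andP[lt _]; under eq_fun do rewrite mulr1.
apply: wrt_mono Fi; case: hF => _ _; apply => //.
have pj : (p <= j)%N by rewrite -(lt_grid pm gp jm gj).
have : g p <= g j by rewrite (grid_le gr)// ltnW.
rewrite gp ge_min => /orP[//|tg].
have /andP[_ gjt] := grid_range gr jm.
have gjS : g j < g j.+1 by case: gr => _ _ ->.
by have := lt_le_trans (le_lt_trans tg gjS) gjt; rewrite ltxx.
Qed.

Lemma simple_integral_grid (B : R -> T -> R) w :
  simple_integral S B t w =
  \sum_(j < m) simple_eval S (g j.+1) w * (B (g j.+1) w - B (g j) w).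
Proof.
under eq_bigr do rewrite /simple_eval mulr_suml.
rewrite exchange_big/=; apply: eq_bigr => i _.
have [p pm gp] := low (ltn_ord i); have [q qm gq] := up (ltn_ord i).
rewrite -gp -gq.
have pq : (p <= q)%N.
  rewrite -(grid_le gr)// gp gq le_min !ge_min lexx orbT andbT.
  by have [_ -> _ _] := hS (ltn_ord i).
rewrite -(telescope_sumr (fun j => B (g j) w) pq) big_distrr/=.
rewrite (big_nat_widen _ _ m)//= big_mkcond/=.
rewrite (big_nat_widenl _ 0)// big_mkcond/= big_mkord.
apply: eq_bigr => j _; have jm := ltn_ord j.
have gj : g j < g j.+1 <= g j.+1 by rewrite lexx andbT; case: gr => _ _ ->.
rewrite indicE mem_setE in_itv/= (lt_grid pm gp jm gj) leNgt (lt_grid qm gq jm gj).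
rewrite -ltnNge; case: (p <= j)%N; case: (j < q)%N => /=;
  by rewrite ?mulr1 ?mulr0 ?mul0r.
Qed.

End simple_process_on_grid.

Section ito_riemann.
Context {d : measure_display} {T : measurableType d} {R : realType}.
Variable P : probability T R.
Variable F : R -> set (set T).
Hypothesis hF : filtration F.
Variable B : R -> T -> R.
Hypothesis hB : brownian P F B.
Local Notation prob := (prob P).
Local Notation mu := (@lebesgue_measure R).

Lemma adapted_meas (H : R -> T -> R) : adapted F H ->
  forall t, 0 <= t -> measurable_fun setT (H t).
Proof.
by move=> aH t t0; apply: wrt_meas (aH t t0); case: hF => _ + _; exact.
Qed.

Lemma near_invS (e : R) : 0 < e -> \forall n \near \oo, n.+1%:R^-1 <= e.
Proof.
move=> e0; have := near_infty_natSinv_lt (PosNum e0).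
by apply: filterS => n /ltW.
Qed.

Lemma grid_mesh (t m1 m2 : R) m g : m1 <= m2 -> grid t m1 m g -> grid t m2 m g.
Proof.
by move=> le [g0 gm gS gmesh]; split => // j jm; rewrite (le_trans (gmesh j jm)).
Qed.

Lemma simple_eval_bounded (S : @simple_process d T R) s w :
  `|simple_eval S s w| <= \sum_(i < sp_size S) `|sp_coef S i w|.
Proof.
rewrite (le_trans (ler_norm_sum _ _ _))//; apply: ler_sum => i _.
rewrite normrM indicE; case: (_ \in _); rewrite ?normr1 ?normr0 ?mulr1//.
by rewrite mulr0.
Qed.

Lemma simple_eval_measurable (S : @simple_process d T R) w :
  measurable_fun setT (fun s => simple_eval S s w).
Proof.
by apply: measurable_sum => i; exact: measurable_funM.
Qed.

(** Refine the grid of each approximating simple process until its squared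
    distance to the integrand is a Riemann sum up to a small probability.  On
    that grid the approximation and the Riemann sum of the integrand differ by
    a transform whose accumulated square tends to 0 in probability. *)
Lemma ito_riemann (H : R -> T -> R) t (I : T -> R) :
  adapted F H -> continuous_paths H -> 0 <= t -> is_ito_integral P F B H t I ->
  exists (m : nat -> nat) (g : nat -> nat -> R),
    (forall n, grid t n.+1%:R^-1 (m n) (g n)) /\
    cvp P (fun n w => \sum_(j < m n)
      H (g n j) w * (B (g n j.+1) w - B (g n j) w) - I w).
Proof.
move=> aH cH t0 [mI [S [aS S_H S_I]]].
have mH := adapted_meas aH.
have mB := brownian_meas hF hB.
have G n k : exists mg : nat * (nat -> R),
    [/\ grid t k.+1%:R^-1 mg.1 mg.2,
      forall i, (i < sp_size (S n))%N -> exists2 p, (p <= mg.1)%N &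
        mg.2 p = Num.min (sp_time (S n) i) t
    & forall i, (i < sp_size (S n))%N -> exists2 p, (p <= mg.1)%N &
        mg.2 p = Num.min (sp_time (S n) i.+1) t].
  pose l := [seq Num.min (sp_time (S n) i) t | i <- iota 0 (sp_size (S n))] ++
    [seq Num.min (sp_time (S n) i.+1) t | i <- iota 0 (sp_size (S n))].
  have k0 : 0 < k.+1%:R^-1 :> R by rewrite invr_gt0.
  have lt a : a \in l -> 0 <= a <= t.
    rewrite mem_cat => /orP[] /mapP[i]; rewrite mem_iota/= add0n => iS ->.
      by have [? _ _ _] := aS n i iS; rewrite le_min t0 ge_min lexx orbT !andbT.
    have [t1 t2 _ _] := aS n i iS.
    by rewrite le_min t0 ge_min lexx orbT !andbT (le_trans t1).
  have [m [g [gr Hl]]] := grid_exists t0 k0 lt.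
  exists (m, g); split => //= i iS; apply: Hl; rewrite mem_cat; apply/orP.
    by left; apply/mapP; exists i; rewrite ?mem_iota.
  by right; apply/mapP; exists i; rewrite ?mem_iota.
pose m n k := (sval (cid (G n k))).1; pose g n k := (sval (cid (G n k))).2.
have gr n k : grid t k.+1%:R^-1 (m n k) (g n k).
  by rewrite /m /g; case: cid => ? [].
have low n k i : (i < sp_size (S n))%N ->
    exists2 p, (p <= m n k)%N & g n k p = Num.min (sp_time (S n) i) t.
  by rewrite /m /g; case: cid => ? /= [_ + _]; exact.
have up n k i : (i < sp_size (S n))%N ->
    exists2 p, (p <= m n k)%N & g n k p = Num.min (sp_time (S n) i.+1) t.
  by rewrite /m /g; case: cid => ? /= [_ _ +]; exact.
have gj0 n k j : (j <= m n k)%N -> 0 <= g n k j.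
  by move=> /(grid_range (gr n k)) /andP[].
pose U n k j w := simple_eval (S n) (g n k j.+1) w - H (g n k j) w.
pose Q n k w := \sum_(j < m n k) U n k j w ^+ 2 * (g n k j.+1 - g n k j).
pose phi n w s := (simple_eval (S n) s w - H s w) ^+ 2.
pose J n w := \int[mu]_(s in `[0, t]) phi n w s.
have iphi n w : mu.-integrable `[0, t] (EFin \o phi n w).
  have [K K0 HK] := path_bounded t (cH w).
  apply: measurable_bounded_integrable => //.
  - by rewrite /= lebesgue_measure_itv/=; case: ifP => // _; rewrite -EFinB ltry.
  - apply: measurable_funX; apply: measurable_funB; last exact: path_measurable.
    exact: measurable_funTS (simple_eval_measurable _ _).
  - exists ((\sum_(i < sp_size (S n)) `|sp_coef (S n) i w| + K) ^+ 2).
    split; first exact: num_real.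
    move=> x /ltW xM s /=; rewrite in_itv/= => st; apply: le_trans xM.
    rewrite /phi normrX ler_sqr ?nnegrE ?addr_ge0 ?sumr_ge0//.
    by rewrite (le_trans (ler_normB _ _))// lerD// ?HK// simple_eval_bounded.
have QJ n w : Q n ^~ w @ \oo --> J n w.
  have [K K0 HK] := path_bounded t (cH w).
  pose M := \sum_(i < sp_size (S n)) `|sp_coef (S n) i w|.
  have M0 : 0 <= M by rewrite sumr_ge0.
  pose C := 2 * (M + K) + 1.
  have C0 : 0 < C by rewrite ltr_wpDl// mulr_ge0// addr_ge0.
  apply/cvgrPdist_lt => e e0.
  have eC : 0 < e / ((t + 1) * C) by rewrite divr_gt0// mulr_gt0// ltr_wpDl.
  have [del del0 Hdel] := path_unif_cont t (cH w) eC.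
  have := near_invS del0; apply: filterS => k kdel.
  apply: (@le_lt_trans _ _ (e / (t + 1) * t)); last first.
    by rewrite mulrAC ltr_pdivrMr ?ltr_wpDl// ltr_pM2l// ltrDl.
  apply: (riemann_step (e := fun j => U n k j w ^+ 2) (gr n k) (iphi n w)) => j jm s sj.
  rewrite /phi /U (simple_eval_grid (gr n k) (low n k) (up n k) w jm sj).
  have [st sg] := grid_dist (gr n k) jm sj.
  have gjt := grid_range (gr n k) (ltnW jm).
  set a := simple_eval _ _ w.
  have aM : `|a| <= M by exact: simple_eval_bounded.
  have -> : (a - H s w) ^+ 2 - (a - H (g n k j) w) ^+ 2 =
    (H s w - H (g n k j) w) * (H s w + H (g n k j) w - 2 * a) by ring.
  have -> : e / (t + 1) = e / ((t + 1) * C) * C.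
    by field; rewrite !gt_eqF// ltr_wpDl.
  rewrite normrM ler_pM// ?(ltW (Hdel _ _ _ _ _))//; first exact: le_trans kdel.
  have := ler_normB (H s w + H (g n k j) w) (2 * a).
  have := ler_normD (H s w) (H (g n k j) w).
  have := HK s st; have := HK _ gjt; rewrite [`|2 * a|]normrM ger0_norm// /C; lra.
have mU n k j : (j < m n k)%N -> measurable_fun setT (U n k j).
  move=> jm; apply: measurable_funB; last by apply: mH; apply: gj0; exact: ltnW.
  apply: wrt_meas (simple_eval_adapted hF (aS n) (gr n k) (low n k) (up n k) jm).
  by case: hF => _ + _; apply; apply: gj0; exact: ltnW.
have mQ n k : measurable_fun setT (Q n k).
  apply: measurable_sum => j; apply: measurable_funM => //.
  by apply: measurable_funX; exact: mU.
have mJ n : measurable_fun setT (J n).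
  by apply: (measurable_fun_cvg (h := Q n)) => // w _; exact: QJ.
have J0 n w : 0 <= J n w by apply: Rintegral_ge0 => s _; exact: sqr_ge0.
have cJ : cvp P J.
  apply: cvg0_in_probability_cvp => //; move: S_H; congr (cvg0_in_probability _ _).
  apply/funext => n; apply/funext => w; rewrite /J /Rintegral fineK//.
  by apply: integrable_fin_num (iphi n w).
have K n : exists k, (n <= k)%N /\
    prob [set w | n.+1%:R^-1 <= `|Q n k w - J n w|] <= n.+1%:R^-1.
  have : cvp P (fun k w => Q n k w - J n w).
    apply: cvp_pointwise => [k|w]; first exact: measurable_funB.
    by apply/subr_cvg0; exact: QJ.
  move=> /(_ n.+1%:R^-1); rewrite invr_gt0 ltr0n => /(_ isT) [N _ HN].
  by exists (maxn n N); rewrite leq_maxl; split => //; apply: HN; exact: leq_maxr.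
pose k n := sval (cid (K n)).
have nk n : (n <= k n)%N by rewrite /k; case: cid => ? [].
have pk n : prob [set w | n.+1%:R^-1 <= `|Q n (k n) w - J n w|] <= n.+1%:R^-1.
  by rewrite /k; case: cid => ? [].
have cQ : cvp P (fun n => Q n (k n)).
  have -> : (fun n => Q n (k n)) = (fun n w => (Q n (k n) w - J n w) + J n w).
    by apply/funext => n; apply/funext => w; rewrite subrK.
  apply: cvpD => // [n|e e0]; first exact: measurable_funB.
  have := near_invS e0; apply: filterS => n ne; apply: le_trans (ne).
  apply: le_trans (pk n); apply: le_prob.
  - by apply: measurable_ge_norm; exact: measurable_funB.
  - by apply: measurable_ge_norm; exact: measurable_funB.
  - by move=> w /=; exact: le_trans.
exists (fun n => m n (k n)), (fun n => g n (k n)); split.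
  move=> n; apply: grid_mesh (gr n (k n)).
  by rewrite lef_pV2 ?posrE ?ltr0n// ler_nat ltnS nk.
pose D n w := \sum_(j < m n (k n)) U n (k n) j w *
  (B (g n (k n) j.+1) w - B (g n (k n) j) w).
have mdB n j : (j < m n (k n))%N ->
    measurable_fun setT (fun w => B (g n (k n) j.+1) w - B (g n (k n) j) w).
  by move=> jm; apply: measurable_funB; apply: mB; apply: gj0 => //; exact: ltnW.
have mD n : measurable_fun setT (D n).
  by apply: measurable_sum => j; apply: measurable_funM; [exact: mU|exact: mdB].
have cD : cvp P D.
  move=> e e0.
  have del0 : 0 < e ^+ 3 / 2 by rewrite divr_gt0// exprn_gt0.
  have e20 : 0 < e / 2 by rewrite divr_gt0.
  have := cvp_small (fun n => mQ n (k n)) cQ del0 e20; apply: filterS => n Hn.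
  have [g0 _ gS _] := gr n (k n).
  apply: (le_trans (@transform_prob _ _ _ P F hF B hB (g n (k n)) (U n (k n))
    (m n (k n)) e (e ^+ 3 / 2) _ _ _ e0 del0)).
  - by rewrite g0.
  - exact: gS.
  - move=> j jm; have gj := gj0 n (k n) j (ltnW jm).
    apply: wrtB; first by case: hF => + _ _; exact.
      exact: (simple_eval_adapted hF (aS n) (gr n _) (low n _) (up n _) jm).
    exact: aH.
  - have -> : e ^+ 3 / 2 / e ^+ 2 = e / 2 by field; rewrite gt_eqF.
    rewrite [leRHS](splitr e) lerD2r; apply: le_trans Hn; apply: le_prob.
    + exact: measurable_ge (mQ n (k n)).
    + exact: measurable_ge_norm.
    + by move=> w /= /le_trans; apply; exact: ler_norm.
have simpleE n w : simple_integral (S n) B t w = \sum_(j < m n (k n))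
    simple_eval (S n) (g n (k n) j.+1) w *
    (B (g n (k n) j.+1) w - B (g n (k n) j) w).
  exact: (simple_integral_grid (aS n) (gr n _) (low n _) (up n _)).
have mS n : measurable_fun setT (simple_integral (S n) B t).
  rewrite (_ : simple_integral _ _ _ = fun w => D n w + \sum_(j < m n (k n))
      H (g n (k n) j) w * (B (g n (k n) j.+1) w - B (g n (k n) j) w)).
    apply: measurable_funD => //; apply: measurable_sum => j.
    apply: measurable_funM; last exact: mdB.
    by apply: mH; apply: gj0; exact: ltnW.
  apply/funext => w; rewrite simpleE -big_split/=; apply: eq_bigr => j _.
  by rewrite -mulrDl subrK.
have cS : cvp P (fun n w => simple_integral (S n) B t w - I w).
  have := @cvg0_in_probability_cvp _ _ _ P
    (fun n w => `|simple_integral (S n) B t w - I w|) (fun _ _ => normr_ge0 _).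
  move=> /(_ _ S_I) H' e e0; under eq_near do under eq_set do rewrite -normr_id.
  by apply: H' => // n; apply: measurableT_comp => //; exact: measurable_funB.
have := cvpB (fun n => measurable_funB (mS n) mI) mD cS cD.
congr (cvp _ _); apply/funext => n; apply/funext => w.
rewrite /= simpleE addrAC -sumrB; congr (_ - _); apply: eq_bigr => j _.
by rewrite -mulrBl /U opprB addrC subrK.
Qed.

End ito_riemann.

(** * Events read off continuous paths *)

Section path_events.
Context {d : measure_display} {T : measurableType d} {R : realType}.
Variable F : R -> set (set T).
Hypothesis hF : filtration F.

Definition clamp (t : R) (q : rat) : R := Num.max 0 (Num.min (ratr q) t).

Lemma clamp_range t q : 0 <= t -> 0 <= clamp t q <= t.
Proof. by move=> t0; rewrite /clamp le_max lexx/= ge_max t0 ge_min lexx orbT. Qed.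

(** The clamped rationals are dense in the segment, end points included. *)
Lemma path_le_dense (f : R -> R) t c : {within `[0, +oo[, continuous f} ->
  0 <= t -> (forall q, f (clamp t q) <= c) -> forall s, 0 <= s <= t -> f s <= c.
Proof.
move=> cf t0 Hq s /andP[s0 st]; rewrite leNgt; apply/negP => lt.
have e0 : 0 < f s - c by rewrite subr_gt0.
have [del del0 Hdel] := path_cont cf s0 e0.
have [q] : exists q, ratr q \in `]s, (s + del)[ by apply: rat_in_itvoo; rewrite ltrDl.
rewrite in_itv/= => /andP[sq qs].
have := Hdel (clamp t q); have /andP[c0 ct] := clamp_range q t0.
have cs : s <= clamp t q by rewrite /clamp le_max le_min st (ltW sq) orbT.
have cd : clamp t q <= Num.max 0 (ratr q).
  by rewrite /clamp ge_max !le_max lexx/= [X in _ || X]ge_min lexx !orbT.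
have q0 : 0 <= ratr q :> R by rewrite (le_trans s0)// ltW.
rewrite max_r// in cd.
move=> /(_ c0); rewrite ler0_norm ?subr_le0// opprB => H.
have : clamp t q - s < del by lra.
move=> /H; have := Hq q; have := ler_norm (f s - f (clamp t q)); lra.
Qed.

(** By density the event is a countable intersection. *)
Lemma path_le_event (f : R -> T -> R) t c : adapted F f -> continuous_paths f ->
  0 <= t -> F t [set w | forall s, 0 <= s <= t -> f s w <= c].
Proof.
move=> af cf t0.
have -> : [set w | forall s, 0 <= s <= t -> f s w <= c] =
    \bigcap_n [set w | f (clamp t (odflt 0 (unpickle n))) w <= c].
  apply/seteqP; split => w /=.
    by move=> H n _ /=; apply: H; exact: clamp_range.
  move=> H; apply: path_le_dense (cf w) t0 _ => q.
  by have := H (pickle q) I; rewrite /= pickleK.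
have sF : sigma_algebra setT (F t) by case: hF => + _ _; exact.
apply: (wrt_bigcap sF) => n; apply: wrt_le.
have /andP[q0 qt] := clamp_range (odflt 0 (unpickle n)) t0.
by apply: wrt_mono (af _ q0); case: hF => _ _; exact.
Qed.

End path_events.

(** * Uniqueness for linear stochastic equations *)

Lemma weighted_cauchy_schwarz {R : realFieldType} (u p : nat -> R) n :
  (forall j, (j < n)%N -> 0 <= p j) ->
  (\sum_(j < n) u j * p j) ^+ 2 <=
  (\sum_(j < n) p j) * (\sum_(j < n) u j ^+ 2 * p j).
Proof.
elim: n => [_|n IH p0]; first by rewrite !big_ord0 mul0r expr0n.
have {}IH := IH (fun j jn => p0 j (ltnW jn)).
rewrite !big_ord_recr/=.
set S := \sum_(j < n) _ in IH *; set A := \sum_(j < n) _ in IH *.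
set Q := \sum_(j < n) _ in IH *.
have A0 : 0 <= A by apply: sumr_ge0 => i _; rewrite p0// ltnS ltnW.
have Q0 : 0 <= Q.
  by apply: sumr_ge0 => i _; rewrite mulr_ge0 ?sqr_ge0// p0// ltnS ltnW.
have pn := p0 n (ltnSn n).
have key : 2 * S * u n <= A * u n ^+ 2 + Q.
  move: A0; rewrite le_eqVlt => /predU1P[A0|A0].
    move: IH; rewrite -A0 mul0r => S0.
    have /eqP : S ^+ 2 = 0 by apply/eqP; rewrite eq_le S0 sqr_ge0.
    by rewrite sqrf_eq0 => /eqP ->; rewrite mulr0 !mul0r add0r.
  rewrite -(ler_pM2l A0) -subr_ge0.
  have := sqr_ge0 (A * u n - S); have -> : (A * u n - S) ^+ 2 =
    A * (A * u n ^+ 2) - A * (2 * S * u n) + S ^+ 2 by ring.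
  by rewrite mulrDr; lra.
have := ler_wpM2r pn key; rewrite -subr_ge0 => H1; rewrite -subr_ge0.
have -> : (A + p n) * (Q + u n ^+ 2 * p n) - (S + u n * p n) ^+ 2 =
  (A * Q - S ^+ 2) + ((A * u n ^+ 2 + Q) * p n - 2 * S * u n * p n) by ring.
by rewrite addr_ge0// subr_ge0.
Qed.

Lemma telescope_grid {R : numDomainType} (g : nat -> R) m :
  \sum_(j < m) (g j.+1 - g j) = g m - g 0%N.
Proof. by rewrite -(big_mkord xpredT (fun j => g j.+1 - g j)) telescope_sumr. Qed.

Section linear_uniqueness.
Context {d : measure_display} {T : measurableType d} {R : realType}.
Variable P : probability T R.
Variable F : R -> set (set T).
Hypothesis hF : filtration F.
Variable B : R -> T -> R.
Hypothesis hB : brownian P F B.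
Local Notation L1 := (L1 P).
Local Notation L2 := (L2 P).
Local Notation mean := (mean P).
Local Notation prob := (prob P).

Definition euler_sum (sigma a : R) (D : R -> T -> R) m (g : nat -> R) w : R :=
  \sum_(j < m) D (g j) w *
    (sigma * (B (g j.+1) w - B (g j) w) + a * (g j.+1 - g j)).

Variables (sigma a : R) (D : R -> T -> R).
Hypotheses (aD : adapted F D) (cD : continuous_paths D).
Hypothesis eulerD : forall t, 0 <= t -> exists (m : nat -> nat) (g : nat -> nat -> R),
  (forall n, grid t n.+1%:R^-1 (m n) (g n)) /\
  cvp P (fun n w => euler_sum sigma a D (m n) (g n) w - D t w).

Let mD (t : R) : 0 <= t -> measurable_fun setT (D t).
Proof. exact: (adapted_meas hF aD). Qed.

Let mB (t : R) : 0 <= t -> measurable_fun setT (B t).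
Proof. exact: (brownian_meas hF hB). Qed.

Let sF (t : R) : 0 <= t -> sigma_algebra setT (F t). Proof. by case: hF => + _ _; exact. Qed.
Let mF (t : R) : 0 <= t -> F t `<=` measurable. Proof. by case: hF => _ + _; exact. Qed.

Let euler_meas t mesh m g : grid t mesh m g ->
  measurable_fun setT (euler_sum sigma a D m g).
Proof.
move=> gr; apply: measurable_sum => j.
have jm := ltn_ord j; have /andP[gj _] := grid_range gr (ltnW jm).
have /andP[gS _] := grid_range gr jm.
apply: measurable_funM; first exact: mD.
apply: measurable_funD => //; apply: measurable_funM => //.
by apply: measurable_funB; exact: mB.
Qed.

(** [D] is stopped by the event that it has stayed below [N] so far: on that
    event the stopped and the original Euler sums agree. *)
Variable N : R.
Hypothesis N0 : 0 <= N.
Let A (t : R) : set T := [set w | forall s, 0 <= s <= t -> `|D s w| <= N].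

Let FA (t : R) : 0 <= t -> F t (A t).
Proof.
move=> t0; apply: (path_le_event hF (f := fun s w => `|D s w|)) => //.
  by move=> s s0; apply: (wrt_comp (h := Num.norm)) (aD s0); exact: normr_measurable.
by move=> w; exact: (path_comp (@norm_continuous _ R) (@cD w)).
Qed.

Let DA (t : R) w := \1_(A t) w * D t w.

Let DA_le (t : R) w : 0 <= t -> `|DA t w| <= N.
Proof.
move=> t0; rewrite /DA indicE; case: (boolP (w \in A t)) => [|_]; last first.
  by rewrite mul0r normr0.
by rewrite inE mul1r; apply; rewrite t0 lexx.
Qed.

Let FDA (t : R) : 0 <= t -> measurable_wrt (F t) (DA t).
Proof.
move=> t0; apply: (wrtM (sF t0)); last exact: aD.
by apply: (wrt_indic (sF t0)); exact: FA.
Qed.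

Let mDA (t : R) : 0 <= t -> measurable_fun setT (DA t).
Proof. by move=> t0; apply: wrt_meas (FDA t0); exact: mF. Qed.

Let LDA (t : R) : 0 <= t -> L2 (DA t).
Proof.
move=> t0; apply: (@L2_bnd _ _ _ _ _ N); first exact: mDA.
by move=> w; exact: DA_le.
Qed.

Let phi (t : R) := mean (fun w => DA t w ^+ 2).

Let stopped_euler t mesh m g : grid t mesh m g ->
  L2 (euler_sum sigma a DA m g) /\
  mean (fun w => euler_sum sigma a DA m g w ^+ 2) <=
  2 * (sigma ^+ 2 + a ^+ 2 * t) * \sum_(j < m) phi (g j) * (g j.+1 - g j).
Proof.
move=> gr; have [g0 gm gS _] := gr.
have gj0 j : (j <= m)%N -> 0 <= g j by move=> /(grid_range gr) /andP[].
have t0 : 0 <= t by rewrite -gm gj0.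
have dg j : (j < m)%N -> 0 <= g j.+1 - g j.
  by move=> jm; rewrite subr_ge0 ltW// gS.
have [_ LM leM] := @transform_L2 _ _ _ P F hF B hB g (fun=> id)
  (fun j => DA (g j)) (fun j => g j.+1 - g j) m (eq_ind_r (fun x => 0 <= x) (lexx 0) g0)
  gS (fun _ _ => @measurable_id _ _ _)
  (fun j jn => incr_L2 hF hB (gj0 j (ltnW jn)) (gS j jn))
  (fun j jn => incr_mean0 hF hB (gj0 j (ltnW jn)) (gS j jn))
  (fun j jn => incr_var_le hF hB (gj0 j (ltnW jn)) (gS j jn))
  (fun j jn => conj (FDA (gj0 j (ltnW jn))) (LDA (gj0 j (ltnW jn)))).
set M := fun w => \sum_(j < m) _ in LM leM.
pose V w := \sum_(j < m) DA (g j) w * (g j.+1 - g j).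
have L1V j : (j < m)%N -> L2 (fun w => DA (g j) w * (g j.+1 - g j)).
  move=> jm; under eq_fun do rewrite mulrC.
  by apply: L2Z; apply: LDA; apply: gj0; exact: ltnW.
have LV : L2 V by exact: (L2_sum (F := fun j w => DA (g j) w * (g j.+1 - g j))).
have EE w : euler_sum sigma a DA m g w = sigma * M w + a * V w.
  rewrite /M /V !mulr_sumr -big_split/=; apply: eq_bigr => j _; ring.
have LE : L2 (euler_sum sigma a DA m g).
  by rewrite (funext EE); apply: L2D; exact: L2Z.
split=> //.
have iU j : (j < m)%N -> L1 (fun w => DA (g j) w ^+ 2 * (g j.+1 - g j)).
  move=> jm; under eq_fun do rewrite mulrC.
  by apply: L1Z; case: (LDA (gj0 j (ltnW jm))).
have VV : mean (fun w => V w ^+ 2) <= t * \sum_(j < m) phi (g j) * (g j.+1 - g j).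
  have -> : \sum_(j < m) phi (g j) * (g j.+1 - g j) =
      mean (fun w => \sum_(j < m) DA (g j) w ^+ 2 * (g j.+1 - g j)).
    rewrite (mean_sum (F := fun j w => DA (g j) w ^+ 2 * (g j.+1 - g j)))//.
    apply: eq_bigr => j _; rewrite mulrC -meanZ; last first.
      by case: (LDA (gj0 j (ltnW (ltn_ord j)))).
    by apply: eq_mean => w; rewrite mulrC.
  have i1 : L1 (fun w => \sum_(j < m) DA (g j) w ^+ 2 * (g j.+1 - g j)).
    exact: (L1_sum (F := fun j w => DA (g j) w ^+ 2 * (g j.+1 - g j))).
  rewrite -meanZ//; apply: mean_le => [||w]; first by case: LV.
    exact: L1Z.
  have -> : t = \sum_(j < m) (g j.+1 - g j) by rewrite telescope_grid gm g0 subr0.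
  exact: (@weighted_cauchy_schwarz _ (fun j => DA (g j) w) (fun j => g j.+1 - g j)).
apply: (@le_trans _ _ (2 * sigma ^+ 2 * mean (fun w => M w ^+ 2) +
    2 * a ^+ 2 * mean (fun w => V w ^+ 2))).
  have [_ iM] := LM; have [_ iV] := LV; have [_ iE] := LE.
  rewrite -!meanZ// -meanD; [|exact: L1Z|exact: L1Z].
  apply: mean_le => // [|w]; first by apply: L1D; exact: L1Z.
  have := sqr_ge0 (sigma * M w - a * V w); rewrite EE.
  have -> : (sigma * M w - a * V w) ^+ 2 = sigma ^+ 2 * M w ^+ 2 +
    a ^+ 2 * V w ^+ 2 - 2 * (sigma * M w) * (a * V w) by ring.
  have -> : (sigma * M w + a * V w) ^+ 2 = sigma ^+ 2 * M w ^+ 2 +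
    a ^+ 2 * V w ^+ 2 + 2 * (sigma * M w) * (a * V w) by ring.
  lra.
have -> : forall s, 2 * (sigma ^+ 2 + a ^+ 2 * t) * s =
  2 * sigma ^+ 2 * s + 2 * a ^+ 2 * (t * s) by move=> s; ring.
by rewrite lerD// ler_wpM2l// mulr_ge0// sqr_ge0.
Qed.

Let exp_sum (lam t mesh : R) m g : 0 < lam -> grid t mesh m g ->
  \sum_(j < m) expR (lam * g j) * (g j.+1 - g j) <= expR (lam * t) / lam.
Proof.
move=> lam0 gr; have [g0 gm gS _] := gr.
rewrite ler_pdivlMr// mulr_suml.
apply: (@le_trans _ _ (\sum_(j < m) (expR (lam * g j.+1) - expR (lam * g j)))).
  apply: ler_sum => j _.
  have -> : expR (lam * g j.+1) = expR (lam * g j) * expR (lam * (g j.+1 - g j)).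
    by rewrite -expRD; congr expR; ring.
  have := ler_wpM2l (expR_ge0 (lam * g j)) (expR_ge1Dx (lam * (g j.+1 - g j))).
  by lra.
rewrite (telescope_grid (fun j => expR (lam * g j)))/= gm.
by rewrite gerBl expR_ge0.
Qed.

(** Twice the growth rate [4 * (sigma ^+ 2 + a ^+ 2 * t)] of [phi], so that
    integrating an exponential of rate [C t] loses half of its constant; the
    summand 1 keeps it positive. *)
Let C (t : R) := 8 * (sigma ^+ 2 + a ^+ 2 * t) + 1.

(** One application of the equation halves the constant of an exponential
    bound with a large enough rate. *)
Let phi_halve (t K : R) : 0 <= t -> 0 <= K ->
  (forall s, 0 <= s <= t -> phi s <= K * expR (C t * s)) ->
  forall s, 0 <= s <= t -> phi s <= K / 2 * expR (C t * s).
Proof.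
move=> t0 K0 Hphi s /andP[s0 st].
have Ct0 : 0 < C t.
  by rewrite /C ltr_wpDl// mulr_ge0// addr_ge0 ?sqr_ge0// mulr_ge0 ?sqr_ge0.
apply/ler_addgt0Pl => eps eps0.
pose e := Num.min 1 (eps / (2 + N ^+ 2)).
have N20 : 0 < 2 + N ^+ 2 by rewrite ltr_wpDr ?sqr_ge0.
have e0 : 0 < e by rewrite lt_min ltr01 divr_gt0.
have [m [g [gr cR]]] := eulerD s0.
have mR n : measurable_fun setT
    (fun w => euler_sum sigma a D (m n) (g n) w - D s w).
  by apply: measurable_funB; [exact: euler_meas (gr n)|exact: mD].
have [n _ /(_ n (leqnn n)) Hn] := cR e e0.
set E := euler_sum sigma a D _ _ in mR Hn.
pose E' := euler_sum sigma a DA (m n) (g n).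
pose O := [set w | e <= `|E w - D s w|].
have mO : measurable O by apply: measurable_ge_norm; exact: mR.
have [LE' leE'] := stopped_euler (gr n).
have LD := LDA s0; have [_ iD] := LD; have [_ iE'] := LE'.
have pt w : DA s w ^+ 2 <= 2 * E' w ^+ 2 + (2 * e ^+ 2 + N ^+ 2 * \1_O w).
  have N20' := sqr_ge0 N; have e20 := sqr_ge0 e; have E20 := sqr_ge0 (E' w).
  case: (boolP (w \in O)) => wO.
    rewrite indicE wO mulr1 -(real_normK (num_real (DA s w))).
    have : `|DA s w| ^+ 2 <= N ^+ 2 by rewrite ler_sqr ?nnegrE// DA_le.
    lra.
  rewrite indicE (negbTE wO) mulr0 addr0.
  case: (boolP (w \in A s)) => wA; last first.
    by rewrite {1}/DA indicE (negbTE wA) mul0r expr0n/= addr_ge0// mulr_ge0.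
  have DAE r : 0 <= r <= s -> DA r w = D r w.
    move=> /andP[r0 rs]; rewrite /DA indicE mem_set ?mul1r// => q /andP[q0 qr].
    by move: wA; rewrite inE; apply; rewrite q0 (le_trans qr).
  have EE : E w = E' w.
    apply: eq_bigr => j _; rewrite DAE//.
    exact: grid_range (gr n) _ (ltnW (ltn_ord j)).
  rewrite DAE ?s0 ?lexx//.
  have lt : `|E w - D s w| < e by rewrite ltNge; apply/negP => H; move/negP: wO; rewrite inE.
  have : (E w - D s w) ^+ 2 <= e ^+ 2.
    by rewrite -(real_normK (num_real (E w - D s w))) ler_sqr ?nnegrE ?(ltW e0) ?(ltW lt).
  have := sqr_ge0 (E w - (D s w - E w)); rewrite -EE.
  have -> : (E w - (D s w - E w)) ^+ 2 = 2 * E w ^+ 2 + 2 * (E w - D s w) ^+ 2 - D s w ^+ 2.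
    ring.
  lra.
have step : phi s <= 2 * mean (fun w => E' w ^+ 2) + (2 * e ^+ 2 + N ^+ 2 * prob O).
  have i1 : L1 (fun w => 2 * E' w ^+ 2) by exact: L1Z.
  have i2 : L1 (fun w => N ^+ 2 * \1_O w) by apply: L1Z; exact: L1_indic1.
  have i3 : L1 (fun w => 2 * e ^+ 2 + N ^+ 2 * \1_O w).
    by apply: L1D => //; exact: L1_cst.
  rewrite -meanZ// -mean_indic// -meanZ; last exact: L1_indic1.
  rewrite -[2 * e ^+ 2](mean_cst P) -meanD//; last exact: L1_cst.
  rewrite -meanD//; apply: mean_le => //.
  exact: L1D.
have e1 : e <= 1 by rewrite ge_min lexx.
have ee : e ^+ 2 <= e by rewrite expr2 ler_piMr// ltW.
have eE : 2 * e ^+ 2 + N ^+ 2 * prob O <= eps.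
  apply: (@le_trans _ _ ((2 + N ^+ 2) * e)).
    have := ler_wpM2l (sqr_ge0 N) Hn; rewrite -/O; lra.
  by rewrite mulrC -ler_pdivlMr// ge_min lexx orbT.
have sum_le : \sum_(j < m n) phi (g n j) * (g n j.+1 - g n j) <=
    K * (expR (C t * s) / C t).
  apply: (@le_trans _ _ (\sum_(j < m n)
      K * (expR (C t * g n j) * (g n j.+1 - g n j)))).
    apply: ler_sum => j _; rewrite mulrA ler_wpM2r//.
      by rewrite subr_ge0 ltW//; case: (gr n) => _ _ + _; exact.
    apply: Hphi; have /andP[-> /le_trans ->//] := grid_range (gr n) (ltnW (ltn_ord j)).
  by rewrite -mulr_sumr ler_wpM2l// (exp_sum _ (gr n)).
apply: (le_trans step); rewrite addrC lerD//.
apply: (@le_trans _ _ (C t / 2 * (K * (expR (C t * s) / C t)))); last first.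
  by rewrite le_eqVlt; apply/orP; left; apply/eqP; field; rewrite gt_eqF.
have q0 : 0 <= sigma ^+ 2 + a ^+ 2 * s.
  by rewrite addr_ge0 ?sqr_ge0// mulr_ge0 ?sqr_ge0.
apply: (@le_trans _ _ (C t / 2 *
    \sum_(j < m n) phi (g n j) * (g n j.+1 - g n j))); last first.
  by rewrite ler_wpM2l// divr_ge0// ltW.
apply: (@le_trans _ _ (2 * (2 * (sigma ^+ 2 + a ^+ 2 * s) *
    \sum_(j < m n) phi (g n j) * (g n j.+1 - g n j)))).
  by rewrite ler_wpM2l.
rewrite mulrA ler_wpM2r//.
  apply: sumr_ge0 => j _; rewrite mulr_ge0//.
    by apply: mean_ge0 => w; exact: sqr_ge0.
  by rewrite subr_ge0 ltW//; case: (gr n) => _ _ + _; exact.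
have : a ^+ 2 * s <= a ^+ 2 * t by rewrite ler_wpM2l// sqr_ge0.
by rewrite /C; lra.
Qed.

(** Gronwall's lemma: [phi] is bounded by [N ^+ 2], and the bound can be halved
    for ever. *)
Lemma stopped_mean_sqr0 t : 0 <= t -> mean (fun w => (\1_(A t) w * D t w) ^+ 2) = 0.
Proof.
move=> t0; apply/eqP; rewrite eq_le; apply/andP; split; last first.
  by apply: mean_ge0 => w; exact: sqr_ge0.
have H k : forall s, 0 <= s <= t -> phi s <= N ^+ 2 / 2 ^+ k * expR (C t * s).
  elim: k => [s /andP[s0 st]|k IH s st].
    rewrite expr0 divr1; apply: (@le_trans _ _ (N ^+ 2)).
      rewrite -[leRHS](mean_cst P); apply: mean_le => [||w].
      - by case: (LDA s0).
      - exact: L1_cst.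
      - by rewrite -(real_normK (num_real (DA s w))) ler_sqr ?nnegrE// DA_le.
    rewrite ler_peMr ?sqr_ge0// -expR0 ler_expR mulr_ge0// /C.
    by rewrite addr_ge0// mulr_ge0// addr_ge0 ?sqr_ge0// mulr_ge0 ?sqr_ge0.
  rewrite [2 ^+ k.+1]exprSr invfM mulrA; apply: phi_halve => //.
  by rewrite divr_ge0 ?sqr_ge0// exprn_ge0.
have cv : (N ^+ 2 * expR (C t * t)) * (2^-1) ^+ k @[k --> \oo] --> (0 : R).
  rewrite -[X in _ --> X](mulr0 (N ^+ 2 * expR (C t * t))).
  apply: cvgMr; apply: cvg_expr; rewrite ger0_norm; lra.
apply: (cvgr_to_ge cv); near=> k.
have := H k t; rewrite t0 lexx => /(_ isT); rewrite exprVn => le.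
by apply: (le_trans le); rewrite mulrAC.
Unshelve. all: by end_near. Qed.

End linear_uniqueness.

Section linear_uniqueness_ae.
Context {d : measure_display} {T : measurableType d} {R : realType}.
Variable P : probability T R.
Variable F : R -> set (set T).
Hypothesis hF : filtration F.
Variable B : R -> T -> R.
Hypothesis hB : brownian P F B.
Variables (sigma a : R) (D : R -> T -> R).
Hypotheses (aD : adapted F D) (cD : continuous_paths D).
Hypothesis eulerD : forall t, 0 <= t -> exists (m : nat -> nat) (g : nat -> nat -> R),
  (forall n, grid t n.+1%:R^-1 (m n) (g n)) /\
  cvp P (fun n w => euler_sum B sigma a D (m n) (g n) w - D t w).
Local Notation mean := (mean P).
Local Notation prob := (prob P).

Let mD (t : R) : 0 <= t -> measurable_fun setT (D t).
Proof. exact: (adapted_meas hF aD). Qed.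

Let prob0 (t e : R) : 0 <= t -> 0 < e -> prob [set w | e <= `|D t w|] = 0.
Proof.
move=> t0 e0.
pose A n := [set w | forall s, 0 <= s <= t -> `|D s w| <= n%:R].
have FA n : F t (A n).
  apply: (path_le_event hF (f := fun s w => `|D s w|)) => //.
    by move=> s s0; apply: (wrt_comp (h := Num.norm)) (aD s0); exact: normr_measurable.
  by move=> w; exact: (path_comp (@norm_continuous _ R) (@cD w)).
have mA n : measurable (A n) by case: hF => _ /(_ t t0) + _; apply; exact: FA.
have lim0 : mean \1_(~` A n) @[n --> \oo] --> (0 : R).
  apply: (@mean_cvg0 _ _ _ _ _ (cst 1)) => [n|w|n w|].
  - by apply: measurable_indic; exact: measurableC.
  - have [M M0 HM] := path_bounded t (@cD w).
    apply: cvg_near_cst; near=> n; rewrite indicE memNset//=.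
    apply; move=> s st; apply: (le_trans (HM s st)).
    near: n; exact: nbhs_infty_ger.
  - by rewrite indicE; case: (_ \in _); rewrite ?normr1 ?normr0.
  - exact: L1_cst.
apply/eqP; rewrite eq_le prob_ge0 andbT; apply: (cvgr_to_ge lim0).
near=> n; rewrite mean_indic; last exact: measurableC.
have mAD : measurable_fun setT (fun w => \1_(A n) w * D t w).
  by apply: measurable_funM; [exact: measurable_indic|exact: mD].
apply: (@le_trans _ _ (prob ([set w | e <= `|\1_(A n) w * D t w|] `|` ~` A n))).
  apply: le_prob.
  - by apply: measurable_ge_norm; exact: mD.
  - by apply: measurableU; [exact: measurable_ge_norm|exact: measurableC].
  - move=> w /= ew; case: (boolP (w \in A n)) => wA.
      by left; rewrite /= indicE wA mul1r.
    by right => /=; rewrite notin_setE in wA.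
apply: (le_trans (@probU _ _ _ P _ _ _ _)).
- exact: measurable_ge_norm.
- exact: measurableC.
rewrite -[leRHS]add0r lerD2r.
have LAD : L2 P (fun w => \1_(A n) w * D t w).
  apply: (@L2_bnd _ _ _ _ _ n%:R) => // w; rewrite indicE.
  case: (boolP (w \in A n)) => [|_]; last by rewrite mul0r normr0.
  by rewrite inE mul1r; apply; rewrite t0 lexx.
apply: (le_trans (chebyshev_mean e0 LAD)).
by rewrite (stopped_mean_sqr0 hF hB aD cD eulerD)// mulr0.
Unshelve. all: by end_near. Qed.

(** A continuous path stays below some integer on each segment, so stopping is
    harmless; and it vanishes as soon as it vanishes at the rational times. *)
Lemma linear_unique_ae : {ae P, forall w, forall t, 0 <= t -> D t w = 0}.
Proof.
pose r (q : rat) : R := Num.max 0 (ratr q).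
have r0 q : 0 <= r q by rewrite le_max lexx.
pose E (i : nat) : set T := let qk := odflt (0, 0%N) (unpickle i) in
  [set w | qk.2.+1%:R^-1 <= `|D (r qk.1) w|].
apply: (@negligibleS _ _ _ _ (\bigcup_i E i)); last first.
  apply: negligible_bigcup => i; exists (E i); split => //.
    by apply: measurable_ge_norm; exact: mD.
  have mE : measurable (E i) by apply: measurable_ge_norm; exact: mD.
  by have := probE P mE; rewrite prob0.
move=> w /= /existsNP[t /not_implyP[t0 /eqP Dt]].
have c0 : 0 < `|D t w| / 2 by rewrite divr_gt0// normr_gt0.
have [del del0 Hdel] := path_cont (@cD w) t0 c0.
have [q] : exists q, ratr q \in `]t, (t + del)[ by apply: rat_in_itvoo; rewrite ltrDl.
rewrite in_itv/= => /andP[tq qt].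
have rq : r q = ratr q by rewrite /r max_r// (le_trans t0)// ltW.
have [k _ /(_ k (leqnn k)) kc] := near_invS c0.
exists (pickle (q, k)); [exact: I|rewrite /E pickleK; apply: (le_trans kc)].
have := Hdel (r q) (r0 q); rewrite rq ltr0_norm ?subr_lt0// => H.
have {}H : `|D t w - D (ratr q) w| < `|D t w| / 2 by apply: H; lra.
have := ler_normD (D t w - D (ratr q) w) (D (ratr q) w); rewrite subrK; lra.
Qed.

End linear_uniqueness_ae.

(** * Geometric Brownian motion *)

Lemma expR_sub1_le {R : realType} (u L : R) : `|u| <= L ->
  `|expR u - 1| <= `|u| * expR L /\ `|expR u - 1 - u| <= u ^+ 2 * expR L.
Proof.
move=> uL; have up : expR u - 1 <= u * expR u.
  have := ler_wpM2l (expR_ge0 u) (expR_ge1Dx (- u)).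
  by rewrite -expRD subrr expR0; lra.
have lo := expR_ge1Dx u.
have L1' : 1 <= expR L by rewrite -expR0 ler_expR (le_trans _ uL).
have uL' : expR u <= expR L by rewrite ler_expR (le_trans (ler_norm u)).
have q0 : 0 <= expR u - 1 - u by lra.
rewrite [`|_ - _ - _|]ger0_norm//.
have [u0|u0] := leP 0 u.
  rewrite !ger0_norm//; last by lra.
  have uu := ler_wpM2l u0 uL'; split; first lra.
  have : u * (expR u - 1) <= u * (u * expR L) by rewrite ler_wpM2l//; lra.
  by rewrite expr2; lra.
have e1 : expR u - 1 < 0 by rewrite subr_lt0 -expR0 ltr_expR.
rewrite (ltr0_norm e1) (ltr0_norm u0); split.
  have : - u * 1 <= - u * expR L by rewrite ler_wpM2l//; lra.
  by lra.
have : - u * (- (expR u - 1)) <= - u * (- u) by rewrite ler_wpM2l; lra.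
have : u ^+ 2 * 1 <= u ^+ 2 * expR L by rewrite ler_wpM2l// sqr_ge0.
by rewrite expr2; lra.
Qed.

Lemma cvg0_invS {R : realType} (f : nat -> R) (K : R) :
  (forall n, `|f n| <= K * n.+1%:R^-1) -> f @ \oo --> (0 : R).
Proof.
move=> fK; apply/cvgrPdist_le => e e0.
have K1 : 0 < `|K| + 1 by rewrite ltr_wpDl.
have := near_invS (divr_gt0 e0 K1); apply: filterS => n ne.
rewrite sub0r normrN (le_trans (fK n))//.
apply: (@le_trans _ _ ((`|K| + 1) * n.+1%:R^-1)).
  by rewrite ler_wpM2r ?invr_ge0// (le_trans (ler_norm K))// lerDl.
by rewrite mulrC -ler_pdivlMr.
Qed.

Section gaussian_error.
Context {d : measure_display} {T : measurableType d} {R : realType}.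
Variable P : probability T R.
Variables (eta : T -> R) (v : R).
Hypotheses (meta : measurable_fun setT eta) (v0 : 0 < v).
Hypothesis law : forall U : set R, measurable U ->
  P (eta @^-1` U) = normal_prob 0 (Num.sqrt v) U.
Local Notation L1 := (L1 P).
Local Notation L2 := (L2 P).
Local Notation mean := (mean P).

(** The error made by a drifted geometric step over an Euler step, without
    its non-random part. *)
Definition step_error (sigma a v b : R) : R :=
  expR (a * v) * (expR (sigma * b - sigma ^+ 2 * v / 2) - 1 - sigma * b) +
  (expR (a * v) - 1) * (sigma * b).

Lemma step_error_measurable sigma a : measurable_fun setT (step_error sigma a v).
Proof.
have mlin : measurable_fun setT (fun b : R => sigma * b) by exact: measurable_funM.
apply: measurable_funD; apply: measurable_funM => //.
apply: measurable_funB => //; apply: measurable_funB => //.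
by apply: measurableT_comp => //; exact: measurable_funB.
Qed.

Let E sigma w := expR (sigma * eta w - sigma ^+ 2 * v / 2).

Let EE sigma w : E sigma w = expR (- (sigma ^+ 2 * v / 2)) * expR (sigma * eta w).
Proof. by rewrite /E -expRD addrC. Qed.

Let L2E sigma : L2 (E sigma).
Proof.
by rewrite (funext (EE sigma)); apply: L2Z; exact: (gauss_L2_exp meta v0 law).
Qed.

Let meanE sigma : mean (E sigma) = 1.
Proof.
rewrite (funext (EE sigma)) meanZ; last exact: (gauss_L1_exp meta v0 law).
by rewrite (gauss_mean_exp meta v0 law) -expRD addNr expR0.
Qed.

Let meanbE sigma : mean (fun w => eta w * E sigma w) = sigma * v.
Proof.
have -> : (fun w => eta w * E sigma w) =
    (fun w => expR (- (sigma ^+ 2 * v / 2)) * (eta w * expR (sigma * eta w))).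
  by apply/funext => w; rewrite EE mulrCA.
rewrite meanZ; last first.
  by apply: L2_L1M; [exact: (gauss_L2 meta v0 law)|exact: (gauss_L2_exp meta v0 law)].
by rewrite (gauss_mean_mul_exp meta v0 law) mulrCA -expRD addNr expR0 mulr1.
Qed.

Let Q sigma w := E sigma w - 1 - sigma * eta w.

Let L2Q sigma : L2 (Q sigma).
Proof.
have L2b := gauss_L2 meta v0 law.
by apply: L2B; [apply: L2B => //; exact: (@L2_bnd _ _ _ _ _ `|1|)|exact: L2Z].
Qed.

Let meanQ2 sigma : mean (fun w => Q sigma w ^+ 2) <=
  expR (sigma ^+ 2 * v) - 1 - sigma ^+ 2 * v.
Proof.
have L2b := gauss_L2 meta v0 law; have L1b := L2_L1 L2b.
have [_ Lb2] := L2b; have [_ LE2] := L2E sigma.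
have LbE := L2_L1M L2b (L2E sigma).
have E2 : mean (fun w => E sigma w ^+ 2) = expR (sigma ^+ 2 * v).
  have -> : (fun w => E sigma w ^+ 2) =
    (fun w => expR (- (sigma ^+ 2 * v)) * expR (2 * sigma * eta w)).
    apply/funext => w; rewrite -expRM_natl -expRD; congr expR.
    by field.
  rewrite meanZ; last exact: (gauss_L1_exp meta v0 law).
  by rewrite (gauss_mean_exp meta v0 law) -expRD; congr expR; field.
have -> : mean (fun w => Q sigma w ^+ 2) = mean (fun w => E sigma w ^+ 2) +
    (sigma ^+ 2 * mean (fun w => eta w ^+ 2) + (mean (cst 1) + ((-2) * mean (E sigma) +
    ((- 2 * sigma) * mean (fun w => eta w * E sigma w) + 2 * sigma * mean eta)))).
  have LE1 := L2_L1 (L2E sigma).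
  have i1 := L1Z (- 2) LE1; have i2 := L1Z (- 2 * sigma) LbE.
  have i3 := L1Z (2 * sigma) L1b; have i4 := L1Z (sigma ^+ 2) Lb2.
  have i5 := L1D i2 i3; have i6 := L1D i1 i5; have i7 := L1D (L1_cst P 1) i6.
  have i8 := L1D i4 i7.
  rewrite -!meanZ// -(meanD i2 i3) -(meanD i1 i5).
  rewrite -(meanD (L1_cst P 1) i6) -(meanD i4 i7) -(meanD LE2 i8).
  by apply: eq_mean => w; rewrite /Q /=; ring.
rewrite E2 meanE meanbE (gauss_mean0 meta v0 law) mean_cst.
have := ler_wpM2l (sqr_ge0 sigma) (gauss_var_le meta v0 law); lra.
Qed.

Let step_errorE sigma a w : step_error sigma a v (eta w) =
  expR (a * v) * Q sigma w + ((expR (a * v) - 1) * sigma) * eta w.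
Proof. by rewrite /step_error /Q /E mulrA. Qed.

Lemma step_error_L2 sigma a : L2 (fun w => step_error sigma a v (eta w)).
Proof.
rewrite (funext (step_errorE sigma a)); apply: L2D; apply: L2Z => //.
exact: (gauss_L2 meta v0 law).
Qed.

Lemma step_error_mean0 sigma a : mean (fun w => step_error sigma a v (eta w)) = 0.
Proof.
have L1b := L2_L1 (gauss_L2 meta v0 law); have L1Q := L2_L1 (L2Q sigma).
rewrite (funext (step_errorE sigma a)) meanD; [|exact: L1Z|exact: L1Z].
rewrite !meanZ// (gauss_mean0 meta v0 law) mulr0 addr0.
have -> : mean (Q sigma) = mean (E sigma) - 1 - sigma * mean eta.
  have LE1 := L2_L1 (L2E sigma).
  rewrite -meanZ// -[X in _ - X - _](mean_cst P) -meanB//; last exact: L1_cst.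
  by rewrite -meanB//; [apply: L1B => //; exact: L1_cst|exact: L1Z].
by rewrite meanE (gauss_mean0 meta v0 law) mulr0 subr0 subrr mulr0.
Qed.

(** The terms of first order in [v] cancel because [eta] and
    [expR (sigma * eta - sigma ^+ 2 * v / 2)] have covariance [sigma * v]. *)
Lemma step_error_var sigma a : v <= 1 ->
  mean (fun w => step_error sigma a v (eta w) ^+ 2) <=
  2 * (expR `|a|) ^+ 2 * (sigma ^+ 4 * expR (sigma ^+ 2) + a ^+ 2 * sigma ^+ 2) *
  v ^+ 2.
Proof.
move=> v1.
have [_ LQ2] := L2Q sigma; have [_ Lb2] := gauss_L2 meta v0 law.
have [_ LS2] := step_error_L2 sigma a.
set p := expR (a * v); set q := (p - 1) * sigma.
apply: (@le_trans _ _ (2 * p ^+ 2 * mean (fun w => Q sigma w ^+ 2) +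
    2 * q ^+ 2 * mean (fun w => eta w ^+ 2))).
  rewrite -!meanZ// -meanD; [|exact: L1Z|exact: L1Z].
  apply: mean_le => // [|w]; first by apply: L1D; exact: L1Z.
  rewrite step_errorE -/p -/q.
  have := sqr_ge0 (p * Q sigma w - q * eta w).
  have -> : (p * Q sigma w - q * eta w) ^+ 2 = p ^+ 2 * Q sigma w ^+ 2 +
    q ^+ 2 * eta w ^+ 2 - 2 * (p * Q sigma w) * (q * eta w) by ring.
  have -> : (p * Q sigma w + q * eta w) ^+ 2 = p ^+ 2 * Q sigma w ^+ 2 +
    q ^+ 2 * eta w ^+ 2 + 2 * (p * Q sigma w) * (q * eta w) by ring.
  lra.
have av : `|a * v| <= `|a|.
  by rewrite normrM (gtr0_norm v0) ler_piMr.
have p0 : 0 <= p by exact: expR_ge0.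
have pA : p ^+ 2 <= expR `|a| ^+ 2.
  by rewrite ler_sqr ?nnegrE ?expR_ge0// ler_expR (le_trans (ler_norm _)).
have [h1 _] := expR_sub1_le av.
have s0 := sqr_ge0 sigma.
have sv : `|sigma ^+ 2 * v| <= sigma ^+ 2.
  by rewrite (ger0_norm (mulr_ge0 s0 (ltW v0))) ler_piMr.
have [_ h2] := expR_sub1_le sv.
have hQ : mean (fun w => Q sigma w ^+ 2) <= sigma ^+ 4 * expR (sigma ^+ 2) * v ^+ 2.
  apply: (le_trans (meanQ2 sigma)); apply: (le_trans (ler_norm _)).
  apply: (le_trans h2); rewrite exprMn -exprM.
  by rewrite le_eqVlt; apply/orP; left; apply/eqP; ring.
have hq : q ^+ 2 <= expR `|a| ^+ 2 * (a ^+ 2 * sigma ^+ 2) * v ^+ 2.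
  rewrite /q exprMn.
  have -> : expR `|a| ^+ 2 * (a ^+ 2 * sigma ^+ 2) * v ^+ 2 =
    (a * v) ^+ 2 * expR `|a| ^+ 2 * sigma ^+ 2 by ring.
  rewrite ler_wpM2r//.
  rewrite -(real_normK (num_real (p - 1))) -(real_normK (num_real (a * v))).
  by rewrite -exprMn ler_sqr ?nnegrE ?mulr_ge0 ?expR_ge0.
have m0 : 0 <= mean (fun w => Q sigma w ^+ 2).
  by apply: mean_ge0 => w; exact: sqr_ge0.
have mb := gauss_var_le meta v0 law.
have mb0 : 0 <= mean (fun w => eta w ^+ 2).
  by apply: mean_ge0 => w; exact: sqr_ge0.
have k1 : p ^+ 2 * mean (fun w => Q sigma w ^+ 2) <=
    expR `|a| ^+ 2 * (sigma ^+ 4 * expR (sigma ^+ 2) * v ^+ 2).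
  by apply: ler_pM => //; exact: sqr_ge0.
have k2 : q ^+ 2 * mean (fun w => eta w ^+ 2) <=
    (expR `|a| ^+ 2 * (a ^+ 2 * sigma ^+ 2) * v ^+ 2) * 1.
  by apply: ler_pM => //; [exact: sqr_ge0|exact: le_trans v1].
lra.
Qed.

End gaussian_error.

Section geometric_brownian_motion.
Context {d : measure_display} {T : measurableType d} {R : realType}.
Variable P : probability T R.
Variable F : R -> set (set T).
Hypothesis hF : filtration F.
Variable B : R -> T -> R.
Hypothesis hB : brownian P F B.
Local Notation L1 := (L1 P).
Local Notation L2 := (L2 P).
Local Notation mean := (mean P).
Local Notation mu := (@lebesgue_measure R).

Let sF (t : R) : 0 <= t -> sigma_algebra setT (F t).
Proof. by case: hF => + _ _; exact. Qed.

Definition geom (x sigma c : R) (t : R) (w : T) : R :=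
  x * expR (sigma * B t w + c * t).

Lemma brownian_cont : continuous_paths B. Proof. by case: hB. Qed.

Lemma brownian0 w : B 0 w = 0. Proof. by case: hB. Qed.

Lemma brownian_exp_moment (c t : R) : 0 <= t ->
  L1 (fun w => expR (c * B t w)) /\
  mean (fun w => expR (c * B t w)) = expR (c ^+ 2 * t / 2).
Proof.
rewrite le_eqVlt => /predU1P[<-|t0].
  have -> : (fun w => expR (c * B 0 w)) = cst 1.
    by apply/funext => w; rewrite brownian0 mulr0 expR0.
  by rewrite mean_cst mulr0 mul0r expR0; split => //; exact: L1_cst.
have -> : (fun w => expR (c * B t w)) = (fun w => expR (c * (B t w - B 0 w))).
  by apply/funext => w; rewrite brownian0 subr0.
have m0 := incr_meas hF hB (lexx 0) (ltW t0).
have v0 : 0 < t - 0 by rewrite subr0.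
have law := incr_law hB (lexx 0) t0.
split; first exact: (gauss_L1_exp m0 v0 law).
by rewrite (gauss_mean_exp m0 v0 law) subr0.
Qed.

Lemma geom_adapted x sigma c : adapted F (geom x sigma c).
Proof.
move=> t t0; apply: (wrtZ (sF t0)).
apply: (wrt_comp (h := expR)) => //.
apply: (wrtD (sF t0)); last exact: (wrt_cst (sF t0)).
by apply: (wrtZ (sF t0)); exact: (brownian_adapted hB).
Qed.

Lemma geom_cont x sigma c : continuous_paths (geom x sigma c).
Proof.
move=> w; apply: pathZ; apply: (path_comp (@continuous_expR R)).
by apply: pathD; apply: pathZ; [exact: brownian_cont|exact: path_id].
Qed.

Lemma geom_L2 x sigma c t : 0 <= t -> L2 (geom x sigma c t) /\
  mean (fun w => geom x sigma c t w ^+ 2) =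
  x ^+ 2 * expR (2 * c * t + 2 * sigma ^+ 2 * t).
Proof.
move=> t0; have [L m] := brownian_exp_moment (2 * sigma) t0.
have E : (fun w => geom x sigma c t w ^+ 2) =
    (fun w => (x ^+ 2 * expR (2 * c * t)) * expR (2 * sigma * B t w)).
  apply/funext => w; rewrite /geom exprMn -expRM_natl -mulrA -expRD.
  by congr (_ * expR _); ring.
split.
  by split; [exact: (adapted_meas hF (geom_adapted x sigma c))|rewrite E; exact: L1Z].
rewrite E meanZ// m -mulrA -expRD; by congr (_ * expR _); field.
Qed.

Let grid_sqr_sum (t mesh : R) m g : grid t mesh m g ->
  \sum_(j < m) (g j.+1 - g j) ^+ 2 <= t * mesh.
Proof.
move=> gr; have [g0 gm gS gmesh] := gr.
have -> : t = \sum_(j < m) (g j.+1 - g j) by rewrite telescope_grid gm g0 subr0.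
rewrite mulr_suml; apply: ler_sum => j _; rewrite expr2 ler_wpM2l ?gmesh//.
by rewrite subr_ge0 ltW// gS.
Qed.

(** Ito's formula for the exponential, in the only form needed: the Euler sums
    of the geometric process converge to its increment.  The error is a
    transform of centred increments plus a sum of second order terms. *)
Lemma euler_geometric x sigma a t (m : nat -> nat) (g : nat -> nat -> R) :
  0 <= t -> (forall n, grid t n.+1%:R^-1 (m n) (g n)) ->
  let G := geom x sigma (a - sigma ^+ 2 / 2) in
  cvp P (fun n w => euler_sum B sigma a G (m n) (g n) w - (G t w - x)).
Proof.
move=> t0 gr G; set c := a - sigma ^+ 2 / 2 in G *.
pose v n j := g n j.+1 - g n j.
have gj0 n j : (j <= m n)%N -> 0 <= g n j by move=> /(grid_range (gr n)) /andP[].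
have gS n j : (j < m n)%N -> g n j < g n j.+1 by case: (gr n) => _ _ + _; exact.
have vpos n j : (j < m n)%N -> 0 < v n j by move=> jm; rewrite subr_gt0 gS.
have v1 n j : (j < m n)%N -> v n j <= 1.
  move=> jm; have [_ _ _ /(_ j jm)] := gr n; move/le_trans; apply.
  by rewrite invf_le1// ler1n.
have mG (s : R) : 0 <= s -> measurable_fun setT (G s).
  exact: (adapted_meas hF (geom_adapted x sigma c)).
have mB n j : (j < m n)%N -> measurable_fun setT (fun w => B (g n j.+1) w - B (g n j) w).
  by move=> jm; apply: (incr_meas hF hB); [exact/gj0/ltnW|exact/ltW/gS].
have law n j (jm : (j < m n)%N) := incr_law hB (gj0 n j (ltnW jm)) (gS n j jm).
pose h n j := step_error sigma a (v n j).
pose M n w := \sum_(j < m n) G (g n j) w * h n j (B (g n j.+1) w - B (g n j) w).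
pose r n j := expR (a * v n j) - 1 - a * v n j.
pose N n w := \sum_(j < m n) G (g n j) w * r n j.
have step n j w : (j < m n)%N -> G (g n j.+1) w - G (g n j) w -
    G (g n j) w * (sigma * (B (g n j.+1) w - B (g n j) w) + a * (g n j.+1 - g n j)) =
    G (g n j) w * h n j (B (g n j.+1) w - B (g n j) w) + G (g n j) w * r n j.
  move=> jm; set b := B (g n j.+1) w - B (g n j) w.
  have -> : G (g n j.+1) w = G (g n j) w * (expR (a * v n j) *
      expR (sigma * b - sigma ^+ 2 * v n j / 2)).
    rewrite /G /geom -mulrA -!expRD; congr (_ * expR _); rewrite /b /v /c.
    by field.
  by rewrite /h /step_error /r -/(v n j); ring.
have EE n w : euler_sum B sigma a G (m n) (g n) w - (G t w - x) =
    (-1) * (M n w + N n w).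
  have -> : G t w - x = \sum_(j < m n) (G (g n j.+1) w - G (g n j) w).
    rewrite (telescope_grid (fun j => G (g n j) w)).
    have [-> -> _ _] := gr n.
    by rewrite /G {3}/geom brownian0 !mulr0 addr0 expR0 mulr1.
  rewrite /euler_sum /M /N -big_split/= -sumrB mulr_sumr; apply: eq_bigr => j _.
  by rewrite -(step n j w (ltn_ord j)); ring.
have mM n : measurable_fun setT (M n).
  apply: measurable_sum => j; have jm := ltn_ord j.
  apply: measurable_funM; first by apply: mG; apply: gj0; exact: ltnW.
  by apply: measurableT_comp; [exact: step_error_measurable|exact: mB].
have mN n : measurable_fun setT (N n).
  apply: measurable_sum => j; apply: measurable_funM => //.
  by apply: mG; apply: gj0; exact: ltnW.
rewrite (funext (fun n => funext (EE n))).
apply: cvpZ; first by move=> n; exact: measurable_funD.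
apply: cvpD => //.
- pose C := 2 * (expR `|a|) ^+ 2 *
    (sigma ^+ 4 * expR (sigma ^+ 2) + a ^+ 2 * sigma ^+ 2).
  have C0 : 0 <= C.
    rewrite /C mulr_ge0 ?mulr_ge0 ?exprn_ge0 ?expR_ge0// addr_ge0//.
      by rewrite mulr_ge0 ?expR_ge0// (exprM _ 2 2) sqr_ge0.
    by rewrite mulr_ge0 ?sqr_ge0.
  pose CG := x ^+ 2 * expR ((2 * `|c| + 2 * sigma ^+ 2) * t).
  have CG0 : 0 <= CG by rewrite mulr_ge0 ?sqr_ge0 ?expR_ge0.
  have HM n : L2 (M n) /\ mean (fun w => M n w ^+ 2) <= CG * C * t * n.+1%:R^-1.
    have [g0 gm _ _] := gr n.
    have [|||||j jm|_ LM leM] := @transform_L2 _ _ _ P F hF B hB (g n) (h n)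
      (fun j => G (g n j)) (fun j => C * v n j ^+ 2) (m n) _ (gS n).
    - by rewrite g0.
    - by move=> j jm; exact: step_error_measurable.
    - by move=> j jm; exact: (step_error_L2 (mB n j jm) (vpos n j jm) (law n j jm)).
    - by move=> j jm; exact: (step_error_mean0 (mB n j jm) (vpos n j jm) (law n j jm)).
    - move=> j jm.
      exact: (step_error_var (mB n j jm) (vpos n j jm) (law n j jm) _ _ (v1 n j jm)).
    - have gj := gj0 n j (ltnW jm); split; first exact: geom_adapted.
      by have [] := geom_L2 x sigma c gj.
    split=> //; apply: (le_trans leM).
    apply: (@le_trans _ _ (\sum_(j < m n) CG * C * v n j ^+ 2)); last first.
      rewrite -mulr_sumr -[leRHS]mulrA ler_wpM2l ?(mulr_ge0 CG0 C0)//.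
      exact: grid_sqr_sum (gr n).
    apply: ler_sum => j _; have jm := ltn_ord j.
    have gj := gj0 n j (ltnW jm); have [_ ->] := geom_L2 x sigma c gj.
    rewrite -[leRHS]mulrA ler_wpM2r ?(mulr_ge0 C0 (sqr_ge0 _))//.
    rewrite ler_wpM2l ?sqr_ge0// ler_expR.
    have /andP[_ gt] := grid_range (gr n) (ltnW jm).
    have : c * g n j <= `|c| * t.
      by apply: (le_trans (ler_norm _)); rewrite normrM ler_pM// ger0_norm.
    have : sigma ^+ 2 * g n j <= sigma ^+ 2 * t by rewrite ler_wpM2l ?sqr_ge0.
    lra.
  apply: cvp_mean_sqr => [n|]; first by case: (HM n).
  apply: (@cvg0_invS _ _ (CG * C * t)) => n.
  by rewrite ger0_norm ?mean_ge0//; [case: (HM n)|move=> w; exact: sqr_ge0].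
- apply: cvp_pointwise => // w.
  have [K K0 HK] := path_bounded t (@geom_cont x sigma c w).
  apply: (@cvg0_invS _ _ (K * (a ^+ 2 * expR `|a|) * t)) => n.
  apply: (le_trans (ler_norm_sum _ _ _)).
  apply: (@le_trans _ _ (\sum_(j < m n) K * (a ^+ 2 * expR `|a|) * v n j ^+ 2)).
    apply: ler_sum => j _; have jm := ltn_ord j.
    have av : `|a * v n j| <= `|a|.
      by rewrite normrM (gtr0_norm (vpos n j jm)) ler_piMr// v1.
    have [_ hr] := expR_sub1_le av.
    rewrite normrM -mulrA ler_pM//.
      by apply: HK; exact: grid_range (gr n) _ (ltnW jm).
    by apply: (le_trans hr); rewrite exprMn mulrAC.
  have K1 : 0 <= K * (a ^+ 2 * expR `|a|).
    by apply: mulr_ge0 => //; apply: mulr_ge0; [exact: sqr_ge0|exact: expR_ge0].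
  rewrite -mulr_sumr -[leRHS]mulrA ler_wpM2l//.
  exact: grid_sqr_sum (gr n).
Qed.

Lemma cvp_ae (Z Z' : nat -> T -> R) : (forall n, measurable_fun setT (Z n)) ->
  (forall n, measurable_fun setT (Z' n)) ->
  {ae P, forall w, forall n, Z n w = Z' n w} -> cvp P Z -> cvp P Z'.
Proof.
move=> mZ mZ' [ O [mO O0 HO]] cZ e e0; apply: filterS (cZ e e0) => n le.
apply: (@le_trans _ _ (prob P ([set w | e <= `|Z n w|] `|` O))).
  apply: le_prob.
  - exact: measurable_ge_norm.
  - by apply: measurableU => //; exact: measurable_ge_norm.
  - move=> w /= ew; case: (pselect (Z n w = Z' n w)) => [E|NE].
      by left; rewrite /= E.
    by right; apply: HO => /= /(_ n).
have O0' : prob P O = 0 by rewrite /prob O0.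
apply: (le_trans (@probU _ _ _ P _ _ _ _)) => //; first exact: measurable_ge_norm.
by rewrite O0' addr0.
Qed.

(** The given solution and the explicit one satisfy the same linear equation,
    and the difference starts at 0. *)
Theorem gbm_explicit x sigma a X : is_gbm P F x sigma a B X ->
  {ae P, forall w, forall t, 0 <= t -> X t w = geom x sigma (a - sigma ^+ 2 / 2) t w}.
Proof.
move=> [aX cX HX]; set G := geom x sigma _.
have mX (t : R) : 0 <= t -> measurable_fun setT (X t) by exact: (adapted_meas hF aX).
have aG : adapted F G := @geom_adapted x sigma _.
have mG (t : R) : 0 <= t -> measurable_fun setT (G t) by exact: (adapted_meas hF aG).
pose D (t : R) w := X t w - G t w.
have aD : adapted F D.
  by move=> t t0; apply: (wrtB (sF t0)); [exact: aX|exact: aG].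
have cD : continuous_paths D by move=> w; apply: pathB; [exact: cX|exact: geom_cont].
suff euler t : 0 <= t -> exists (m : nat -> nat) (g : nat -> nat -> R),
    (forall n, grid t n.+1%:R^-1 (m n) (g n)) /\
    cvp P (fun n w => euler_sum B sigma a D (m n) (g n) w - D t w).
  have := linear_unique_ae hF hB aD cD euler.
  apply: filterS => w H t t0; apply/eqP; rewrite -subr_eq0; apply/eqP; exact: H.
move=> t0; have [I HI XE] := HX t t0.
have aH : adapted F (fun s w => sigma * X s w).
  by move=> s s0; apply: (wrtZ (sF s0)); exact: aX.
have cH : continuous_paths (fun s w => sigma * X s w).
  by move=> w; apply: pathZ; exact: cX.
have [m [g [gr cI]]] := ito_riemann hF hB aH cH t0 HI.
have mI : measurable_fun setT I by case: HI.
exists m, g; split => //.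
have gj0 n j : (j <= m n)%N -> 0 <= g n j by move=> /(grid_range (gr n)) /andP[].
have mdB n j : (j < m n)%N -> measurable_fun setT (fun w => B (g n j.+1) w - B (g n j) w).
  move=> jm; apply: (incr_meas hF hB); first exact/gj0/ltnW.
  by apply/ltW; case: (gr n) => _ _ + _; exact.
pose J w := \int[mu]_(s in `[0, t]) (a * X s w).
pose JR n w := \sum_(j < m n) (a * X (g n j) w) * (g n j.+1 - g n j).
pose IR n w := \sum_(j < m n) (sigma * X (g n j) w) * (B (g n j.+1) w - B (g n j) w).
have mJR n : measurable_fun setT (JR n).
  apply: measurable_sum => j; apply: measurable_funM => //.
  by apply: measurable_funM => //; apply: mX; apply: gj0; exact: ltnW.
have mIR n : measurable_fun setT (IR n).
  apply: measurable_sum => j; apply: measurable_funM; last exact: mdB.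
  by apply: measurable_funM => //; apply: mX; apply: gj0; exact: ltnW.
have JRJ w : JR n w @[n --> \oo] --> J w.
  have caX : {within `[0, +oo[, continuous (fun s => a * X s w)}.
    by apply: pathZ; exact: cX.
  apply/cvgrPdist_lt => e e0.
  have [mesh mesh0 Hm] := riemann_sum_cvg caX t0 e0.
  apply: filterS (near_invS mesh0) => n nm; apply: Hm.
  exact: grid_mesh nm (gr n).
have mJ : measurable_fun setT J.
  by apply: (measurable_fun_cvg (h := JR)) => // w _; exact: JRJ.
have cJ : cvp P (fun n w => JR n w - J w).
  apply: cvp_pointwise => [n|w]; first exact: measurable_funB.
  by apply/subr_cvg0; exact: JRJ.
have meuler (f : R -> T -> R) n : (forall s, 0 <= s -> measurable_fun setT (f s)) ->
    measurable_fun setT (euler_sum B sigma a f (m n) (g n)).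
  move=> mf; apply: measurable_sum => j; apply: measurable_funM.
    by apply: mf; apply: gj0; exact: ltnW.
  by apply: measurable_funD => //; apply: measurable_funM => //; exact: mdB.
have cX' : cvp P (fun n w => euler_sum B sigma a X (m n) (g n) w - (X t w - x)).
  have := cvpD (fun n => measurable_funB (mIR n) mI) (fun n => measurable_funB (mJR n) mJ) cI cJ.
  apply: cvp_ae => [n|n|].
  - by apply: measurable_funD; exact: measurable_funB.
  - apply: measurable_funB; first exact: meuler.
    by apply: measurable_funB => //; exact: mX.
  - apply: filterS XE => w XE n /=; rewrite XE /J.
    have -> : euler_sum B sigma a X (m n) (g n) w = IR n w + JR n w.
      rewrite /IR /JR -big_split/=; apply: eq_bigr => j _; ring.
    by ring.
have := cvpB _ _ cX' (@euler_geometric x sigma a t m g t0 gr).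
rewrite -/G => H; have {}H := H _ _.
have -> : (fun n w => euler_sum B sigma a D (m n) (g n) w - D t w) =
  (fun n w => (euler_sum B sigma a X (m n) (g n) w - (X t w - x)) -
              (euler_sum B sigma a G (m n) (g n) w - (G t w - x))).
  apply/funext => n; apply/funext => w.
  have -> : euler_sum B sigma a D (m n) (g n) w =
      euler_sum B sigma a X (m n) (g n) w - euler_sum B sigma a G (m n) (g n) w.
    by rewrite -sumrB; apply: eq_bigr => j _; rewrite -mulrBl.
  by rewrite /D; ring.
apply: H => n.
- apply: measurable_funB; first exact: meuler.
  by apply: measurable_funB => //; exact: mX.
- apply: measurable_funB; first exact: meuler.
  by apply: measurable_funB => //; exact: mG.
Qed.

End geometric_brownian_motion.

(** * Martingales and hitting probabilities *)

Section staying_positive.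
Context {d : measure_display} {T : measurableType d} {R : realType}.
Variable F : R -> set (set T).
Hypothesis hF : filtration F.

Definition stay (f : R -> T -> R) (t : R) : set T :=
  [set w | forall s, 0 <= s <= t -> 0 < f s w].

(** A positive continuous function on a segment is bounded below by some
    [k.+1%:R^-1]. *)
Lemma stay_event (f : R -> T -> R) t : adapted F f -> continuous_paths f ->
  0 <= t -> F t (stay f t).
Proof.
move=> af cf t0.
have sF (s : R) : 0 <= s -> sigma_algebra setT (F s) by case: hF => + _ _; exact.
pose C k := [set w | forall s, 0 <= s <= t -> (-1) * f s w <= - k.+1%:R^-1].
have -> : stay f t = ~` \bigcap_k ~` C k.
  rewrite setC_bigcap; apply/seteqP; split => w /= H.
    have cN : {within `[0, t], continuous (fun s => f s w)}.
      by apply: continuous_subspaceW (cf w) => s /=; rewrite !in_itv/= andbT => /andP[].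
    have [c] := EVT_min t0 cN; rewrite in_itv/= => ct Hc.
    have [k _ /(_ k (leqnn k)) kc] := near_invS (H c ct).
    exists k => // H2; apply: H2 => s st /=.
    by rewrite mulN1r lerN2 (le_trans kc)// Hc// in_itv.
  move: H => [k _ /=]; rewrite /C /= => /contrapT H s st.
  have := H s st; rewrite mulN1r lerN2; apply: lt_le_trans.
  by rewrite invr_gt0.
apply: (wrtC (sF t t0)); apply: (wrt_bigcap (sF t t0)) => k.
apply: (wrtC (sF t t0)); apply: (path_le_event hF) => //.
  by move=> s s0; apply: (wrtZ (sF s s0)); exact: af.
by move=> w; apply: pathZ; exact: cf.
Qed.

End staying_positive.

Lemma grid_near {R : realType} (t mesh : R) m g s : grid t mesh m g ->
  0 <= s <= t -> 0 <= mesh -> exists2 j, (j <= m)%N & `|s - g j| <= mesh.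
Proof.
move=> gr /andP[s0 st] mesh0; have [g0 gm gS gmesh] := gr.
have ex : exists j, (j <= m)%N && (s <= g j) by exists m; rewrite leqnn gm.
case: (ex_minnP ex) => [] [|j] /andP[jm sj] jmin.
  by exists 0%N => //; rewrite g0 in sj *; rewrite subr0 ger0_norm// (le_trans sj).
exists j; first exact: ltnW.
have gjs : g j < s.
  rewrite ltNge; apply/negP => H; have := jmin j.
  by rewrite H (ltnW jm)/= ltnn => /(_ isT).
rewrite gtr0_norm ?subr_gt0//; have := gmesh j jm; lra.
Qed.

Section martingales.
Context {d : measure_display} {T : measurableType d} {R : realType}.
Variable P : probability T R.
Variable F : R -> set (set T).
Hypothesis hF : filtration F.
Local Notation L1 := (L1 P).
Local Notation mean := (mean P).
Local Notation prob := (prob P).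

Let sF (t : R) : 0 <= t -> sigma_algebra setT (F t).
Proof. by case: hF => + _ _; exact. Qed.
Let mF (t : R) : 0 <= t -> F t `<=` measurable.
Proof. by case: hF => _ + _; exact. Qed.
Let FF (s t : R) : 0 <= s -> s <= t -> F s `<=` F t.
Proof. by case: hF => _ _; exact. Qed.

Definition martingale (K : R -> T -> R) : Prop :=
  [/\ adapted F K, forall t, 0 <= t -> L1 (K t)
    & forall s t A, 0 <= s -> s <= t -> F s A ->
      mean (fun w => \1_A w * K t w) = mean (fun w => \1_A w * K s w)].

Lemma martingaleD K1 K2 : martingale K1 -> martingale K2 ->
  martingale (fun t w => K1 t w + K2 t w).
Proof.
move=> [a1 l1 m1] [a2 l2 m2]; split => [t t0|t t0|s t A s0 st FA].
- by apply: (wrtD (sF t0)); [exact: a1|exact: a2].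
- by apply: L1D; [exact: l1|exact: l2].
- have t0 := le_trans s0 st; have mA := mF s0 FA.
  have D r : 0 <= r -> mean (fun w => \1_A w * (K1 r w + K2 r w)) =
      mean (fun w => \1_A w * K1 r w) + mean (fun w => \1_A w * K2 r w).
    move=> r0; rewrite -meanD; [|exact/L1_indic/l1|exact/L1_indic/l2].
    by apply: eq_mean => w; rewrite mulrDr.
  by rewrite !D// (m1 s t)// (m2 s t).
Qed.

Lemma martingaleZ c K : martingale K -> martingale (fun t w => c * K t w).
Proof.
move=> [aK lK mK]; split => [t t0|t t0|s t A s0 st FA].
- by apply: (wrtZ (sF t0)); exact: aK.
- by apply: L1Z; exact: lK.
- have t0 := le_trans s0 st; have mA := mF s0 FA.
  have Z r : 0 <= r -> mean (fun w => \1_A w * (c * K r w)) =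
      c * mean (fun w => \1_A w * K r w).
    move=> r0; rewrite -meanZ; last exact/L1_indic/lK.
    by apply: eq_mean => w; rewrite mulrCA.
  by rewrite !Z// (mK s t).
Qed.

Lemma martingale_mean K t : martingale K -> 0 <= t -> mean (K t) = mean (K 0).
Proof.
move=> [_ _ mK] t0; have := mK 0 t setT (lexx 0) t0 (wrtT (sF (lexx 0))).
have E r : mean (fun w => \1_setT w * K r w) = mean (K r).
  by apply: eq_mean => w; rewrite indicT mul1r.
by rewrite !E.
Qed.

Lemma exp_martingale B c : brownian P F B ->
  martingale (fun t w => expR (c * B t w - c ^+ 2 / 2 * t)).
Proof.
move=> hB; set K := (X in martingale X).
have KE t w : K t w = expR (- (c ^+ 2 / 2 * t)) * expR (c * B t w).
  by rewrite /K -expRD addrC.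
have aK : adapted F K.
  move=> t t0; apply: (wrt_comp (h := expR)) => //.
  apply: (wrtB (sF t0)); last exact: (wrt_cst (sF t0)).
  by apply: (wrtZ (sF t0)); exact: (brownian_adapted hB).
have lK t : 0 <= t -> L1 (K t).
  move=> t0; rewrite (funext (KE t)); apply: L1Z.
  by have [] := brownian_exp_moment hF hB c t0.
split => // s t A s0; rewrite le_eqVlt => /predU1P[->//|st] FA.
have mA := mF s0 FA; have Ls := L1_indic mA (lK s s0).
have m0 := incr_meas hF hB s0 (ltW st).
have v0 : 0 < t - s by rewrite subr_gt0.
have law := incr_law hB s0 st.
have Fxi : measurable_wrt (F s) (fun w => \1_A w * K s w).
  by apply: (wrtM (sF s0)); [exact: (wrt_indic (sF s0))|exact: aK].
have mh : measurable_fun setT (fun b : R => expR (c * b)).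
  by apply: measurableT_comp => //; exact: measurable_funM.
have Lh := gauss_L1_exp m0 v0 law c.
have [L E] := incr_indep hF hB s0 st Fxi mh Ls Lh.
rewrite (gauss_mean_exp m0 v0 law c) in E.
have -> : (fun w => \1_A w * K t w) = (fun w => expR (- (c ^+ 2 / 2 * (t - s))) *
    (\1_A w * K s w * expR (c * (B t w - B s w)))).
  apply/funext => w.
  have -> : K t w = expR (- (c ^+ 2 / 2 * (t - s))) *
      (K s w * expR (c * (B t w - B s w))).
    by rewrite /K -!expRD; congr expR; ring.
  by ring.
rewrite meanZ// E mulrCA -expRD.
have -> : - (c ^+ 2 / 2 * (t - s)) + c ^+ 2 * (t - s) / 2 = 0 by field.
by rewrite expR0 mulr1.
Qed.

Fixpoint reach (E : nat -> set T) (k : nat) : set T :=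
  if k is k'.+1 then reach E k' `|` E k else E 0%N.

Lemma reachP E k w : reach E k w <-> exists2 j, (j <= k)%N & E j w.
Proof.
elim: k => [|k IH] /=.
  by split => [H|[j]]; [exists 0%N|rewrite leqn0 => /eqP ->].
split => [[/IH[j jk Ej]|H]|[j]]; first by exists j => //; exact: leqW.
  by exists k.+1.
rewrite leq_eqVlt => /predU1P[-> H|jk Ej]; first by right.
by left; apply/IH; exists j.
Qed.

Section along_a_chain.
Variables (K : R -> T -> R) (g : nat -> R) (m : nat).
Hypothesis hK : martingale K.
Hypotheses (g0 : 0 <= g 0%N) (gS : forall j, (j < m)%N -> g j < g j.+1).

Let gj0 j : (j <= m)%N -> 0 <= g j.
Proof. by move=> jm; rewrite (le_trans g0)// (chain_le gS). Qed.

Let Freach E k : (forall j, (j <= m)%N -> F (g j) (E j)) -> (k <= m)%N ->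
  F (g k) (reach E k).
Proof.
move=> FE; elim: k => [|k IH] km /=; first exact: FE.
apply: (wrtU (sF (gj0 km))); last exact: FE.
apply: (FF (gj0 (ltnW km)) (ltW (gS km))); exact: IH (ltnW km).
Qed.

Let LK k : (k <= m)%N -> L1 (K (g k)).
Proof. by move=> km; case: hK => _ + _; apply; exact: gj0. Qed.

Let meanU A C k : (k <= m)%N -> F (g k) A -> F (g k) C -> A `&` C = set0 ->
  mean (fun w => \1_(A `|` C) w * K (g k) w) =
  mean (fun w => \1_A w * K (g k) w) + mean (fun w => \1_C w * K (g k) w).
Proof.
move=> km FA FC AC; have mA := mF (gj0 km) FA; have mC := mF (gj0 km) FC.
rewrite -meanD; [|exact/L1_indic/LK|exact/L1_indic/LK].
apply: eq_mean => w; rewrite -mulrDl; congr (_ * _).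
rewrite !indicE in_setU; case: (boolP (w \in A)) => wA; last by rewrite add0r.
case: (boolP (w \in C)) => wC; last by rewrite addr0.
by move: wA wC; rewrite !inE => wA wC; have : (A `&` C) w by []; rewrite AC.
Qed.

Let probUd A C : measurable A -> measurable C -> A `&` C = set0 ->
  prob (A `|` C) = prob A + prob C.
Proof.
move=> mA mC AC; apply: EFin_inj; rewrite EFinD -!probE//; last exact: measurableU.
by rewrite measureU.
Qed.

(** Split by the first time at which the level is reached: afterwards the
    martingale keeps its mean. *)
Lemma doob_chain c k : (k <= m)%N ->
  c * prob (reach (fun j => [set w | c <= K (g j) w]) k) <=
  mean (fun w => \1_(reach (fun j => [set w | c <= K (g j) w]) k) w * K (g k) w).
Proof.
set E := (fun j => _).
have aK : adapted F K by case: hK.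
have FE j : (j <= m)%N -> F (g j) (E j).
  by move=> jm; apply: wrt_ge; apply: aK; exact: gj0.
have base A j : (j <= m)%N -> F (g j) A -> A `<=` E j ->
    c * prob A <= mean (fun w => \1_A w * K (g j) w).
  move=> jm FA AE; have mA := mF (gj0 jm) FA.
  rewrite -mean_indic// -meanZ; last exact: L1_indic1.
  apply: mean_le; [exact/L1Z/L1_indic1|exact/L1_indic/LK|move=> w].
  rewrite indicE; case: (boolP (w \in A)) => [|_]; last by rewrite mulr0 mul0r.
  by rewrite inE mulr1 mul1r => /AE.
elim: k => [|k IH] km; first by apply: (base _ 0%N) => //; exact: FE.
have {}IH := IH (ltnW km).
have Fk := Freach FE (ltnW km).
have kS := ltW (gS km).
have Fk' := FF (gj0 (ltnW km)) kS Fk.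
have FEk := FE k.+1 km.
have Fnew : F (g k.+1) (E k.+1 `\` reach E k).
  by rewrite setDE; apply: (wrtI (sF (gj0 km))) => //; exact: (wrtC (sF (gj0 km))).
have disj : reach E k `&` (E k.+1 `\` reach E k) = set0.
  by apply/seteqP; split => // w [? []].
have -> : reach E k.+1 = reach E k `|` (E k.+1 `\` reach E k) by rewrite setUDr setDv setD0.
rewrite meanU// probUd//; [|exact: (mF (gj0 km) Fk')|exact: (mF (gj0 km) Fnew)].
rewrite mulrDr lerD//; last by apply: base => // w [].
case: hK => _ _ mK; rewrite (mK (g k) (g k.+1))//; exact: gj0 (ltnW km).
Qed.

Variables (Z : R -> T -> R) (lev : R).
Hypothesis aZ : adapted F Z.

Let E j : set T := [set w | Z (g j) w <= 0].
Let big j : set T := [set w | lev < K (g j) w].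

(** The part of the first passage of [Z] below 0 at which [K] overshoots. *)
Fixpoint overshoot (k : nat) : set T :=
  if k is k'.+1 then overshoot k' `|` ((E k `\` reach E k') `&` big k)
  else E 0%N `&` big 0%N.

Let FE j : (j <= m)%N -> F (g j) (E j).
Proof. by move=> jm; apply: wrt_le; apply: aZ; exact: gj0. Qed.

Let Fbig j : (j <= m)%N -> F (g j) (big j).
Proof. by move=> jm; apply: wrt_gt; case: hK => aK _ _; apply: aK; exact: gj0. Qed.

Lemma reach_event k : (k <= m)%N -> F (g k) (reach E k).
Proof. exact: Freach FE. Qed.

Let Fnew k : (k < m)%N -> F (g k.+1) (E k.+1 `\` reach E k).
Proof.
move=> km; rewrite setDE; apply: (wrtI (sF (gj0 km))); first exact: FE.
apply: (wrtC (sF (gj0 km))); apply: (FF (gj0 (ltnW km)) (ltW (gS km))).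
exact: reach_event (ltnW km).
Qed.

Lemma overshoot_event k : (k <= m)%N -> F (g k) (overshoot k).
Proof.
elim: k => [|k IH] km /=.
  by apply: (wrtI (sF (gj0 km))); [exact: FE|exact: Fbig].
apply: (wrtU (sF (gj0 km))).
  by apply: (FF (gj0 (ltnW km)) (ltW (gS km))); exact: IH (ltnW km).
by apply: (wrtI (sF (gj0 km))); [exact: Fnew|exact: Fbig].
Qed.

Let overshoot_reach k : overshoot k `<=` reach E k.
Proof.
elim: k => [|k IH] /=; first by move=> w [].
by move=> w [/IH|[[Ew _] _]]; [left|right].
Qed.

Lemma overshootP k w : overshoot k w ->
  (Z (g 0%N) w <= 0) \/
  exists j, [/\ (j < k)%N, 0 < Z (g j) w & lev < K (g j.+1) w].
Proof.
elim: k => [[]|k IH] /=; first by left.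
move=> [/IH[H|[j [jk Zj Kj]]]|[[_ nr] bigk]]; first by left.
  by right; exists j; split => //; exact: ltnW.
right; exists k; split => //; rewrite ltNge; apply/negP => Zk; apply: nr.
by apply/reachP; exists k.
Qed.

Hypothesis lev0 : 0 <= lev.

(** The same splitting: where it does not overshoot, [K] is at most [lev] at the
    first passage. *)
Lemma passage_chain k : (k <= m)%N ->
  mean (fun w => \1_(reach E k) w * K (g k) w) <=
  lev * prob (reach E k) + mean (fun w => \1_(overshoot k) w * K (g k) w).
Proof.
have base A j : (j <= m)%N -> F (g j) A ->
    mean (fun w => \1_A w * K (g j) w) <=
    lev * prob A + mean (fun w => \1_(A `&` big j) w * K (g j) w).
  move=> jm FA; have mA := mF (gj0 jm) FA.
  have mAb : measurable (A `&` big j).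
    by apply: measurableI => //; exact: (mF (gj0 jm) (Fbig jm)).
  have i1 := L1Z lev (L1_indic1 P mA); have i2 := L1_indic mAb (LK jm).
  rewrite -mean_indic// -meanZ; last exact: L1_indic1.
  rewrite -meanD//; apply: mean_le; [exact/L1_indic/LK|exact: L1D|move=> w].
  rewrite !indicE in_setI; case: (boolP (w \in A)) => /= [_|_]; last first.
    by rewrite !mul0r mulr0 addr0.
  rewrite mulr1 mul1r; case: (boolP (w \in big j)) => [_|].
    by rewrite mul1r lerDr.
  by rewrite mul0r addr0 notin_setE /big /= => /negP; rewrite -leNgt.
elim: k => [|k IH] km; first by apply: (base _ 0%N) => //; exact: FE.
have {}IH := IH (ltnW km).
have kS := ltW (gS km).
have Fk := reach_event (ltnW km).
have Fk' := FF (gj0 (ltnW km)) kS Fk.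
have Fo := overshoot_event (ltnW km).
have Fo' := FF (gj0 (ltnW km)) kS Fo.
have Fn := Fnew km.
have Fnb : F (g k.+1) ((E k.+1 `\` reach E k) `&` big k.+1).
  by apply: (wrtI (sF (gj0 km))) => //; exact: Fbig.
have disj : reach E k `&` (E k.+1 `\` reach E k) = set0.
  by apply/seteqP; split => // w [? []].
have disj' : overshoot k `&` ((E k.+1 `\` reach E k) `&` big k.+1) = set0.
  by apply/seteqP; split => // w [/overshoot_reach ? [[]]].
have -> : reach E k.+1 = reach E k `|` (E k.+1 `\` reach E k) by rewrite setUDr setDv setD0.
rewrite [overshoot k.+1]/= !meanU// probUd//; [|exact: (mF (gj0 km) Fk')|exact: (mF (gj0 km) Fn)].
rewrite mulrDr addrACA lerD//; last exact: base.
by case: hK => _ _ mK; rewrite !(mK (g k) (g k.+1))//; exact: gj0 (ltnW km).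
Qed.

End along_a_chain.

End martingales.

Section hitting_bounds.
Context {d : measure_display} {T : measurableType d} {R : realType}.
Variable P : probability T R.
Variable F : R -> set (set T).
Hypothesis hF : filtration F.
Local Notation L1 := (L1 P).
Local Notation L2 := (L2 P).
Local Notation mean := (mean P).
Local Notation prob := (prob P).

Let sF (t : R) : 0 <= t -> sigma_algebra setT (F t).
Proof. by case: hF => + _ _; exact. Qed.
Let mF (t : R) : 0 <= t -> F t `<=` measurable.
Proof. by case: hF => _ + _; exact. Qed.

Lemma prob_setC (A : set T) : measurable A -> prob (~` A) = 1 - prob A.
Proof.
move=> mA; apply: EFin_inj; rewrite EFinB -!probE//; last exact: measurableC.
exact: probability_setC.
Qed.

Lemma measurable_stay (f : R -> T -> R) t : adapted F f -> continuous_paths f ->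
  0 <= t -> measurable (stay f t).
Proof. by move=> af cf t0; apply: (mF t0); exact: (stay_event hF). Qed.

Let grids (t : R) : 0 <= t -> exists (m : nat -> nat) (g : nat -> nat -> R),
  forall n, grid t n.+1%:R^-1 (m n) (g n).
Proof.
move=> t0; have G n : exists mg : nat * (nat -> R), grid t n.+1%:R^-1 mg.1 mg.2.
  have n0 : 0 < n.+1%:R^-1 :> R by rewrite invr_gt0.
  have [m [g [gr _]]] := @grid_exists R t _ [::] t0 n0 (fun a => ltac:(by [])).
  by exists (m, g).
exists (fun n => (sval (cid (G n))).1), (fun n => (sval (cid (G n))).2) => n.
by case: cid.
Qed.

(** Doob's maximal inequality, passed to the limit of fine grids. *)
Lemma hit_upper (K Z : R -> T -> R) t : martingale P F K -> continuous_paths K ->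
  (forall s w, 0 <= s -> 0 <= K s w) -> adapted F Z -> continuous_paths Z ->
  (forall s w, 0 <= s -> Z s w <= 0 -> 1 <= K s w) -> 0 <= t ->
  1 - mean (K 0) <= prob (stay Z t).
Proof.
move=> hK cK K0 aZ cZ ZK t0; have [aK lK _] := hK.
have mS := measurable_stay aZ cZ t0.
suff : prob (~` stay Z t) <= mean (K 0) by rewrite prob_setC//; lra.
apply/ler_addgt0Pl => e e0; pose eps := Num.min e (1 / 2).
have eps0 : 0 < eps by rewrite lt_min e0 divr_gt0.
have eps1 : eps < 1 by rewrite gt_min; apply/orP; right; lra.
have [m [g gr]] := grids t0.
pose M n := reach (fun j => [set w | 1 - eps <= K (g n j) w]) (m n).
have gj0 n j : (j <= m n)%N -> 0 <= g n j by move=> /(grid_range (gr n)) /andP[].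
have gS n : forall j, (j < m n)%N -> g n j < g n j.+1 by case: (gr n).
have mM n : measurable (M n).
  have mE j : (j <= m n)%N -> measurable [set w | 1 - eps <= K (g n j) w].
    by move=> jm; apply: measurable_ge; apply: (adapted_meas hF aK); exact: gj0.
  rewrite /M; elim: (m n) mE => [|k IH] mE /=; first exact: mE.
  apply: measurableU; last exact: mE.
  by apply: IH => j jk; apply: mE; exact: leqW.
have Mle n : (1 - eps) * prob (M n) <= mean (K 0).
  have [g0 gm _ _] := gr n.
  have := doob_chain hF hK (eq_ind_r (fun x => 0 <= x) (lexx 0) g0) (gS n) (1 - eps) (leqnn _).
  rewrite -/(M n) gm => /le_trans; apply.
  rewrite -(martingale_mean hF hK t0); apply: mean_le => [||w].
  - exact/L1_indic/lK.
  - exact: lK.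
  - by rewrite indicE; case: (_ \in _); rewrite ?mul1r// mul0r K0.
have lim0 : mean \1_(~` stay Z t `\` M n) @[n --> \oo] --> (0 : R).
  apply: (@mean_cvg0 _ _ _ _ _ (cst 1)) => [n|w|n w|].
  - by apply: measurable_indic; apply: measurableD => //; exact: measurableC.
  - apply: cvg_near_cst; case: (pselect (stay Z t w)) => [Sw|].
      by apply: nearW => n; rewrite indicE memNset//= => -[].
    move=> /existsNP[s /not_implyP[st /negP]]; rewrite -leNgt => Zs.
    have [s0 _] := andP st; have Ks := ZK s w s0 Zs.
    have [del del0 Hdel] := path_unif_cont t (cK w) eps0.
    apply: filterS (near_invS del0) => n ndel; rewrite indicE memNset//= => -[_]; apply.
    have n0 : 0 <= n.+1%:R^-1 :> R by rewrite invr_ge0.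
    have [j jm sj] := grid_near (gr n) st n0.
    apply/reachP; exists j => //=.
    have := Hdel s (g n j) st (grid_range (gr n) jm) (le_trans sj ndel).
    have := ler_norm (K s w - K (g n j) w); lra.
  - by rewrite indicE; case: (_ \in _); rewrite ?normr1 ?normr0.
  - exact: L1_cst.
have mD n : measurable (~` stay Z t `\` M n).
  by apply: measurableD => //; exact: measurableC.
have key : (1 - eps) * prob (~` stay Z t) <= mean (K 0).
  rewrite -subr_le0; apply: (cvgr_to_ge lim0); near=> n.
  rewrite mean_indic//; rewrite lerBlDl; apply: le_trans (lerD (Mle n) (lexx _)).
  apply: (@le_trans _ _ ((1 - eps) * (prob (M n) + prob (~` stay Z t `\` M n)))).
    rewrite ler_wpM2l//; first by lra.
    apply: le_trans (probU P (mM n) (mD n)); apply: le_prob.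
    - exact: measurableC.
    - exact: measurableU.
    - by move=> w H; case: (pselect (M n w)) => Mw; [left|right].
  rewrite mulrDr lerD2l ler_piMl ?prob_ge0//; lra.
have p1 : prob (~` stay Z t) <= 1 by apply: prob_le1; exact: measurableC.
have pe : eps * prob (~` stay Z t) <= eps * 1 by rewrite ler_wpM2l// ltW.
have : eps <= e by rewrite ge_min lexx.
lra.
Unshelve. all: by end_near. Qed.

(** Optional stopping at the first grid time with [Z <= 0]; by continuity the
    overshoot disappears as the grid gets finer. *)
Lemma hit_lower (K Z : R -> T -> R) theta t : martingale P F K ->
  adapted F Z -> continuous_paths Z -> 0 < theta ->
  (forall s w, 0 <= s -> K s w <= expR (- theta * Z s w)) ->
  (forall w, 0 < Z 0 w) -> 0 <= t ->
  mean (K 0) <= prob (~` stay Z t) +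
    mean (fun w => Num.min 1 (expR (- theta * Z t w))).
Proof.
move=> hK aZ cZ th0 KZ Z0 t0; have [aK lK _] := hK.
have mS := measurable_stay aZ cZ t0.
apply/ler_addgt0Pl => e e0.
have [m [g gr]] := grids t0.
have gj0 n j : (j <= m n)%N -> 0 <= g n j by move=> /(grid_range (gr n)) /andP[].
have gS n : forall j, (j < m n)%N -> g n j < g n j.+1 by case: (gr n).
have g00 n : 0 <= g n 0%N by exact: gj0.
have gm n : g n (m n) = t by case: (gr n).
have lev0 : 0 <= 1 + e by lra.
pose A n := reach (fun j => [set w | Z (g n j) w <= 0]) (m n).
pose Ov n := overshoot K (g n) Z (1 + e) (m n).
have FA n : F t (A n) by rewrite -(gm n); exact: (reach_event hF (g00 n) (gS n) aZ).
have FO n : F t (Ov n) by rewrite -(gm n); exact: (overshoot_event hF hK (g00 n) (gS n)).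
have mA n : measurable (A n) by apply: (mF t0); exact: FA.
have mO n : measurable (Ov n) by apply: (mF t0); exact: FO.
have Lt := lK t t0.
have mZt : measurable_fun setT (Z t) by exact: (adapted_meas hF aZ).
pose f w := Num.min 1 (expR (- theta * Z t w)).
have Lf : L1 f.
  apply: (@L1_bnd _ _ _ _ _ 1).
    apply: measurable_minr => //; apply: measurableT_comp => //.
    exact: measurable_funM.
  by move=> w; rewrite /f ger0_norm ?le_min ?ler01 ?expR_ge0// ge_min lexx.
have lim0 : mean (fun w => \1_(Ov n) w * K t w) @[n --> \oo] --> (0 : R).
  apply: (@mean_cvg0 _ _ _ _ _ (fun w => `|K t w|)) => [n|w|n w|].
  - by apply: measurable_funM; [exact: measurable_indic|exact: L1_meas Lt].
  - apply: cvg_near_cst.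
    have c0 : 0 < ln (1 + e) / theta by rewrite divr_gt0// ln_gt0; lra.
    have [del del0 Hdel] := path_unif_cont t (cZ w) c0.
    apply: filterS (near_invS del0) => n ndel; rewrite indicE memNset ?mul0r//=.
    move=> /overshootP; have [-> _ _ gmesh] := gr n.
    move=> [|[j [jm Zj Kj]]]; first by rewrite leNgt Z0.
    have gj : 0 <= g n j.+1 by exact: gj0.
    have : 1 + e < expR (- theta * Z (g n j.+1) w) by exact: lt_le_trans (KZ _ _ gj).
    have e1 : 0 < 1 + e by lra.
    rewrite -{1}(lnK (_ : 1 + e \is Num.pos)) ?posrE// ltr_expR mulNr => H.
    have := Hdel (g n j) (g n j.+1) (grid_range (gr n) (ltnW jm)) (grid_range (gr n) jm).
    rewrite ltr0_norm ?subr_lt0 ?gS// opprB => /(_ (le_trans (gmesh j jm) ndel)).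
    rewrite ltr_pdivlMr//; have := ler_norm (Z (g n j) w - Z (g n j.+1) w).
    move=> /(ler_wpM2r (ltW th0)); have := mulr_gt0 Zj th0; lra.
  - by rewrite indicE; case: (_ \in _); rewrite ?mul1r// mul0r normr0.
  - exact: integrable_norm.
have key n : mean (K 0) - (e + prob (~` stay Z t) + mean f) <=
    mean (fun w => \1_(Ov n) w * K t w).
  have split1 : mean (K t) = mean (fun w => \1_(A n) w * K t w) +
      mean (fun w => \1_(~` A n) w * K t w).
    rewrite -meanD; [|exact: L1_indic|by apply: L1_indic => //; exact: measurableC].
    apply: eq_mean => w; rewrite !indicE in_setC.
    by case: (w \in A n); rewrite /= mul1r mul0r ?addr0 ?add0r.
  rewrite -(martingale_mean hF hK t0) split1.
  have h1 : mean (fun w => \1_(~` A n) w * K t w) <= mean f.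
    apply: mean_le => // [|w]; first by apply: L1_indic => //; exact: measurableC.
    have f0 : 0 <= f w by rewrite le_min ler01 expR_ge0.
    rewrite indicE; case: (boolP (w \in ~` A n)) => [|_]; last by rewrite mul0r.
    rewrite inE mul1r => nA; rewrite le_min KZ// andbT.
    apply: (le_trans (KZ t w t0)); rewrite -expR0 ler_expR mulNr oppr_le0.
    rewrite mulr_ge0 ?(ltW th0)//; apply/ltW; rewrite ltNge; apply/negP => Zt.
    by apply: nA; apply/reachP; exists (m n); rewrite //= gm.
  have := passage_chain hF hK (g00 n) (gS n) aZ lev0 (leqnn (m n)).
  rewrite gm -/(A n) -/(Ov n).
  have pA : prob (A n) <= prob (~` stay Z t).
    apply: le_prob => //; first exact: measurableC.
    move=> w /reachP[j jm Zj] /= /(_ (g n j) (grid_range (gr n) jm)).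
    by rewrite ltNge Zj.
  have p1 : prob (A n) <= 1 by exact: prob_le1.
  have : e * prob (A n) <= e * 1 by rewrite ler_wpM2l// ltW.
  lra.
have : mean (K 0) - (e + prob (~` stay Z t) + mean f) <= 0.
  by apply: (cvgr_to_ge lim0); near=> n; exact: key.
rewrite /f; lra.
Unshelve. all: by end_near. Qed.

(** * Two Brownian motions with drift *)

Definition drifted (z al be m : R) (B V : R -> T -> R) (t : R) (w : T) : R :=
  z + (al * B t w + be * V t w) + m * t.

Lemma drifted_adapted z al be m B V : brownian P F B -> brownian P F V ->
  adapted F (drifted z al be m B V).
Proof.
move=> hB hV t t0; apply: (wrtD (sF t0)); last exact: (wrt_cst (sF t0)).
apply: (wrtD (sF t0)); first exact: (wrt_cst (sF t0)).
apply: (wrtD (sF t0)); apply: (wrtZ (sF t0)).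
  exact: (brownian_adapted hB).
exact: (brownian_adapted hV).
Qed.

Lemma drifted_cont z al be m B V : brownian P F B -> brownian P F V ->
  continuous_paths (drifted z al be m B V).
Proof.
move=> hB hV w; apply: pathD; last by apply: pathZ; exact: path_id.
apply: pathD; first exact: path_cst.
by apply: pathD; apply: pathZ; [exact: (brownian_cont hB)|exact: (brownian_cont hV)].
Qed.

Lemma drifted0 z al be m B V w : brownian P F B -> brownian P F V ->
  drifted z al be m B V 0 w = z.
Proof.
by move=> hB hV; rewrite /drifted (brownian0 hB) (brownian0 hV) !mulr0 !addr0.
Qed.

Lemma brownian_L2 B t : brownian P F B -> 0 < t ->
  L2 (B t) /\ mean (fun w => B t w ^+ 2) <= t.
Proof.
move=> hB t0; have E : B t = (fun w => B t w - B 0 w).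
  by apply/funext => w; rewrite (brownian0 hB) subr0.
rewrite E; split; first exact: (incr_L2 hF hB).
by rewrite (le_trans (incr_var_le hF hB (lexx 0) t0))// subr0.
Qed.

Lemma combination_prob (al be : R) B V (t c : R) : brownian P F B -> brownian P F V ->
  0 < t -> 0 < c ->
  prob [set w | c <= `|al * B t w + be * V t w|] <=
  (c ^+ 2)^-1 * (2 * (al ^+ 2 + be ^+ 2) * t).
Proof.
move=> hB hV t0 c0; have [LB mB] := brownian_L2 hB t0.
have [LV mV] := brownian_L2 hV t0; have [_ LB2] := LB; have [_ LV2] := LV.
have LS : L2 (fun w => al * B t w + be * V t w) by apply: L2D; exact: L2Z.
apply: (le_trans (chebyshev_mean c0 LS)); rewrite ler_wpM2l ?invr_ge0 ?sqr_ge0//.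
apply: (@le_trans _ _ (2 * al ^+ 2 * mean (fun w => B t w ^+ 2) +
    2 * be ^+ 2 * mean (fun w => V t w ^+ 2))).
  rewrite -!meanZ// -meanD; [|exact: L1Z|exact: L1Z].
  apply: mean_le => [||w]; [by case: LS|by apply: L1D; exact: L1Z|].
  have := sqr_ge0 (al * B t w - be * V t w).
  have -> : (al * B t w - be * V t w) ^+ 2 = al ^+ 2 * B t w ^+ 2 +
    be ^+ 2 * V t w ^+ 2 - 2 * (al * B t w) * (be * V t w) by ring.
  have -> : (al * B t w + be * V t w) ^+ 2 = al ^+ 2 * B t w ^+ 2 +
    be ^+ 2 * V t w ^+ 2 + 2 * (al * B t w) * (be * V t w) by ring.
  lra.
have := ler_wpM2l (sqr_ge0 al) mB; have := ler_wpM2l (sqr_ge0 be) mV; lra.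
Qed.

(** Off an event of probability [O(1 / t)], by Chebyshev's inequality, half of
    the drift survives the fluctuations. *)
Lemma drifted_tail (z al be m theta : R) B V : brownian P F B -> brownian P F V ->
  0 < z -> 0 < m -> 0 < theta -> forall e : R, 0 < e ->
  exists2 t, 0 <= t &
    mean (fun w => Num.min 1 (expR (- theta * drifted z al be m B V t w))) <= e.
Proof.
move=> hB hV z0 m0 th0 e e0.
pose C := 2 / (theta * m) + 8 * (al ^+ 2 + be ^+ 2) / m ^+ 2.
have tm0 : 0 < theta * m by rewrite mulr_gt0.
have q0 : 0 <= al ^+ 2 + be ^+ 2 by rewrite addr_ge0 ?sqr_ge0.
have C0 : 0 < C.
  by rewrite /C ltr_wpDr ?divr_gt0// divr_ge0 ?sqr_ge0// mulr_ge0.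
have [t t0 te] : exists2 t, 0 < t & t * e = C.
  by exists (C / e); rewrite ?divr_gt0// divfK ?gt_eqF.
exists t; first exact: ltW.
pose S w := al * B t w + be * V t w.
pose c := m * t / 2; have c0 : 0 < c by rewrite divr_gt0// mulr_gt0.
pose A := [set w | c <= `|S w|].
have mB := brownian_meas hF hB (ltW t0); have mV := brownian_meas hF hV (ltW t0).
have mS : measurable_fun setT S by apply: measurable_funD; exact: measurable_funM.
have mA : measurable A by exact: measurable_ge_norm.
have pA := combination_prob al be hB hV t0 c0.
have mZ : measurable_fun setT (drifted z al be m B V t).
  by exact: (adapted_meas hF (drifted_adapted z al be m hB hV) (ltW t0)).
have exp_le : expR (- (theta * c)) <= 2 / (theta * m * t).
  rewrite expRN -[leRHS]invrK lef_pV2 ?posrE ?expR_gt0 ?invr_gt0 ?divr_gt0 ?mulr_gt0//.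
  rewrite invf_div; apply: le_trans (expR_ge1Dx _); rewrite /c.
  have -> : theta * m * t / 2 = theta * (m * t / 2) by field.
  lra.
apply: (@le_trans _ _ (expR (- (theta * c)) + prob A)).
  rewrite -mean_indic// -[X in _ <= X + _](mean_cst P) -meanD; last 2 first.
  - exact: L1_cst.
  - exact: L1_indic1.
  apply: mean_le => [||w].
  - apply: (@L1_bnd _ _ _ _ _ 1) => [|w].
      apply: measurable_minr => //; apply: measurableT_comp => //.
      exact: measurable_funM.
    by rewrite ger0_norm ?le_min ?ler01 ?expR_ge0// ge_min lexx.
  - by apply: L1D; [exact: L1_cst|exact: L1_indic1].
  - rewrite indicE; case: (boolP (w \in A)) => wA /=.
      by rewrite ge_min lerDr expR_ge0.
    rewrite addr0 ge_min ler_expR mulNr lerN2 ler_wpM2l ?(ltW th0) ?orbT//.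
    move: wA; rewrite notin_setE /A /= => /negP; rewrite -ltNge => Sc.
    rewrite /drifted -/(S w); have := ler_norm (- S w); rewrite normrN.
    have : m * t = c + c by rewrite /c; field.
    lra.
apply: (le_trans (lerD exp_le pA)).
rewrite le_eqVlt; apply/orP; left; apply/eqP.
have -> : 2 / (theta * m * t) + (c ^+ 2)^-1 * (2 * (al ^+ 2 + be ^+ 2) * t) = C / t.
  by rewrite /C /c; field; rewrite !gt_eqF.
by rewrite -te mulrAC divff ?mul1r// gt_eqF.
Qed.

End hitting_bounds.

Lemma expR_convex {R : realType} (lam u v : R) : 0 <= lam -> lam <= 1 ->
  expR (lam * u + (1 - lam) * v) <= lam * expR u + (1 - lam) * expR v.
Proof.
move=> l0 l1; set p := lam * u + _.
have tangent x : expR p * (1 + (x - p)) <= expR x.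
  have := ler_wpM2l (expR_ge0 p) (expR_ge1Dx (x - p)).
  by rewrite -expRD subrKC.
have := ler_wpM2l l0 (tangent u).
have l10 : 0 <= 1 - lam by rewrite subr_ge0.
have := ler_wpM2l l10 (tangent v).
have : lam * (expR p * (1 + (u - p))) + (1 - lam) * (expR p * (1 + (v - p))) = expR p.
  by rewrite /p; ring.
lra.
Qed.

Section comparison.
Context {d : measure_display} {T : measurableType d} {R : realType}.
Variable P : probability T R.
Variable F : R -> set (set T).
Hypothesis hF : filtration F.
Local Notation mean := (mean P).
Local Notation prob := (prob P).

Lemma normal_prob_opp (s : R) (U : set R) : s != 0 -> measurable U ->
  normal_prob 0 s (-%R @^-1` U) = normal_prob 0 s U.
Proof.
move=> s0 mU; rewrite /normal_prob.
transitivity (\int[lebesgue_measure]_(x in (-%R : _ -> measurableTypeR R) @^-1` U)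
    ((fun y => (normal_pdf 0 s y)%:E) \o -%R) x)%E.
  apply: eq_integral => x _ /=; congr (_%:E).
  by rewrite !normal_pdfE// /normal_fun !subr0 sqrrN.
rewrite -ge0_integral_pushforward//=.
- by apply: eq_measure_integral => //= A mA _; exact: lebesgue_measureN.
- by apply: measurable_funTS; apply/measurable_EFinP; exact: measurable_normal_pdf.
- by move=> x _; rewrite lee_fin normal_pdf_ge0.
Qed.

(** The law of the increments is symmetric. *)
Lemma brownian_opp B : brownian P F B -> brownian P F (fun t w => - B t w).
Proof.
move=> hB; case: (hB) => aB cB B0 indB lawB.
have sF (t : R) : 0 <= t -> sigma_algebra setT (F t) by case: hF => + _ _; exact.
have pre s t (U : set R) : (fun w => - B t w - - B s w) @^-1` U =
    (fun w => B t w - B s w) @^-1` (-%R @^-1` U).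
  have E w : - B t w - - B s w = - (B t w - B s w) by ring.
  by apply/seteqP; split => w /=; rewrite E.
have mN (U : set R) : measurable U -> measurable (-%R @^-1` U : set R).
  by move=> mU; rewrite -[X in measurable X]setTI; exact: oppr_measurable.
split.
- by move=> t t0; apply: (wrtN (sF t t0)); exact: aB.
- move=> w; have -> : (fun t => - B t w) = (fun t => (-1) * B t w).
    by apply/funext => t; rewrite mulN1r.
  by apply: pathZ; exact: cB.
- by move=> w; rewrite B0 oppr0.
- by move=> s t s0 st A U FA mU; rewrite pre; apply: indB => //; exact: mN.
- move=> s t s0 st U mU; rewrite pre lawB//; last exact: mN.
  by apply: normal_prob_opp => //; rewrite gt_eqF// sqrtr_gt0 subr_gt0.
Qed.

(** The condition on [theta] makes the compensator of the exponential cancel the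
    drift. *)
Lemma drifted_martingale (z c theta m : R) B : brownian P F B ->
  theta * c ^+ 2 / 2 = m ->
  martingale P F (fun t w => expR (- theta * (z + c * B t w + m * t))).
Proof.
move=> hB thc; set K := (X in martingale _ _ X).
have -> : K = fun t w => expR (- theta * z) *
    expR (- theta * c * B t w - (- theta * c) ^+ 2 / 2 * t).
  apply/funext => t; apply/funext => w; rewrite /K -expRD; congr expR.
  by rewrite -thc; ring.
exact/(martingaleZ hF)/exp_martingale.
Qed.

Lemma drifted_path (z c theta m : R) B : brownian P F B ->
  continuous_paths (fun t w => expR (- theta * (z + c * B t w + m * t))).
Proof.
move=> hB w; apply: (path_comp (@continuous_expR R)); apply: pathZ.
apply: pathD; last by apply: pathZ; exact: path_id.
by apply: pathD; [exact: path_cst|apply: pathZ; exact: (brownian_cont hB)].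
Qed.

(** [al * B + be * V] is a barycentre of [s * B] and [- s * V] for
    [s = al - be].  By convexity of the exponential, the exponential of the
    drifted process lies below a martingale with the same initial value. *)
Lemma survival_ge (z al be m : R) B V t : brownian P F B -> brownian P F V ->
  al * be <= 0 -> al - be != 0 -> 0 < z -> 0 < m -> 0 <= t ->
  1 - expR (- (2 * m / (al - be) ^+ 2) * z) <=
  prob (stay (drifted z al be m B V) t).
Proof.
move=> hB hV ab s0 z0 m0 t0; set s := al - be in s0 *.
pose theta := 2 * m / s ^+ 2; rewrite -/theta; pose lam := al / s.
have ss : 0 < s ^+ 2 by rewrite lt_neqAle sqr_ge0 eq_sym sqrf_eq0 s0.
have th0 : 0 < theta by rewrite divr_gt0// mulr_gt0.
have thc : theta * s ^+ 2 / 2 = m by rewrite /theta; field.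
have thc' : theta * (- s) ^+ 2 / 2 = m by rewrite sqrrN.
have lam0 : 0 <= lam.
  have -> : lam = (al ^+ 2 - al * be) / s ^+ 2 by rewrite /lam /s; field.
  by rewrite divr_ge0 ?sqr_ge0// subr_ge0 (le_trans ab)// sqr_ge0.
have lam1 : lam <= 1.
  rewrite -subr_ge0; have -> : 1 - lam = (be ^+ 2 - al * be) / s ^+ 2.
    by rewrite /lam /s; field.
  by rewrite divr_ge0 ?sqr_ge0// subr_ge0 (le_trans ab)// sqr_ge0.
pose N1 (t : R) w := expR (- theta * (z + s * B t w + m * t)).
pose N2 (t : R) w := expR (- theta * (z + (- s) * V t w + m * t)).
pose K (t : R) w := lam * N1 t w + (1 - lam) * N2 t w.
have hK : martingale P F K.
  apply: (martingaleD hF); apply: (martingaleZ hF).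
    exact: drifted_martingale.
  exact: drifted_martingale.
have K0 w : K 0 w = expR (- theta * z).
  rewrite /K /N1 /N2 (brownian0 hB) (brownian0 hV) !mulr0 !addr0.
  by rewrite -mulrDl subrKC mul1r.
have -> : expR (- theta * z) = mean (K 0) by rewrite (funext K0) mean_cst.
have KZ u w : expR (- theta * drifted z al be m B V u w) <= K u w.
  apply: le_trans (expR_convex _ _ lam0 lam1); rewrite ler_expR.
  rewrite le_eqVlt; apply/orP; left; apply/eqP.
  by rewrite /drifted /lam /s; field.
apply: (hit_upper hF hK) => //.
- move=> w; apply: pathD; apply: pathZ; exact: drifted_path.
- move=> u w _; apply: addr_ge0; apply: mulr_ge0; rewrite ?subr_ge0 ?expR_ge0//.
- exact: (drifted_adapted hF _ _ _ _ hB hV).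
- exact: (drifted_cont hB hV).
- move=> u w _ Zle; apply: le_trans (KZ u w).
  by rewrite -expR0 ler_expR mulNr oppr_ge0 mulr_ge0_le0// ltW.
Qed.

(** [r * B] with [r = al + be] is a barycentre of the drifted process and of
    [r * V], so the exponential of the drifted process lies above a
    combination of two martingales. *)
Lemma survival_le_dominant (z al be m : R) B V : brownian P F B -> brownian P F V ->
  al * be <= 0 -> `|be| <= `|al| -> al + be != 0 -> 0 < z -> 0 < m ->
  forall e : R, 0 < e -> exists2 t, 0 <= t &
  prob (stay (drifted z al be m B V) t) <=
  1 - expR (- (2 * m / (al + be) ^+ 2) * z) + e.
Proof.
move=> hB hV ab beal r0 z0 m0 e e0; set r := al + be in r0 *.
pose theta := 2 * m / r ^+ 2; rewrite -/theta; pose lam := r / al.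
have rr : 0 < r ^+ 2 by rewrite lt_neqAle sqr_ge0 eq_sym sqrf_eq0 r0.
have th0 : 0 < theta by rewrite divr_gt0// mulr_gt0.
have thc : theta * r ^+ 2 / 2 = m by rewrite /theta; field.
have al0 : al != 0.
  apply/eqP => al0; move: beal; rewrite al0 normr0 normr_le0 => /eqP be0.
  by move/eqP: r0; apply; rewrite /r al0 be0 addr0.
have alal : 0 < al ^+ 2 by rewrite lt_neqAle sqr_ge0 eq_sym sqrf_eq0 al0.
have lam0 : 0 < lam.
  rewrite lt_neqAle eq_sym mulf_neq0 ?invr_eq0//=.
  have -> : lam = (al ^+ 2 + al * be) / al ^+ 2 by rewrite /lam /r; field.
  rewrite divr_ge0 ?sqr_ge0// -(real_normK (num_real al)) expr2.
  have : `|al * be| <= `|al| * `|al| by rewrite normrM ler_wpM2l.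
  by have := ler_norm (- (al * be)); rewrite normrN; lra.
have lam1 : lam <= 1.
  rewrite -subr_ge0; have -> : 1 - lam = - (al * be) / al ^+ 2.
    by rewrite /lam /r; field.
  by rewrite divr_ge0 ?sqr_ge0// oppr_ge0.
pose N1 (t : R) w := expR (- theta * (z + r * B t w + m * t)).
pose N2 (t : R) w := expR (- theta * (z + r * V t w + m * t)).
pose K (t : R) w := lam^-1 * N1 t w + (- (lam^-1 * (1 - lam))) * N2 t w.
have hK : martingale P F K.
  apply: (martingaleD hF); apply: (martingaleZ hF).
    exact: drifted_martingale.
  exact: drifted_martingale.
have K0 w : K 0 w = expR (- theta * z).
  rewrite /K /N1 /N2 (brownian0 hB) (brownian0 hV) !mulr0 !addr0.
  by field; rewrite gt_eqF.
have mK0 : mean (K 0) = expR (- theta * z) by rewrite (funext K0) mean_cst.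
have KZ u w : 0 <= u -> K u w <= expR (- theta * drifted z al be m B V u w).
  move=> _; set E := expR _.
  have cv : N1 u w <= lam * E + (1 - lam) * N2 u w.
    apply: le_trans (expR_convex _ _ (ltW lam0) lam1); rewrite ler_expR.
    rewrite le_eqVlt; apply/orP; left; apply/eqP.
    by rewrite /drifted /lam /r; field.
  have lamV : 0 <= lam^-1 by rewrite invr_ge0 ltW.
  have := ler_wpM2l lamV cv; rewrite /K.
  have -> : lam^-1 * (lam * E + (1 - lam) * N2 u w) =
      E + lam^-1 * (1 - lam) * N2 u w by field; rewrite gt_eqF.
  lra.
have [t t0 tail] := drifted_tail hF al be hB hV z0 m0 th0 e0.
exists t => //.
have aZ := drifted_adapted hF z al be m hB hV.
have cZ : continuous_paths (drifted z al be m B V) := drifted_cont hB hV.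
have Z0 w : 0 < drifted z al be m B V 0 w by rewrite (drifted0 _ _ _ _ _ hB hV).
have := hit_lower hF hK aZ cZ th0 KZ Z0 t0.
rewrite prob_setC; last exact: (measurable_stay hF).
rewrite mK0; lra.
Qed.

Lemma survival_le (z al be m : R) B V : brownian P F B -> brownian P F V ->
  al * be <= 0 -> al + be != 0 -> 0 < z -> 0 < m ->
  forall e : R, 0 < e -> exists2 t, 0 <= t &
  prob (stay (drifted z al be m B V) t) <=
  1 - expR (- (2 * m / (al + be) ^+ 2) * z) + e.
Proof.
move=> hB hV ab r0 z0 m0 e e0.
have [le|/ltW le] := leP `|be| `|al|; first exact: survival_le_dominant.
have -> : drifted z al be m B V = drifted z be al m V B.
  by apply/funext => t; apply/funext => w; rewrite /drifted (addrC (al * _)).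
by rewrite (addrC al) in r0 *; apply: survival_le_dominant => //; rewrite mulrC.
Qed.

(** Without an upward drift the process is dominated by one with an
    arbitrarily small upward drift. *)
Lemma survival_le_nonpos (z al be m : R) B V : brownian P F B -> brownian P F V ->
  al * be <= 0 -> al + be != 0 -> 0 < z -> m <= 0 ->
  forall e : R, 0 < e -> exists2 t, 0 <= t &
  prob (stay (drifted z al be m B V) t) <= e.
Proof.
move=> hB hV ab r0 z0 m0 e e0.
have rr : 0 < (al + be) ^+ 2 by rewrite lt_neqAle sqr_ge0 eq_sym sqrf_eq0 r0.
(* 1 - expR (- u) <= u, and this drift makes u equal to e / 2 *)
pose del := e * (al + be) ^+ 2 / (4 * z).
have del0 : 0 < del by rewrite divr_gt0// mulr_gt0.
have e20 : 0 < e / 2 by rewrite divr_gt0.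
have [t t0 Ht] := survival_le hB hV ab r0 z0 del0 e20.
exists t => //.
have small : 1 - expR (- (2 * del / (al + be) ^+ 2) * z) <= e / 2.
  have := expR_ge1Dx (- (2 * del / (al + be) ^+ 2) * z).
  have -> : - (2 * del / (al + be) ^+ 2) * z = - (e / 2).
    by rewrite /del; field; rewrite r0 gt_eqF.
  lra.
have {}Ht : prob (stay (drifted z al be del B V) t) <= e by lra.
apply: le_trans Ht; apply: le_prob.
- by apply: (measurable_stay hF) => //; [exact: (drifted_adapted hF _ _ _ _ hB hV)|exact: (drifted_cont hB hV)].
- by apply: (measurable_stay hF) => //; [exact: (drifted_adapted hF _ _ _ _ hB hV)|exact: (drifted_cont hB hV)].
move=> w H s /andP[s0 st]; apply: (lt_le_trans (H s _)); first by rewrite s0.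
by rewrite /drifted lerD2l ler_wpM2r// (le_trans m0)// ltW.
Qed.

(** A downward drift beats the fluctuations, which are of order the square root
    of time. *)
Lemma survival_le_neg (z al be m : R) B V : brownian P F B -> brownian P F V ->
  0 < z -> m < 0 -> forall e : R, 0 < e -> exists2 t, 0 <= t &
  prob (stay (drifted z al be m B V) t) <= e.
Proof.
move=> hB hV z0 m0 e e0.
pose C := 8 * (al ^+ 2 + be ^+ 2) / m ^+ 2.
have mm : 0 < m ^+ 2 by rewrite lt_neqAle sqr_ge0 eq_sym sqrf_eq0 lt_eqF.
have q0 : 0 <= al ^+ 2 + be ^+ 2 by rewrite addr_ge0 ?sqr_ge0.
have C0 : 0 <= C by rewrite divr_ge0 ?sqr_ge0// mulr_ge0.
have nm : 0 < - m by rewrite oppr_gt0.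
have Ce : 0 <= C / e by exact: divr_ge0 C0 (ltW e0).
have zm : 0 < 2 * z / (- m) by apply: divr_gt0 => //; exact: mulr_gt0.
have [t [t0 tz tC]] : exists t, [/\ 0 < t, z <= - m * t / 2 & C / e <= t].
  exists (2 * z / (- m) + C / e); split; [lra| |lra].
  have -> : - m * (2 * z / (- m) + C / e) / 2 = z + - m * (C / e) / 2.
    by field; rewrite gt_eqF// lt_eqF.
  by rewrite lerDl divr_ge0// (mulr_ge0 (ltW nm) Ce).
exists t; first exact: ltW.
(* t is so large that z is at most half of the distance drifted *)
pose c := - m * t / 2; have c0 : 0 < c by rewrite /c divr_gt0// mulr_gt0.
have aZ := drifted_adapted hF z al be m hB hV.
have cZ : continuous_paths (drifted z al be m B V) := drifted_cont hB hV.
have mB := brownian_meas hF hB (ltW t0); have mV := brownian_meas hF hV (ltW t0).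
apply: (@le_trans _ _ (prob [set w | c <= `|al * B t w + be * V t w|])).
  apply: le_prob.
  - exact: (measurable_stay hF aZ cZ (ltW t0)).
  - apply: measurable_ge_norm; apply: measurable_funD; exact: measurable_funM.
  - move=> w /(_ t); rewrite (ltW t0) lexx => /(_ isT); rewrite /drifted /=.
    have := ler_norm (al * B t w + be * V t w).
    have : - (m * t) = c + c by rewrite /c; field.
    have : z <= c by []. 
    lra.
apply: (le_trans (combination_prob hF al be hB hV t0 c0)).
have -> : (c ^+ 2)^-1 * (2 * (al ^+ 2 + be ^+ 2) * t) = C / t.
  by rewrite /c /C; field; rewrite (gt_eqF t0) (lt_eqF m0).
by rewrite ler_pdivrMr// mulrC -ler_pdivrMr.
Qed.

Let single (z c m : R) (B : R -> T -> R) : drifted z c 0 m B B = fun t w => z + c * B t w + m * t.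
Proof. by apply/funext => t; apply/funext => w; rewrite /drifted mul0r addr0. Qed.

(** For [V] the reflected motion, the drifted process has a single driving
    motion with coefficient [al - be], and [survival_le] shows that the lower
    bound [survival_ge] is attained. *)
Lemma survival_min (z al be m : R) B V : brownian P F B -> brownian P F V ->
  al * be < 0 -> 0 < z -> forall t e : R, 0 <= t -> 0 < e ->
  exists2 u, 0 <= u &
  prob (stay (drifted z al be m B (fun t w => - B t w)) u) <=
  prob (stay (drifted z al be m B V) t) + e.
Proof.
move=> hB hV ab z0 t e t0 e0.
have s0 : al - be != 0.
  apply/eqP => /subr0_eq E; move: ab; rewrite E -expr2 ltNge sqr_ge0//.
have -> : drifted z al be m B (fun t w => - B t w) = drifted z (al - be) 0 m B B.
  rewrite single; apply/funext => u; apply/funext => w; rewrite /drifted; ring.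
have c0 : (al - be) * 0 <= 0 by rewrite mulr0.
have r0 : al - be + 0 != 0 by rewrite addr0.
have [m0|m0] := leP m 0.
  have [u u0 Hu] := survival_le_nonpos hB hB c0 r0 z0 m0 e0.
  by exists u => //; rewrite (le_trans Hu)// lerDr prob_ge0.
have [u u0 Hu] := survival_le hB hB c0 r0 z0 m0 e0.
exists u => //; apply: (le_trans Hu); rewrite addr0 lerD2r.
by apply: survival_ge => //; exact: ltW.
Qed.

(** With the same motion on both sides the coefficient is [al + be], and the
    upper bound [survival_le] is attained by [survival_ge].  If it is 0 the
    process is deterministic. *)
Lemma survival_max (z al be m : R) B V : brownian P F B -> brownian P F V ->
  al * be < 0 -> 0 < z -> forall t e : R, 0 <= t -> 0 < e ->
  exists2 u, 0 <= u &
  prob (stay (drifted z al be m B V) u) <=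
  prob (stay (drifted z al be m B B) t) + e.
Proof.
move=> hB hV ab z0 t e t0 e0.
have pge0 (A : set T) : e <= prob A + e by rewrite lerDr prob_ge0.
have [m0|m0] := ltP m 0.
  have [u u0 Hu] := survival_le_neg al be hB hV z0 m0 e0.
  by exists u => //; exact: le_trans Hu _.
have [r0|r0] := eqVneq (al + be) 0.
  exists t => //; have -> : stay (drifted z al be m B B) t = setT.
    apply/seteqP; split => // w _ s /andP[s0 _].
    by rewrite /drifted -mulrDl r0 mul0r addr0 ltr_wpDr// mulr_ge0.
  apply: (@le_trans _ _ 1); last first.
    by rewrite -mean_indic// indicT mean_cst lerDl ltW.
  apply: prob_le1; apply: (measurable_stay hF) => //.
    exact: (drifted_adapted hF _ _ _ _ hB hV).
  exact: (drifted_cont hB hV).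
move: m0; rewrite le_eqVlt => /predU1P[m0|m0].
  have m0' : m <= 0 by rewrite -m0.
  have [u u0 Hu] := survival_le_nonpos hB hV (ltW ab) r0 z0 m0' e0.
  by exists u => //; exact: le_trans Hu _.
have [u u0 Hu] := survival_le hB hV (ltW ab) r0 z0 m0 e0.
exists u => //; apply: (le_trans Hu); rewrite lerD2r.
have -> : drifted z al be m B B = drifted z (al + be) 0 m B B.
  by rewrite single; apply/funext => v; apply/funext => w; rewrite /drifted mulrDl.
have := @survival_ge z (al + be) 0 m B B t hB hB; rewrite subr0 mulr0; exact.
Qed.

End comparison.

(** * Coupling times and mean tails *)

Section coupling.
Context {d : measure_display} {T : measurableType d} {R : realType}.
Variable P : probability T R.
Local Notation prob := (prob P).
Local Notation mu := (@lebesgue_measure R).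

(** The set of meeting times is closed, so the infimum exceeds [t] as soon as
    there is no meeting up to [t]. *)
Lemma coupling_time_gt (X Y : R -> T -> R) t : continuous_paths X ->
  continuous_paths Y -> 0 <= t ->
  [set w | (t%:E < coupling_time X Y w)%E] = stay (fun s w => `|X s w - Y s w|) t.
Proof.
move=> cX cY t0; apply/seteqP; split => w /=.
  move=> lt s /andP[s0 st]; rewrite normr_gt0 subr_eq0; apply/eqP => XY.
  have : (coupling_time X Y w <= s%:E)%E.
    by apply: ereal_inf_lbound; exists s.
  by move=> /(lt_le_trans lt); rewrite lte_fin ltNge st.
move=> H; pose f s := `|X s w - Y s w|.
have cf : {within `[0, +oo[, continuous f}.
  by apply: (path_comp (@norm_continuous _ R)); apply: pathB; [exact: cX|exact: cY].
have ft : 0 < f t by apply: H; rewrite t0 lexx.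
have [del del0 Hdel] := path_cont cf t0 ft.
apply: (@lt_le_trans _ _ (t + del)%:E); first by rewrite lte_fin ltrDl.
apply: le_ereal_inf_tmp => _ [s [s0 XY] <-]; rewrite lee_fin leNgt; apply/negP => lt.
have fs : f s = 0 by rewrite /f XY subrr normr0.
have [st|ts] := leP s t.
  by have := H s; rewrite -/(f s) fs ltxx s0 st => /(_ isT).
have : `|f t - f s| < f t by apply: Hdel => //; rewrite ltr0_norm; lra.
by rewrite fs subr0 ger0_norm ?ltxx// ltW.
Qed.

Lemma eq_prob_ae (A C : set T) : measurable A -> measurable C ->
  {ae P, forall w, A w <-> C w} -> prob A = prob C.
Proof.
move=> mA mC [ N [mN N0 HN]].
have pN : prob N = 0 by rewrite /prob N0.
have le (A1 A2 : set T) : measurable A1 -> measurable A2 ->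
    (forall w, ~ N w -> A1 w -> A2 w) -> prob A1 <= prob A2.
  move=> m1 m2 H; rewrite -[leRHS]addr0 -pN; apply: le_trans (probU P m2 mN).
  apply: le_prob => //; first exact: measurableU.
  by move=> w A1w; case: (pselect (N w)) => Nw; [right|left; exact: H].
have H w : ~ N w -> A w <-> C w by move=> Nw; apply: contrapT => K; apply: Nw; exact: HN.
apply/eqP; rewrite eq_le; apply/andP.
by split; apply: le => // w Nw; apply (H w Nw).
Qed.

(** Beyond some time [f] is within [e] of its infimum [l]; the times before it
    have a weight of order [1 / u] in the mean over [0, u]. *)
Lemma mean_tail_limit (tau : T -> \bar R) (f : R -> R) (l : R) :
  (forall t, 0 <= t -> P [set w | (t%:E < tau w)%E] = (f t)%:E) ->
  (forall t, 0 <= t -> f t <= 1) ->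
  (forall s t, 0 <= s -> s <= t -> f t <= f s) ->
  0 <= l -> (forall t, 0 <= t -> l <= f t) ->
  (forall e, 0 < e -> exists2 t, 0 <= t & f t <= l + e) ->
  mean_tail P tau = l%:E.
Proof.
move=> Pf f1 fni l0 lf fl; rewrite /mean_tail.
pose I u := (\int[mu]_(t in `[0%R, u]) P [set w | t%:E < tau w])%E.
have IE u : I u = (\int[mu]_(t in `[0%R, u]) (f t)%:E)%E.
  by apply: eq_integral => t; rewrite inE/= in_itv/= => /andP[t0 _]; exact: Pf.
have mf (u : R) : measurable_fun `[0, u] (fun t => (f t)%:E).
  apply/measurable_EFinP.
  have nd : {homo (fun t => - f (Num.max 0 t)) : s t / s <= t}.
    move=> s t st; rewrite lerN2; apply: fni; first by rewrite le_max lexx.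
    by rewrite ge_max !le_max lexx/= st orbT.
  have mnd : measurable_fun `[0, u] (fun t => - (- f (Num.max 0 t))).
    by apply: measurableT_comp => //; exact: nondecreasing_measurable.
  apply: eq_measurable_fun mnd => t; rewrite inE/= in_itv/= => /andP[t0 _].
  by rewrite opprK max_r.
have muu (u : R) : 0 < u -> mu `[0, u] = u%:E.
  by move=> u0; rewrite lebesgue_measure_itv/= lte_fin u0 -EFinB subr0.
have lo u : 0 < u -> ((l * u)%:E <= I u)%E.
  move=> u0; rewrite IE.
  have -> : (l * u)%:E = (\int[mu]_(t in `[0%R, u]) cst l%:E t)%E.
    by rewrite integral_cst//= muu// EFinM.
  apply: ge0_le_integral => //.
  - exact: mf.
  - by move=> t /=; rewrite in_itv/= => /andP[t0 _]; rewrite lee_fin lf.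
have hi u c t1 : 0 < u -> 0 <= t1 -> 0 <= c -> f t1 <= c ->
    (I u <= (t1 + c * u)%:E)%E.
  move=> u0 t10 c0 fc; rewrite IE.
  apply: (@le_trans _ _ (\int[mu]_(t in `[0%R, u])
      ((\1_(`[0, t1] : set R) t)%:E + cst c%:E t))%E).
    apply: ge0_le_integral => //.
    - by move=> t /=; rewrite in_itv/= => /andP[t0 _]; rewrite lee_fin (le_trans l0)// lf.
    - exact: mf.
    - apply: emeasurable_funD => //; apply/measurable_EFinP; apply: measurable_funTS.
      exact: measurable_indic.
    - move=> t /=; rewrite in_itv/= => /andP[t0 _]; rewrite -EFinD lee_fin indicE.
      have [tt|tt] := leP t t1.
        by rewrite mem_set/= ?in_itv/= ?t0// (le_trans (f1 t t0))// lerDl.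
      rewrite memNset/= ?in_itv/= ?t0/= ?add0r; last by apply/negP; rewrite -ltNge.
      exact: le_trans (fni _ _ t10 (ltW tt)) fc.
  rewrite ge0_integralD//; last first.
    by apply/measurable_EFinP; apply: measurable_funTS; exact: measurable_indic.
  rewrite integral_cst//= muu// integral_indic// EFinD EFinM leeD2r//.
  apply: (@le_trans _ _ (mu `[0, t1])).
    by apply: le_measure; rewrite ?inE//; exact: measurableI.
  by rewrite lebesgue_measure_itv/= lte_fin; case: ifP => // _; rewrite -EFinB subr0.
have fin u : 0 < u -> I u \is a fin_num.
  move=> u0; rewrite fin_numElt (lt_le_trans _ (lo u u0)) ?ltNyr//=.
  by rewrite (le_lt_trans (hi u 1 0 u0 _ _ (f1 0 _)))// ltry.
apply: cvg_lim => //; apply/fine_cvgP; split.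
  near=> u; apply: fin_numM => //; apply: fin.
  by near: u; exact: nbhs_pinfty_gt.
apply/cvgrPdist_le => e e0.
have e20 : 0 < e / 2 by rewrite divr_gt0.
have [t1 t10 ft1] := fl _ e20.
near=> u.
have u0 : 0 < u by near: u; exact: nbhs_pinfty_gt.
have ut : t1 / (e / 2) <= u by near: u; apply: nbhs_pinfty_ge; exact: num_real.
rewrite /= -/(I u) fineM ?fin//=.
have lo' : l * u <= fine (I u) by rewrite -lee_fin fineK ?fin// lo.
have hi' : fine (I u) <= t1 + (l + e / 2) * u.
  by rewrite -lee_fin fineK ?fin// hi// addr_ge0// ltW.
have uV : 0 < u^-1 by rewrite invr_gt0.
have t1u : t1 <= e / 2 * u by rewrite mulrC -ler_pdivrMr.
rewrite distrC ger0_norm; last first.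
  by rewrite subr_ge0 mulrC ler_pdivlMr.
rewrite lerBlDr mulrC ler_pdivrMr//; lra.
Unshelve. all: by end_near. Qed.

Lemma path_neq0_gt0 (f : R -> R) (t : R) : {within `[0, +oo[, continuous f} ->
  0 < f 0 -> (forall s, 0 <= s <= t -> f s != 0) ->
  forall s, 0 <= s <= t -> 0 < f s.
Proof.
move=> cf f0 fn s /andP[s0 st]; rewrite ltNge; apply/negP => fs.
have cfs : {within `[0, s], continuous f}.
  by apply: continuous_subspaceW cf => x /=; rewrite !in_itv/= andbT => /andP[].
have [|c] := @IVT R f 0 s 0 s0 cfs; first by rewrite ge_min le_max fs (ltW f0) orbT.
rewrite in_itv/= => /andP[c0 cs] fc; have := fn c.
by rewrite c0 (le_trans cs st) fc eqxx => /(_ isT).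
Qed.

End coupling.

Section geometric_coupling.
Context {d : measure_display} {T : measurableType d} {R : realType}.
Variable P : probability T R.
Variable F : R -> set (set T).
Hypothesis hF : filtration F.
Local Notation prob := (prob P).

Lemma mean_tail_coupling (X Y : R -> T -> R) : adapted F X -> adapted F Y ->
  continuous_paths X -> continuous_paths Y ->
  exists l : R, [/\ mean_tail P (coupling_time X Y) = l%:E,
    forall t, 0 <= t -> l <= prob (stay (fun s w => `|X s w - Y s w|) t)
  & forall e, 0 < e -> exists2 t, 0 <= t &
    prob (stay (fun s w => `|X s w - Y s w|) t) <= l + e].
Proof.
move=> aX aY cX cY; set D := fun s w => `|X s w - Y s w|.
have aD : adapted F D.
  move=> t t0; apply: (wrt_comp (h := Num.norm)); first exact: normr_measurable.
  by apply: wrtB; [case: hF => + _ _; exact|exact: aX|exact: aY].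
have cD : continuous_paths D.
  move=> w; apply: (path_comp (@norm_continuous _ R)).
  by apply: pathB; [exact: cX|exact: cY].
have mS t : 0 <= t -> measurable (stay D t) by exact: (measurable_stay hF).
pose S := [set prob (stay D t) | t in [set t : R | 0 <= t]].
have S0 : S !=set0 by exists (prob (stay D 0)); exists 0 => //=.
have Slb : lbound S 0 by move=> _ [t _ <-]; exact: prob_ge0.
have hi : has_inf S by split => //; exists 0.
have l1 t : 0 <= t -> inf S <= prob (stay D t).
  by move=> t0; apply: (ge_inf hi.2); exists t.
have l2 e : 0 < e -> exists2 t, 0 <= t & prob (stay D t) <= inf S + e.
  by move=> e0; have [_ [t t0 <-] /ltW le] := inf_adherent e0 hi; exists t.
exists (inf S); split => //.
apply: (@mean_tail_limit _ _ _ P _ (fun t => prob (stay D t))) => //.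
- by move=> t t0; rewrite coupling_time_gt// -probE//; exact: mS.
- by move=> t t0; apply: prob_le1; exact: mS.
- move=> s t s0 st; have t0 := le_trans s0 st; apply: le_prob; [exact: mS|exact: mS|].
  by move=> w H r /andP[r0 rs]; apply: H; rewrite r0 (le_trans rs).
- exact: lb_le_inf.
Qed.

Variables (B V : R -> T -> R).
Hypotheses (hB : brownian P F B) (hV : brownian P F V).
Variables (x y sigma1 sigma2 a1 a2 k : R) (X Y : R -> T -> R).
Hypotheses (hX : is_gbm P F x sigma1 a1 B X) (hY : is_gbm P F y sigma2 a2 V Y).
Hypotheses (hx : 0 < x) (hy : 0 < y).

Let mS t : 0 <= t -> measurable (stay (fun s w => `|X s w - Y s w|) t).
Proof.
case: hX => aX cX _; case: hY => aY cY _ t0; apply: (measurable_stay hF) => //.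
  move=> s s0; apply: (wrt_comp (h := Num.norm)); first exact: normr_measurable.
  by apply: wrtB; [case: hF => + _ _; exact|exact: aX|exact: aY].
move=> w; apply: (path_comp (@norm_continuous _ R)).
by apply: pathB; [exact: cX|exact: cY].
Qed.

(** Logarithms turn the two geometric motions into one drifted process; [k] is
    the sign that makes it start above 0. *)
Lemma prob_stay_geometric t : 0 < k * (ln x - ln y) -> 0 <= t ->
  prob (stay (fun s w => `|X s w - Y s w|) t) =
  prob (stay (drifted (k * (ln x - ln y)) (k * sigma1) (- k * sigma2)
    (k * ((a1 - sigma1 ^+ 2 / 2) - (a2 - sigma2 ^+ 2 / 2))) B V) t).
Proof.
move=> z0 t0; set Z := drifted _ _ _ _ _ _.
have cZ : continuous_paths Z := drifted_cont hB hV.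
apply: eq_prob_ae; first exact: mS.
  apply: (measurable_stay hF) => //; exact: (drifted_adapted hF _ _ _ _ hB hV).
apply: filterS2 (gbm_explicit hF hB hX) (gbm_explicit hF hV hY) => w XE YE.
have k0 : k != 0 by apply: contraTN z0 => /eqP ->; rewrite mul0r ltxx.
have key s : 0 <= s -> (0 < `|X s w - Y s w|) = (Z s w != 0).
  move=> s0; rewrite normr_gt0 subr_eq0 XE// YE//.
  set p := geom _ _ _ _ _ _; set q := geom _ _ _ _ _ _.
  have p0 : 0 < p by rewrite mulr_gt0// expR_gt0.
  have q0 : 0 < q by rewrite mulr_gt0// expR_gt0.
  have -> : Z s w = k * (ln p - ln q).
    rewrite /p /q /geom !lnM ?posrE ?expR_gt0// !expRK /Z /drifted.
    by ring.
  rewrite mulf_eq0 (negbTE k0)/= subr_eq0.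
  by rewrite (inj_in_eq (@ln_inj R)) ?posrE.
have Z0 : 0 < Z 0 w by rewrite /Z (drifted0 _ _ _ _ _ hB hV).
split => H s st; have [s0 _] := andP st.
  apply: (path_neq0_gt0 (cZ w) Z0 _ st) => r rt; have [r0 _] := andP rt.
  by rewrite -key// H.
by rewrite key// gt_eqF// H.
Qed.

Lemma prob_stay_equal t : x = y -> 0 <= t ->
  prob (stay (fun s w => `|X s w - Y s w|) t) = 0.
Proof.
move=> xy t0; have -> : 0 = prob set0 by rewrite /prob measure0.
apply: eq_prob_ae => //; first exact: mS.
apply: filterS2 (gbm_explicit hF hB hX) (gbm_explicit hF hV hY) => w XE YE.
split => // /(_ 0); rewrite lexx t0 => /(_ isT); rewrite XE// YE// /geom.
by rewrite (brownian0 hB) (brownian0 hV) !mulr0 !addr0 xy subrr normr0 ltxx.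
Qed.

End geometric_coupling.

Theorem proposition5 (d : measure_display) (T : measurableType d) (R : realType)
    (P : probability T R) (F : R -> set (set T)) (hF : filtration F)
    (B : R -> T -> R) (hB : brownian P F B)
    (x y a1 a2 sigma1 sigma2 : R)
    (hx : 0 < x) (hy : 0 < y) (hsigma : 0 < sigma1 * sigma2)
    (X : R -> T -> R) (hX : is_gbm P F x sigma1 a1 B X)
    (Y : (R -> T -> R) -> (R -> T -> R))
    (hY : forall V, brownian P F V -> is_gbm P F y sigma2 a2 V (Y V)) :
  ereal_inf [set mean_tail P (coupling_time X (Y V)) | V in brownian P F]
    = mean_tail P (coupling_time X (Y (fun t w => - B t w)))
  /\
  ereal_sup [set mean_tail P (coupling_time X (Y V)) | V in brownian P F]
    = mean_tail P (coupling_time X (Y B)).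
Proof.
have hN := brownian_opp hF hB; set NB := (fun t w => - B t w) in hN *.
pose S V := stay (fun s w => `|X s w - Y V s w|).
have tail V : brownian P F V -> exists l : R,
    [/\ mean_tail P (coupling_time X (Y V)) = l%:E,
      forall t, 0 <= t -> l <= prob P (S V t)
    & forall e, 0 < e -> exists2 t, 0 <= t & prob P (S V t) <= l + e].
  move=> hV; have [aX cX _] := hX; have [aY cY _] := hY V hV.
  exact: (@mean_tail_coupling _ _ _ P F hF X (Y V) aX aY cX cY).
(* survival probabilities decrease in time, so a comparison at some later time,
   up to any error, is enough to compare their limits *)
have cmp V W : brownian P F V -> brownian P F W ->
    (forall t e : R, 0 <= t -> 0 < e ->
      exists2 u, 0 <= u & prob P (S V u) <= prob P (S W t) + e) ->
    (mean_tail P (coupling_time X (Y V)) <= mean_tail P (coupling_time X (Y W)))%E.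
  move=> hV hW VW; have [lV [-> lV1 _]] := tail V hV.
  have [lW [-> _ lW2]] := tail W hW; rewrite lee_fin.
  apply/ler_addgt0Pl => e e0; have e20 : 0 < e / 2 by rewrite divr_gt0.
  have [t t0 Ht] := lW2 _ e20; have [u u0 Hu] := VW t _ t0 e20.
  by have := lV1 u u0; lra.
suff [Hinf Hsup] : (forall V, brownian P F V ->
    (mean_tail P (coupling_time X (Y NB)) <=
     mean_tail P (coupling_time X (Y V)))%E) /\
    (forall V, brownian P F V -> (mean_tail P (coupling_time X (Y V)) <=
     mean_tail P (coupling_time X (Y B)))%E).
  split; apply/eqP; rewrite eq_le; apply/andP; split.
  - by apply: ereal_inf_lbound; exists NB.
  - by apply: le_ereal_inf_tmp => _ [V hV <-]; exact: Hinf.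
  - by apply: ge_ereal_sup => _ [V hV <-]; exact: Hsup.
  - by apply: ereal_sup_ubound; exists B.
have [xy|xy] := eqVneq x y.
  have S0 V t : brownian P F V -> 0 <= t -> prob P (S V t) = 0.
    by move=> hV; exact: (prob_stay_equal hF hB hV hX (hY V hV) xy).
  by split => V hV; apply: cmp => // t e t0 e0; exists t => //;
    rewrite !S0// add0r ltW.
have [k z0] : exists k : R, 0 < k * (ln x - ln y).
  have : ln x != ln y by rewrite (inj_in_eq (@ln_inj R)) ?posrE.
  rewrite -subr_eq0 => nz; exists (ln x - ln y).
  by rewrite -expr2 lt_neqAle eq_sym sqrf_eq0 nz sqr_ge0.
have k0 : 0 < k ^+ 2.
  rewrite lt_neqAle sqr_ge0 eq_sym sqrf_eq0 andbT.
  by apply: contraTN z0 => /eqP ->; rewrite mul0r ltxx.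
have ab : (k * sigma1) * (- k * sigma2) < 0.
  have -> : (k * sigma1) * (- k * sigma2) = - (k ^+ 2 * (sigma1 * sigma2)) by ring.
  by rewrite oppr_lt0 mulr_gt0.
have SE V t (hV : brownian P F V) (t0 : 0 <= t) :=
  prob_stay_geometric hF hB hV hX (hY V hV) hx hy z0 t0.
pose m := k * ((a1 - sigma1 ^+ 2 / 2) - (a2 - sigma2 ^+ 2 / 2)).
split => V hV; apply: cmp => // t e t0 e0.
  have [u u0 Hu] := survival_min hF m hB hV ab z0 t0 e0.
  by exists u => //; rewrite /S !SE//; exact: Hu.
have [u u0 Hu] := survival_max hF m hB hV ab z0 t0 e0.
by exists u => //; rewrite /S !SE//; exact: Hu.
Qed.
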